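(* Let $\mathcal B$ be a nondegenerate braided fusion category. Let $\mathcal B^\sharp$ be the canonical self-enriched monoidal category of $\mathcal B$ (with hom objects $\mathcal B^\sharp(x,y)=y\otimes x^*$) and let $Z(\mathcal B^\sharp)$ be its Drinfeld center. Then $Z(\mathcal B^\sharp)\simeq\mathcal B$ as braided monoidal categories enriched over $\mathcal B$, where on the right-hand side $\mathcal B$ is regarded as a braided monoidal category enriched over itself with hom objects $\mathcal B(x,y)\,\mathbf 1$ (that is, via its enrichment over finite-dimensional vector spaces and the canonical embedding of finite-dimensional vector spaces into $\mathcal B$ through the tensor unit).
   Context: Enriched categories. Let $(\mathcal B,\otimes,\mathbf 1)$ be a monoidal category (its associativity and unit isomorphisms are suppressed; $1$ denotes identity morphisms of $\mathcal B$). A category $\mathcal C^\sharp$ enriched over $\mathcal B$ has a set of objects, hom objects $\mathcal C^\sharp(x,y)\in\mathcal B$, identities $\mathrm{id}_x:\mathbf 1\to\mathcal C^\sharp(x,x)$ and compositions $\circ:\mathcal C^\sharp(y,z)\otimes\mathcal C^\sharp(x,y)\to\mathcal C^\sharp(x,z)$ satisfying the usual unit and associativity axioms. Its underlying category $\mathcal C$ has the same objects and $\mathcal C(x,y)=\mathcal B(\mathbf 1,\mathcal C^\sharp(x,y))$. For $f\in\mathcal C(x,y)$, $f\circ-:\mathcal C^\sharp(w,x)\to\mathcal C^\sharp(w,y)$ and $-\circ f:\mathcal C^\sharp(y,w)\to\mathcal C^\sharp(x,w)$ denote composition with $f$. An enriched functor $F$ is a map on objects with morphisms $F:\mathcal C^\sharp(x,y)\to\mathcal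 D^\sharp(F(x),F(y))$ in $\mathcal B$ compatible with identities and compositions. An enriched natural transformation $\xi:F\to G$ is a natural transformation between the underlying functors such that $(\xi_y\circ-)\circ F=(-\circ\xi_x)\circ G$ as morphisms $\mathcal C^\sharp(x,y)\to\mathcal D^\sharp(F(x),G(y))$ for all $x,y$. Products. Let $\mathcal B$ be braided with braiding $c_{x,y}:x\otimes y\to y\otimes x$. $\mathcal C^\sharp\times\mathcal D^\sharp$ has objects $Ob(\mathcal C^\sharp)\times Ob(\mathcal D^\sharp)$, hom objects $(\mathcal C^\sharp\times\mathcal D^\sharp)((x,y),(x',y'))=\mathcal C^\sharp(x,x')\otimes\mathcal D^\sharp(y,y')$, identities $\mathrm{id}_x\otimes\mathrm{id}_y$, and composition $\mathcal C^\sharp(x',x'')\otimes\mathcal D^\sharp(y',y'')\otimes\mathcal C^\sharp(x,x')\otimes\mathcal D^\sharp(y,y')\xrightarrow{1\otimes c^{-1}\otimes1}\mathcal C^\sharp(x',x'')\otimes\mathcal C^\sharp(x,x')\otimes\mathcal D^\sharp(y',y'')\otimes\mathcal D^\sharp(y,y')\xrightarrow{\circ\otimes\circ}\mathcal C^\sharp(x,x'')\otimes\mathcal D^\sharp(y,y'')$, where $c^{-1}$ is the inverse of $c_{\mathcal C^\sharp(x,x'),\mathcal D^\sharp(y',y'')}$. Enriched monoidal categories. A monoidal category enriched over $\mathcal B$ is a category $\mathcal C^\sharp$ enriched over $\mathcal B$ with an object $\mathbf 1_{\mathcal C^\sharp}$, an enriched functor $\otimes:\mathcal C^\sharp\times\mathcal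 C^\sharp\to\mathcal C^\sharp$ and enriched natural isomorphisms $\lambda:\mathbf 1_{\mathcal C^\sharp}\otimes-\to\mathrm{Id}$, $\rho:-\otimes\mathbf 1_{\mathcal C^\sharp}\to\mathrm{Id}$, $\alpha:(-\otimes-)\otimes-\to-\otimes(-\otimes-)$ such that the underlying data define an ordinary monoidal category $\mathcal C$. An enriched monoidal functor is an enriched functor $F:\mathcal C^\sharp\to\mathcal D^\sharp$ with an isomorphism $\mu:F(\mathbf 1_{\mathcal C^\sharp})\to\mathbf 1_{\mathcal D^\sharp}$ and an enriched natural isomorphism $\nu:F(-)\otimes F(-)\to F(-\otimes-)$ such that the underlying data define an ordinary monoidal functor. Enriched braided monoidal categories. An enriched functor $F:\mathcal C^\sharp\times\mathcal D^\sharp\to\mathcal E^\sharp$ is commutative if $F\circ c^2=F$ on every $\mathcal C^\sharp(x,x')\otimes\mathcal D^\sharp(y,y')$, where $c^2$ is the double braiding. Then $F^{\mathrm{rev}}(y,x)=F(x,y)$ together with $\mathcal D^\sharp(y,y')\otimes\mathcal C^\sharp(x,x')\xrightarrow{c}\mathcal C^\sharp(x,x')\otimes\mathcal D^\sharp(y,y')\xrightarrow{F}\mathcal E^\sharp(F(x,y),F(x',y'))$ defines an enriched functor $F^{\mathrm{rev}}:\mathcal D^\sharp\times\mathcal C^\sharp\to\mathcal E^\sharp$. An enriched braided monoidal category is an enriched monoidal category $\mathcal C^\sharp$ with commutative $\otimes$ and an enriched natural isomorphism $\beta:\otimes\to\otimes^{\mathrm{rev}}$ which defines a braiding for $\mathcal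 C$. An enriched braided monoidal functor is an enriched monoidal functor whose underlying monoidal functor is braided. An equivalence of braided monoidal categories enriched over $\mathcal B$ is an enriched braided monoidal functor that is an isomorphism on all hom objects and essentially surjective on underlying categories. Drinfeld center. A half-braiding for $x\in\mathcal C^\sharp$ is an enriched natural isomorphism $b_x:x\otimes-\to-\otimes x$ (components $b_{x,z}:x\otimes z\to z\otimes x$) between enriched endofunctors of $\mathcal C^\sharp$ that defines a half-braiding in the ordinary monoidal category $\mathcal C$. Assume $\mathcal B$ has equalizers and arbitrary intersections of subobjects of any object (true for braided fusion categories). The Drinfeld center $Z(\mathcal C^\sharp)$ is the monoidal category enriched over $\mathcal B$ whose objects are pairs $(x,b_x)$ with $b_x$ a half-braiding for $x$; whose hom object $Z(\mathcal C^\sharp)((x,b_x),(y,b_y))$ is the intersection over all $z\in\mathcal C^\sharp$ of the equalizers of the two morphisms $\mathcal C^\sharp(x,y)\rightrightarrows\mathcal C^\sharp(x\otimes z,z\otimes y)$ given by $\mathcal C^\sharp(x,y)\xrightarrow{\otimes\circ(\mathrm{id}_z\otimes1)}\mathcal C^\sharp(z\otimes x,z\otimes y)\xrightarrow{-\circ b_{x,z}}\mathcal C^\sharp(x\otimes z,z\otimes y)$ and $\mathcal C^\sharp(x,y)\xrightarrow{\otimes\circ(1\otimes\mathrm{id}_z)}\mathcal C^\sharp(x\otimes z,y\otimes z)\xrightarrow{b_{y,z}\circ-}\mathcal C^\sharp(x\otimes z,z\otimes y)$; and whose identities, composition and enriched monoidal structure are induced from those of $\mathcal C^\sharp$ (on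 objects as in the ordinary Drinfeld center $Z(\mathcal C)$). It is an enriched braided monoidal category with braiding $b_{x,y}:x\otimes y\to y\otimes x$. Self-enrichment. For $\mathcal B$ a rigid braided monoidal category, with $x^*$ the left dual of $x$, counit $v_x:x^*\otimes x\to\mathbf 1$ and unit $u_x:\mathbf 1\to x\otimes x^*$, the enriched monoidal category $\mathcal B^\sharp$ has $Ob(\mathcal B^\sharp)=Ob(\mathcal B)$, $\mathcal B^\sharp(x,y)=y\otimes x^*$, composition $(z\otimes y^* )\otimes(y\otimes x^* )\to z\otimes x^*$ induced by $v_y$, $\mathrm{id}_x=u_x$, and tensor product on objects that of $\mathcal B$ and on hom objects $1\otimes c_{x^*,y'\otimes y^*}:(x'\otimes x^* )\otimes(y'\otimes y^* )\to(x'\otimes y')\otimes(x\otimes y)^*$, where $(x\otimes y)^*=y^*\otimes x^*$; the underlying monoidal category is $\mathcal B$. Fusion categories. A multi-fusion category is a rigid semisimple $\mathbb C$-linear monoidal category with finitely many (isomorphism classes of) simple objects and finite-dimensional hom spaces; it is a fusion category if the tensor unit is simple. A braided fusion category is a fusion category with a braiding. An object $x$ of a braided monoidal category is transparent if $c_{y,x}\circ c_{x,y}=1$ for every object $y$. A braided fusion category is nondegenerate if the tensor unit is the unique transparent simple object (up to isomorphism). For a finite-dimensional vector space $V$, $V\,\mathbf 1$ denotes the direct sum of $\dim V$ copies of $\mathbf 1$, i.e. the image of $V$ under the canonical embedding of finite-dimensional vector spaces into $\mathcal B$. *)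

(* Defs.v *)
(* The field of complex numbers is [R[i]] for a [realType] R.  Structures are
   split into their data (a record) and the axioms on these data (a predicate).
   Monoidal categories are not assumed strict: associativity and unit
   isomorphisms are never suppressed. *)
From mathcomp Require Import all_boot all_order all_algebra.
From mathcomp Require Import complex.
From mathcomp Require Import reals.

Set Implicit Arguments.
Unset Strict Implicit.
Unset Printing Implicit Defensive.

Import GRing.Theory.
Local Open Scope ring_scope.

Record cat_data := CatData {
  Ob :> Type;
  Mor : Ob -> Ob -> Type;
  mid : forall x, Mor x x;
  mcomp : forall x y z, Mor y z -> Mor x y -> Mor x z
}.
Arguments mid {c} x.

Notation "g ∘ f" := (mcomp g f) (at level 50, left associativity).

Definition is_category (C : cat_data) : Prop :=
  [/\ forall (x y : C) (f : Mor x y), mid y ∘ f = f,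
      forall (x y : C) (f : Mor x y), f ∘ mid x = f
    & forall (w x y z : C) (h : Mor y z) (g : Mor x y) (f : Mor w x),
        h ∘ (g ∘ f) = h ∘ g ∘ f].

(* The two morphisms are inverse to each other only under [mutually_inverse]. *)
Record isopair (C : cat_data) (x y : C) := IsoPair {
  fwd :> Mor x y;
  bwd : Mor y x
}.

Definition mutually_inverse (C : cat_data) (x y : C) (f : isopair x y) : Prop :=
  fwd f ∘ bwd f = mid y /\ bwd f ∘ fwd f = mid x.

Definition is_iso (C : cat_data) (x y : C) (f : Mor x y) : Prop :=
  exists g : Mor y x, mutually_inverse (IsoPair f g).

Definition isomorphic (C : cat_data) (x y : C) : Prop :=
  exists f : Mor x y, is_iso f.

Definition is_mono (C : cat_data) (x y : C) (f : Mor x y) : Prop :=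
  forall (t : C) (g h : Mor t x), f ∘ g = f ∘ h -> g = h.

Definition is_epi (C : cat_data) (x y : C) (f : Mor x y) : Prop :=
  forall (t : C) (g h : Mor y t), g ∘ f = h ∘ f -> g = h.

Definition is_equalizer (C : cat_data) (x y : C) (f g : Mor x y)
    (e : C) (m : Mor e x) : Prop :=
  f ∘ m = g ∘ m /\
  forall (t : C) (h : Mor t x), f ∘ h = g ∘ h -> exists! k : Mor t e, m ∘ k = h.

Definition is_coequalizer (C : cat_data) (x y : C) (f g : Mor x y)
    (e : C) (q : Mor y e) : Prop :=
  q ∘ f = q ∘ g /\
  forall (t : C) (h : Mor y t), h ∘ f = h ∘ g -> exists! k : Mor e t, k ∘ q = h.

Definition factors_through (C : cat_data) (s t x : C)
    (h : Mor s x) (m : Mor t x) : Prop :=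
  exists k : Mor s t, m ∘ k = h.

(* [m] is the intersection of the family of subobjects [(e i, n i)] of [x]. *)
Definition is_intersection (C : cat_data) (x : C) (I : Type) (e : I -> C)
    (n : forall i, Mor (e i) x) (s : C) (m : Mor s x) : Prop :=
  [/\ is_mono m,
      forall i, factors_through m (n i)
    & forall (t : C) (h : Mor t x),
        (forall i, factors_through h (n i)) -> factors_through h m].

Record mon_struct (C : cat_data) := MonStruct {
  ms_unit : C;
  ms_ten : C -> C -> C;
  ms_tenm : forall x x' y y' : C,
    Mor x x' -> Mor y y' -> Mor (ms_ten x y) (ms_ten x' y');
  ms_asc : forall x y z : C,
    isopair (ms_ten (ms_ten x y) z) (ms_ten x (ms_ten y z));
  ms_lun : forall x : C, isopair (ms_ten ms_unit x) x;
  ms_run : forall x : C, isopair (ms_ten x ms_unit) x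
}.

Record mon_data := MonData {
  md_cat :> cat_data;
  md_str : mon_struct md_cat
}.

Definition tunit (C : mon_data) : C := ms_unit (md_str C).
Definition ten (C : mon_data) (x y : C) : C := ms_ten (md_str C) x y.
Definition tenm (C : mon_data) (x x' y y' : C) (f : Mor x x') (g : Mor y y') :
  Mor (ten x y) (ten x' y') := ms_tenm (md_str C) f g.
Definition asc (C : mon_data) (x y z : C) :
  isopair (ten (ten x y) z) (ten x (ten y z)) := ms_asc (md_str C) x y z.
Definition lun (C : mon_data) (x : C) : isopair (ten (tunit C) x) x :=
  ms_lun (md_str C) x.
Definition run (C : mon_data) (x : C) : isopair (ten x (tunit C)) x :=
  ms_run (md_str C) x.

Notation "x ⊗ y" := (ten x y) (at level 40, left associativity).
Notation "f ⊠ g" := (tenm f g) (at level 40, left associativity).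
Notation "𝟙" := (tunit _) (at level 0).

Definition is_monoidal (C : mon_data) : Prop :=
  is_category C /\
  (forall x y : C, mid x ⊠ mid y = mid (x ⊗ y)) /\
  (forall (x x' x'' y y' y'' : C) (f' : Mor x' x'') (f : Mor x x')
     (g' : Mor y' y'') (g : Mor y y'),
     (f' ∘ f) ⊠ (g' ∘ g) = (f' ⊠ g') ∘ (f ⊠ g)) /\
  (forall x y z : C, mutually_inverse (asc x y z)) /\
  (forall x : C, mutually_inverse (lun x)) /\
  (forall x : C, mutually_inverse (run x)) /\
  (forall (x x' y y' z z' : C) (f : Mor x x') (g : Mor y y') (h : Mor z z'),
     asc x' y' z' ∘ ((f ⊠ g) ⊠ h) = (f ⊠ (g ⊠ h)) ∘ asc x y z) /\
  (forall (x y : C) (f : Mor x y), lun y ∘ (mid 𝟙 ⊠ f) = f ∘ lun x) /\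
  (forall (x y : C) (f : Mor x y), run y ∘ (f ⊠ mid 𝟙) = f ∘ run x) /\
  (forall w x y z : C,
     asc w x (y ⊗ z) ∘ asc (w ⊗ x) y z =
     (mid w ⊠ asc x y z) ∘ asc w (x ⊗ y) z ∘ (asc w x y ⊠ mid z)) /\
  (forall x y : C, (mid x ⊠ lun y) ∘ asc x 𝟙 y = run x ⊠ mid y).

Record br_data := BrData {
  bd_mon :> mon_data;
  brd : forall x y : bd_mon, isopair (x ⊗ y) (y ⊗ x)
}.

Definition is_braided (C : br_data) : Prop :=
  is_monoidal C /\
  (forall x y : C, mutually_inverse (brd x y)) /\
  (forall (x x' y y' : C) (f : Mor x x') (g : Mor y y'),
     brd x' y' ∘ (f ⊠ g) = (g ⊠ f) ∘ brd x y) /\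
  (forall x y z : C,
     asc y z x ∘ brd x (y ⊗ z) ∘ asc x y z =
     (mid y ⊠ brd x z) ∘ asc y x z ∘ (brd x y ⊠ mid z)) /\
  (forall x y z : C,
     bwd (asc z x y) ∘ brd (x ⊗ y) z ∘ bwd (asc x y z) =
     (brd x z ⊠ mid y) ∘ bwd (asc x z y) ∘ (mid x ⊠ brd y z)).

Definition is_half_braiding (C : mon_data) (x : C)
    (b : forall z : C, Mor (x ⊗ z) (z ⊗ x)) : Prop :=
  [/\ forall z, is_iso (b z),
      forall (z w : C) (f : Mor z w), b w ∘ (mid x ⊠ f) = (f ⊠ mid x) ∘ b z
    & forall z w : C,
        asc z w x ∘ b (z ⊗ w) ∘ asc x z w =
        (mid z ⊠ b w) ∘ asc z x w ∘ (b z ⊠ mid w)].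

Record fun_data (C D : cat_data) := FunData {
  fob :> C -> D;
  fmor : forall x y : C, Mor x y -> Mor (fob x) (fob y)
}.

Definition is_functor (C D : cat_data) (F : fun_data C D) : Prop :=
  (forall x : C, fmor F (mid x) = mid (F x)) /\
  (forall (x y z : C) (g : Mor y z) (f : Mor x y),
     fmor F (g ∘ f) = fmor F g ∘ fmor F f).

Record mfun_data (C D : mon_data) := MFunData {
  mf_fun :> fun_data C D;
  mf_unit : Mor (mf_fun 𝟙) 𝟙;
  mf_ten : forall x y : C, Mor (mf_fun x ⊗ mf_fun y) (mf_fun (x ⊗ y))
}.

Definition is_monoidal_functor (C D : mon_data) (F : mfun_data C D) : Prop :=
  is_functor F /\
  is_iso (mf_unit F) /\
  (forall x y : C, is_iso (mf_ten F x y)) /\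
  (forall (x x' y y' : C) (f : Mor x x') (g : Mor y y'),
     mf_ten F x' y' ∘ (fmor F f ⊠ fmor F g) =
     fmor F (f ⊠ g) ∘ mf_ten F x y) /\
  (forall x y z : C,
     fmor F (asc x y z) ∘ mf_ten F (x ⊗ y) z ∘ (mf_ten F x y ⊠ mid (F z)) =
     mf_ten F x (y ⊗ z) ∘ (mid (F x) ⊠ mf_ten F y z)
       ∘ asc (F x) (F y) (F z)) /\
  (forall x : C,
     fmor F (lun x) ∘ mf_ten F 𝟙 x = lun (F x) ∘ (mf_unit F ⊠ mid (F x))) /\
  (forall x : C,
     fmor F (run x) ∘ mf_ten F x 𝟙 = run (F x) ∘ (mid (F x) ⊠ mf_unit F)).

Definition is_braided_functor (C D : br_data) (F : mfun_data C D) : Prop :=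
  is_monoidal_functor F /\
  (forall x y : C,
     fmor F (brd x y) ∘ mf_ten F x y = mf_ten F y x ∘ brd (F x) (F y)).

Record ecat_data (B : mon_data) := ECatData {
  eob :> Type;
  ehom : eob -> eob -> B;
  eid : forall x, Mor 𝟙 (ehom x x);
  ecomp : forall x y z, Mor (ehom y z ⊗ ehom x y) (ehom x z)
}.
Arguments eid {B e} x.
Arguments ecomp {B e} x y z.

Definition is_ecategory (B : mon_data) (C : ecat_data B) : Prop :=
  [/\ forall w x y z : C,
        ecomp w x z ∘ (ecomp x y z ⊠ mid (ehom w x)) =
        ecomp w y z ∘ (mid (ehom y z) ⊠ ecomp w x y)
          ∘ asc (ehom y z) (ehom x y) (ehom w x),
      forall x y : C,
        ecomp x y y ∘ (eid y ⊠ mid (ehom x y)) = lun (ehom x y)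
    & forall x y : C,
        ecomp x x y ∘ (mid (ehom x y) ⊠ eid x) = run (ehom x y)].

Definition underlying (B : mon_data) (C : ecat_data B) : cat_data := {|
  Ob := C;
  Mor := fun x y => Mor 𝟙 (ehom x y);
  mid := fun x => eid x;
  mcomp := fun x y z g f => ecomp x y z ∘ (g ⊠ f) ∘ bwd (lun 𝟙)
|}.

Definition uHom (B : mon_data) (C : ecat_data B) (x y : C) : Type :=
  @Mor (underlying C) x y.
Definition uisopair (B : mon_data) (C : ecat_data B) (x y : C) : Type :=
  @isopair (underlying C) x y.

Definition postcomp (B : mon_data) (C : ecat_data B) (w x y : C)
    (f : uHom x y) : Mor (ehom w x) (ehom w y) :=
  ecomp w x y ∘ (f ⊠ mid (ehom w x)) ∘ bwd (lun (ehom w x)).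
Definition precomp (B : mon_data) (C : ecat_data B) (w x y : C)
    (f : uHom x y) : Mor (ehom y w) (ehom x w) :=
  ecomp x y w ∘ (mid (ehom y w) ⊠ f) ∘ bwd (run (ehom y w)).

Record efun_data (B : mon_data) (C D : ecat_data B) := EFunData {
  fo :> C -> D;
  fm : forall x y : C, Mor (ehom x y) (ehom (fo x) (fo y))
}.

Definition is_efunctor (B : mon_data) (C D : ecat_data B)
    (F : efun_data C D) : Prop :=
  (forall x : C, fm F x x ∘ eid x = eid (F x)) /\
  (forall x y z : C,
     fm F x z ∘ ecomp x y z =
     ecomp (F x) (F y) (F z) ∘ (fm F y z ⊠ fm F x y)).

Definition underlying_fun (B : mon_data) (C D : ecat_data B)
    (F : efun_data C D) : fun_data (underlying C) (underlying D) :=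
  @FunData (underlying C) (underlying D) F (fun x y f => fm F x y ∘ f).

Definition is_enat (B : mon_data) (C D : ecat_data B) (F G : efun_data C D)
    (xi : forall x : C, uHom (F x) (G x)) : Prop :=
  (forall (x y : C) (f : uHom x y),
     @mcomp (underlying D) _ _ _ (xi y) (fmor (underlying_fun F) f) =
     @mcomp (underlying D) _ _ _ (fmor (underlying_fun G) f) (xi x)) /\
  (forall x y : C,
     postcomp (F x) (xi y) ∘ fm F x y = precomp (G y) (xi x) ∘ fm G x y).

Definition is_enat_iso (B : mon_data) (C D : ecat_data B)
    (F G : efun_data C D) (xi : forall x : C, uHom (F x) (G x)) : Prop :=
  is_enat xi /\ (forall x : C, @is_iso (underlying D) _ _ (xi x)).

Definition efun_id (B : mon_data) (C : ecat_data B) : efun_data C C :=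
  EFunData (fun x y : C => mid (ehom x y)).

Definition efun_comp (B : mon_data) (C D E : ecat_data B)
    (G : efun_data D E) (F : efun_data C D) : efun_data C E :=
  @EFunData B C E (fun x => G (F x))
    (fun x y => fm G (F x) (F y) ∘ fm F x y).

(* the morphism [1 ⊗ c^{-1} ⊗ 1], where [c] is the braiding [brd y b] *)
Definition interchange (B : br_data) (a b y d : B) :
    Mor ((a ⊗ b) ⊗ (y ⊗ d)) ((a ⊗ y) ⊗ (b ⊗ d)) :=
  bwd (asc a y (b ⊗ d))
  ∘ (mid a ⊠ (asc y b d ∘ (bwd (brd y b) ⊠ mid d) ∘ bwd (asc b y d)))
  ∘ asc a b (y ⊗ d).

Definition eprod (B : br_data) (C D : ecat_data B) : ecat_data B := {|
  eob := (C * D)%type;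
  ehom := fun p q => ehom p.1 q.1 ⊗ ehom p.2 q.2;
  eid := fun p => (eid p.1 ⊠ eid p.2) ∘ bwd (lun 𝟙);
  ecomp := fun p q r =>
    (ecomp p.1 q.1 r.1 ⊠ ecomp p.2 q.2 r.2)
    ∘ interchange (ehom q.1 r.1) (ehom q.2 r.2) (ehom p.1 q.1) (ehom p.2 q.2)
|}.

Definition efun_prod (B : br_data) (C C' D D' : ecat_data B)
    (F : efun_data C C') (G : efun_data D D') :
    efun_data (eprod C D) (eprod C' D') :=
  @EFunData B (eprod C D) (eprod C' D') (fun p => (F p.1, G p.2))
    (fun p q => fm F p.1 q.1 ⊠ fm G p.2 q.2).

Definition efun_assoc (B : br_data) (C D E : ecat_data B) :
    efun_data (eprod (eprod C D) E) (eprod C (eprod D E)) :=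
  @EFunData B (eprod (eprod C D) E) (eprod C (eprod D E))
    (fun p => (p.1.1, (p.1.2, p.2)))
    (fun p q => fwd (asc (ehom p.1.1 q.1.1) (ehom p.1.2 q.1.2)
                         (ehom p.2 q.2))).

Definition efun_fixl (B : br_data) (C D E : ecat_data B)
    (F : efun_data (eprod C D) E) (x : C) : efun_data D E :=
  @EFunData B D E (fun z => F (x, z))
    (fun z w => fm F (x, z) (x, w) ∘ (eid x ⊠ mid (ehom z w))
                  ∘ bwd (lun (ehom z w))).
Definition efun_fixr (B : br_data) (C D E : ecat_data B)
    (F : efun_data (eprod C D) E) (y : D) : efun_data C E :=
  @EFunData B C E (fun z => F (z, y))
    (fun z w => fm F (z, y) (w, y) ∘ (mid (ehom z w) ⊠ eid y)
                  ∘ bwd (run (ehom z w))).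

Definition efun_commutative (B : br_data) (C D E : ecat_data B)
    (F : efun_data (eprod C D) E) : Prop :=
  forall p q : eprod C D,
    fm F p q ∘ (brd (ehom p.2 q.2) (ehom p.1 q.1)
                  ∘ brd (ehom p.1 q.1) (ehom p.2 q.2)) = fm F p q.

Definition efun_rev (B : br_data) (C D E : ecat_data B)
    (F : efun_data (eprod C D) E) : efun_data (eprod D C) E :=
  @EFunData B (eprod D C) E (fun p => F (p.2, p.1))
    (fun p q => fm F (p.2, p.1) (q.2, q.1)
                  ∘ brd (ehom p.1 q.1) (ehom p.2 q.2)).

Record emon_data (B : br_data) := EMonData {
  em_cat :> ecat_data B;
  em_unit : em_cat;
  em_ten : em_cat -> em_cat -> em_cat;
  em_tenm : forall x x' y y' : em_cat,
    Mor (ehom x x' ⊗ ehom y y') (ehom (em_ten x y) (em_ten x' y'));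
  em_asc : forall x y z : em_cat,
    uisopair (em_ten (em_ten x y) z) (em_ten x (em_ten y z));
  em_lun : forall x : em_cat, uisopair (em_ten em_unit x) x;
  em_run : forall x : em_cat, uisopair (em_ten x em_unit) x
}.
Arguments em_unit {B} e.
Arguments em_tenm {B e} x x' y y'.

Definition eten (B : br_data) (C : emon_data B) : efun_data (eprod C C) C :=
  @EFunData B (eprod C C) C (fun p => em_ten p.1 p.2)
    (fun p q => em_tenm p.1 q.1 p.2 q.2).

Definition underlying_mon (B : br_data) (C : emon_data B) : mon_data :=
  @MonData (underlying C) (@MonStruct (underlying C)
    (em_unit C) (@em_ten B C)
    (fun (x x' y y' : C) (f : uHom x x') (g : uHom y y') =>
       em_tenm x x' y y' ∘ (f ⊠ g) ∘ bwd (lun 𝟙))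
    (@em_asc B C) (@em_lun B C) (@em_run B C)).

Definition is_emonoidal (B : br_data) (C : emon_data B) : Prop :=
  is_ecategory C /\
  is_efunctor (eten C) /\
  is_enat_iso (F := efun_fixl (eten C) (em_unit C)) (G := efun_id C)
    (fun x => fwd (em_lun x)) /\
  is_enat_iso (F := efun_fixr (eten C) (em_unit C)) (G := efun_id C)
    (fun x => fwd (em_run x)) /\
  is_enat_iso
    (F := efun_comp (eten C) (efun_prod (eten C) (efun_id C)))
    (G := efun_comp (eten C)
            (efun_comp (efun_prod (efun_id C) (eten C)) (efun_assoc C C C)))
    (fun p => fwd (em_asc p.1.1 p.1.2 p.2)) /\
  is_monoidal (underlying_mon C).

Record emfun_data (B : br_data) (C D : emon_data B) := EMFunData {
  emf_fun :> efun_data C D;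
  emf_unit : uHom (emf_fun (em_unit C)) (em_unit D);
  emf_ten : forall x y : C,
    uHom (em_ten (emf_fun x) (emf_fun y)) (emf_fun (em_ten x y))
}.

Definition underlying_mfun (B : br_data) (C D : emon_data B)
    (F : emfun_data C D) : mfun_data (underlying_mon C) (underlying_mon D) :=
  @MFunData (underlying_mon C) (underlying_mon D)
    (underlying_fun F) (emf_unit F) (@emf_ten B C D F).

Definition is_emonoidal_functor (B : br_data) (C D : emon_data B)
    (F : emfun_data C D) : Prop :=
  is_efunctor F /\
  is_enat_iso
    (F := efun_comp (eten D) (efun_prod F F)) (G := efun_comp F (eten C))
    (fun p => emf_ten F p.1 p.2) /\
  is_monoidal_functor (underlying_mfun F).

Record ebr_data (B : br_data) := EBrData {
  eb_mon :> emon_data B;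
  eb_brd : forall x y : eb_mon, uisopair (em_ten x y) (em_ten y x)
}.

Definition underlying_br (B : br_data) (C : ebr_data B) : br_data :=
  @BrData (underlying_mon C) (@eb_brd B C).

Definition is_ebraided (B : br_data) (C : ebr_data B) : Prop :=
  is_emonoidal C /\
  efun_commutative (eten C) /\
  is_enat_iso (F := eten C) (G := efun_rev (eten C))
    (fun p => fwd (eb_brd p.1 p.2)) /\
  is_braided (underlying_br C).

Definition is_ebraided_equivalence (B : br_data) (C D : ebr_data B)
    (F : emfun_data C D) : Prop :=
  is_emonoidal_functor F /\
  is_braided_functor (C := underlying_br C) (D := underlying_br D)
    (underlying_mfun F) /\
  (forall x y : C, is_iso (fm F x y)) /\
  (forall d : D, exists c : C, @isomorphic (underlying D) (F c) d).

Definition ebraided_equivalent (B : br_data) (C D : ebr_data B) : Prop :=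
  [/\ is_ebraided C, is_ebraided D
    & exists F : emfun_data C D, is_ebraided_equivalence F].

Definition is_ehalf_braiding (B : br_data) (C : emon_data B) (x : C)
    (b : forall z : C, uHom (em_ten x z) (em_ten z x)) : Prop :=
  is_enat_iso (F := efun_fixl (eten C) x) (G := efun_fixr (eten C) x) b /\
  @is_half_braiding (underlying_mon C) x b.

Record center_ob (B : br_data) (C : emon_data B) := CenterOb {
  co_ob :> C;
  co_hb : forall z : C, uHom (em_ten co_ob z) (em_ten z co_ob);
  co_hbP : is_ehalf_braiding co_hb
}.

Definition center_eql (B : br_data) (C : emon_data B) (X Y : center_ob C)
    (z : C) : Mor (ehom (X : C) Y) (ehom (em_ten X z) (em_ten z Y)) :=
  precomp (em_ten z Y) (co_hb X z) ∘ fm (efun_fixl (eten C) z) X Y.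
Definition center_eqr (B : br_data) (C : emon_data B) (X Y : center_ob C)
    (z : C) : Mor (ehom (X : C) Y) (ehom (em_ten X z) (em_ten z Y)) :=
  postcomp (em_ten X z) (co_hb Y z) ∘ fm (efun_fixr (eten C) z) X Y.

Definition is_center_hom (B : br_data) (C : emon_data B) (X Y : center_ob C)
    (h : B) (m : Mor h (ehom (X : C) Y)) : Prop :=
  exists (e : C -> B) (n : forall z, Mor (e z) (ehom (X : C) Y)),
    (forall z, is_equalizer (center_eql X Y z) (center_eqr X Y z) (n z)) /\
    is_intersection n m.

(* the half-braidings of the ordinary Drinfeld center for the tensor unit and
   for tensor products *)
Definition hb_unit (C : mon_data) (z : C) : Mor (𝟙 ⊗ z) (z ⊗ 𝟙) :=
  bwd (run z) ∘ lun z.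
Definition hb_ten (C : mon_data) (x y : C)
    (b : forall z, Mor (x ⊗ z) (z ⊗ x)) (b' : forall z, Mor (y ⊗ z) (z ⊗ y))
    (z : C) : Mor ((x ⊗ y) ⊗ z) (z ⊗ (x ⊗ y)) :=
  asc z x y ∘ (b z ⊠ mid y) ∘ bwd (asc x z y) ∘ (mid x ⊠ b' z) ∘ asc x y z.

(* Limits are only defined up to isomorphism.  [drinfeld_center C] consists of
   a choice of the hom objects, as subobjects [dc_inc] of those of C, and of
   the structure they inherit: all the data are determined by this choice,
   because the inclusions are monomorphisms. *)
Record drinfeld_center (B : br_data) (C : emon_data B) := DrinfeldCenter {
  dc_hom : center_ob C -> center_ob C -> B;
  dc_inc : forall X Y, Mor (dc_hom X Y) (ehom (X : C) Y);
  dc_homP : forall X Y, is_center_hom (dc_inc X Y);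

  dc_id : forall X, Mor 𝟙 (dc_hom X X);
  dc_idP : forall X, dc_inc X X ∘ dc_id X = eid (X : C);
  dc_comp : forall X Y Z, Mor (dc_hom Y Z ⊗ dc_hom X Y) (dc_hom X Z);
  dc_compP : forall X Y Z,
    dc_inc X Z ∘ dc_comp X Y Z =
    ecomp (X : C) Y Z ∘ (dc_inc Y Z ⊠ dc_inc X Y);
  dc_cat : ecat_data B := ECatData dc_id dc_comp;

  dc_unitP : is_ehalf_braiding (x := em_unit C) (@hb_unit (underlying_mon C));
  dc_unit : center_ob C := CenterOb dc_unitP;
  dc_tenP : forall X Y : center_ob C,
    is_ehalf_braiding (x := em_ten X Y)
      (@hb_ten (underlying_mon C) (co_ob X) (co_ob Y) (co_hb X) (co_hb Y));
  dc_ten : center_ob C -> center_ob C -> center_ob C :=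
    fun X Y => CenterOb (dc_tenP X Y);
  dc_tenm : forall X X' Y Y',
    Mor (dc_hom X X' ⊗ dc_hom Y Y') (dc_hom (dc_ten X Y) (dc_ten X' Y'));
  dc_tenmP : forall X X' Y Y',
    dc_inc (dc_ten X Y) (dc_ten X' Y') ∘ dc_tenm X X' Y Y' =
    em_tenm (X : C) X' Y Y' ∘ (dc_inc X X' ⊠ dc_inc Y Y');

  dc_asc : forall X Y Z : dc_cat,
    uisopair (dc_ten (dc_ten X Y) Z : dc_cat) (dc_ten X (dc_ten Y Z));
  dc_ascP : forall X Y Z : center_ob C,
    dc_inc _ _ ∘ fwd (dc_asc X Y Z) = fwd (em_asc (X : C) Y Z) /\
    dc_inc _ _ ∘ bwd (dc_asc X Y Z) = bwd (em_asc (X : C) Y Z);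
  dc_lun : forall X : dc_cat, uisopair (dc_ten dc_unit X : dc_cat) X;
  dc_lunP : forall X : center_ob C,
    dc_inc _ _ ∘ fwd (dc_lun X) = fwd (em_lun (X : C)) /\
    dc_inc _ _ ∘ bwd (dc_lun X) = bwd (em_lun (X : C));
  dc_run : forall X : dc_cat, uisopair (dc_ten X dc_unit : dc_cat) X;
  dc_runP : forall X : center_ob C,
    dc_inc _ _ ∘ fwd (dc_run X) = fwd (em_run (X : C)) /\
    dc_inc _ _ ∘ bwd (dc_run X) = bwd (em_run (X : C));

  dc_brd : forall X Y : dc_cat, uisopair (dc_ten X Y : dc_cat) (dc_ten Y X);
  dc_brdP : forall X Y : center_ob C,
    dc_inc (dc_ten X Y) (dc_ten Y X) ∘ fwd (dc_brd X Y) = co_hb X Y;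
  dc_brdK : forall X Y : dc_cat, mutually_inverse (dc_brd X Y)
}.

Definition center_ebr (B : br_data) (C : emon_data B)
    (Z : drinfeld_center C) : ebr_data B :=
  @EBrData B
    (@EMonData B (dc_cat Z) (dc_unit Z) (@dc_ten B C Z) (@dc_tenm B C Z)
       (@dc_asc B C Z) (@dc_lun B C Z) (@dc_run B C Z))
    (@dc_brd B C Z).

(* [vectType] makes the hom spaces finite-dimensional.  Finite direct sums are
   chosen; the empty one is the zero object. *)
Record lincat_data (K : fieldType) := LinCatData {
  lob : Type;
  lhom : lob -> lob -> vectType K;
  lid : forall x, lhom x x;
  lcomp : forall x y z, lhom y z -> lhom x y -> lhom x z;
  dsum : forall n, ('I_n -> lob) -> lob;
  dinj : forall n (a : 'I_n -> lob) (i : 'I_n), lhom (a i) (dsum a);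
  dproj : forall n (a : 'I_n -> lob) (i : 'I_n), lhom (dsum a) (a i)
}.

Definition lin_cat (K : fieldType) (C : lincat_data K) : cat_data :=
  @CatData (lob C) (fun x y => lhom x y : Type) (@lid K C) (@lcomp K C).
Coercion lin_cat : lincat_data >-> cat_data.

Section LinearCategories.
Variables (K : fieldType) (C : lincat_data K).

Definition is_bilinear (U V W : vectType K) (m : U -> V -> W) : Prop :=
  (forall (a : K) (u u' : U) (v : V), m (a *: u + u') v = a *: m u v + m u' v) /\
  (forall (a : K) (u : U) (v v' : V), m u (a *: v + v') = a *: m u v + m u v').

Definition is_linear_category : Prop :=
  is_category C /\ forall x y z : lob C, is_bilinear (@lcomp K C x y z).

Definition are_direct_sums : Prop :=
  forall n (a : 'I_n -> lob C),
    [/\ forall i, lcomp (dproj a i) (dinj a i) = lid (a i),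
        forall i j, i != j -> lcomp (dproj a j) (dinj a i) = 0
      & \sum_i lcomp (dinj a i) (dproj a i) = lid (dsum a)].

Definition is_kernel (x y : lob C) (f : lhom x y) (k : lob C) (m : lhom k x) :=
  @is_equalizer C x y f (0 : lhom x y) k m.
Definition is_cokernel (x y : lob C) (f : lhom x y) (q : lob C) (p : lhom y q) :=
  @is_coequalizer C x y f (0 : lhom x y) q p.

Definition is_abelian : Prop :=
  is_linear_category /\
  are_direct_sums /\
  (forall (x y : lob C) (f : lhom x y),
     exists (k : lob C) (m : lhom k x), is_kernel f m) /\
  (forall (x y : lob C) (f : lhom x y),
     exists (q : lob C) (p : lhom y q), is_cokernel f p) /\
  (forall (x y : lob C) (m : lhom x y), @is_mono C x y m ->
     exists (z : lob C) (f : lhom y z), is_kernel f m) /\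
  (forall (x y : lob C) (p : lhom x y), @is_epi C x y p ->
     exists (z : lob C) (f : lhom z x), is_cokernel f p).

Definition is_simple (x : lob C) : Prop :=
  lid x <> 0 /\
  forall (y : lob C) (m : lhom y x), @is_mono C y x m ->
    lid y = 0 \/ @is_iso C y x m.

Definition is_semisimple : Prop :=
  is_abelian /\
  forall x : lob C, exists (n : nat) (s : 'I_n -> lob C),
    (forall i, is_simple (s i)) /\ @isomorphic C x (dsum s).

Definition finitely_many_simples : Prop :=
  exists (n : nat) (s : 'I_n -> lob C),
    forall x : lob C, is_simple x -> exists i, @isomorphic C x (s i).

End LinearCategories.

Definition is_left_dual (C : mon_data) (x y : C)
    (v : Mor (y ⊗ x) 𝟙) (u : Mor 𝟙 (x ⊗ y)) : Prop :=
  run x ∘ (mid x ⊠ v) ∘ asc x y x ∘ (u ⊠ mid x) ∘ bwd (lun x) = mid x /\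
  lun y ∘ (v ⊠ mid y) ∘ bwd (asc y x y) ∘ (mid y ⊠ u) ∘ bwd (run y) = mid y.

(* Left duals are chosen; [bf_rdualP] says that every object has a right dual. *)
Record braided_fusion (R : realType) := BraidedFusion {
  bf_lin : lincat_data R[i];
  bf_mon : mon_struct bf_lin;
  bf_brd : forall x y : bf_lin,
    @isopair bf_lin (ms_ten bf_mon x y) (ms_ten bf_mon y x);
  bf_br : br_data := @BrData (MonData bf_mon) bf_brd;
  bf_dual : bf_br -> bf_br;
  bf_ev : forall x, Mor (bf_dual x ⊗ x) 𝟙;
  bf_coev : forall x, Mor 𝟙 (x ⊗ bf_dual x);

  bf_braidedP : is_braided bf_br;
  bf_semisimpleP : is_semisimple bf_lin;
  bf_finiteP : finitely_many_simples bf_lin;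
  bf_bilinearP : forall x x' y y' : lob bf_lin,
    is_bilinear (U := lhom x x') (V := lhom y y')
      (W := lhom (ms_ten bf_mon x y) (ms_ten bf_mon x' y'))
      (@ms_tenm bf_lin bf_mon x x' y y');
  bf_ldualP : forall x, is_left_dual (bf_ev x) (bf_coev x);
  bf_rdualP : forall x : bf_br, exists (y : bf_br)
    (v : Mor (x ⊗ y) 𝟙) (u : Mor 𝟙 (y ⊗ x)), is_left_dual v u;
  bf_unitP : is_simple (ms_unit bf_mon)
}.
Coercion bf_br : braided_fusion >-> br_data.

Definition transparent (C : br_data) (x : C) : Prop :=
  forall y : C, brd y x ∘ brd x y = mid (x ⊗ y).

Definition nondegenerate_braided (R : realType) (B : braided_fusion R) : Prop :=
  [/\ is_simple (C := bf_lin B) (tunit B), transparent (tunit B)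
    & forall x : B, is_simple (C := bf_lin B) x -> transparent x ->
        isomorphic x (tunit B)].

Section SelfEnrichment.
Variables (R : realType) (B : braided_fusion R).

Local Notation "x ^*" := (bf_dual x).

(* The identification of [y^* ⊗ x^*] with the chosen dual of [x ⊗ y]. *)
Definition ev_ten (x y : B) : Mor ((y^* ⊗ x^*) ⊗ (x ⊗ y)) 𝟙 :=
  bf_ev y
  ∘ (mid y^* ⊠ (lun y ∘ (bf_ev x ⊠ mid y) ∘ bwd (asc x^* x y)))
  ∘ asc y^* x^* (x ⊗ y).
Definition dual_ten (x y : B) : Mor (y^* ⊗ x^*) (x ⊗ y)^* :=
  lun (x ⊗ y)^*
  ∘ (ev_ten x y ⊠ mid (x ⊗ y)^*)
  ∘ bwd (asc (y^* ⊗ x^*) (x ⊗ y) (x ⊗ y)^*)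
  ∘ (mid (y^* ⊗ x^*) ⊠ bf_coev (x ⊗ y))
  ∘ bwd (run (y^* ⊗ x^*)).

Definition self_ecat : ecat_data B := {|
  eob := B;
  ehom := fun x y => y ⊗ x^*;
  eid := fun x => bf_coev x;
  ecomp := fun x y z =>
    (mid z ⊠ (lun x^* ∘ (bf_ev y ⊠ mid x^*) ∘ bwd (asc y^* y x^*)))
    ∘ asc z y^* (y ⊗ x^*)
|}.

(* the bijection B(x,y) -> B(1, y ⊗ x^* ) *)
Definition self_name (x y : B) (f : Mor x y) : @uHom B self_ecat x y :=
  (f ⊠ mid x^*) ∘ bf_coev x.
Definition self_isopair (x y : B) (f : isopair x y) :
    @uisopair B self_ecat x y :=
  @IsoPair (underlying self_ecat) x y
    (self_name (fwd f)) (self_name (bwd f)).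

Definition self_enrichment : emon_data B := {|
  em_cat := self_ecat;
  em_unit := tunit B : self_ecat;
  em_ten := fun x y : self_ecat => x ⊗ y : self_ecat;
  em_tenm := fun x x' y y' : B =>
    (mid (x' ⊗ y') ⊠ dual_ten x y)
    ∘ bwd (asc x' y' (y^* ⊗ x^*))
    ∘ (mid x' ⊠ (asc y' y^* x^* ∘ brd x^* (y' ⊗ y^*)))
    ∘ asc x' x^* (y' ⊗ y^*);
  em_asc := fun x y z => self_isopair (asc x y z);
  em_lun := fun x => self_isopair (lun x);
  em_run := fun x => self_isopair (run x)
|}.

End SelfEnrichment.

Section VectEnrichment.
Variables (R : realType) (B : braided_fusion R).

Local Notation L := (bf_lin B).
Local Notation unitL := (ms_unit (bf_mon B)).

(* [V 1], with summands indexed by the basis [vbasis fullv] of [V] *)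
Definition vcopies (V : vectType R[i]) : 'I_(\dim {:V}) -> lob L :=
  fun _ => unitL.
Arguments vcopies V : clear implicits.
Definition vobj (V : vectType R[i]) : B := dsum (vcopies V).

Definition vinj (V : vectType R[i]) (i : 'I_(\dim {:V})) :
    lhom unitL (dsum (vcopies V)) := dinj (vcopies V) i.
Definition vproj (V : vectType R[i]) (i : 'I_(\dim {:V})) :
    Mor (vobj V) (tunit B) := dproj (vcopies V) i.

Definition vbas (V : vectType R[i]) (i : 'I_(\dim {:V})) : V :=
  (vbasis {:V})`_i.

(* the bijection V -> B(1, V 1) *)
Definition velem (V : vectType R[i]) (v : V) : Mor (tunit B) (vobj V) :=
  \sum_(i < \dim {:V}) coord (vbasis {:V}) i v *: vinj i.

(* the morphism [V 1 ⊗ W 1 -> U 1] induced by a bilinear map [m] *)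
Definition vbilin (V W U : vectType R[i]) (m : V -> W -> U) :
    Mor (vobj V ⊗ vobj W) (vobj U) :=
  \sum_(i < \dim {:V}) \sum_(j < \dim {:W})
    (velem (m (vbas i) (vbas j)) ∘ lun (tunit B)
       ∘ (vproj i ⊠ vproj j)
     : @lhom _ L (vobj V ⊗ vobj W) (vobj U)).

Definition vect_ecat : ecat_data B := {|
  eob := B;
  ehom := fun x y => vobj (lhom (x : lob L) y);
  eid := fun x => velem (lid (x : lob L));
  ecomp := fun x y z => vbilin (@lcomp _ L x y z)
|}.

Definition vect_isopair (x y : B) (f : isopair x y) :
    @uisopair B vect_ecat x y :=
  @IsoPair (underlying vect_ecat) x y
    (velem (V := lhom (x : lob L) y) (fwd f))
    (velem (V := lhom (y : lob L) x) (bwd f)).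

Definition vect_emon : emon_data B := {|
  em_cat := vect_ecat;
  em_unit := tunit B : vect_ecat;
  em_ten := fun x y : vect_ecat => x ⊗ y : vect_ecat;
  em_tenm := fun x x' y y' =>
    vbilin (V := lhom (x : lob L) x') (W := lhom (y : lob L) y')
      (U := lhom (ms_ten (bf_mon B) x y) (ms_ten (bf_mon B) x' y'))
      (@ms_tenm L (bf_mon B) x x' y y');
  em_asc := fun x y z => vect_isopair (asc x y z);
  em_lun := fun x => vect_isopair (lun x);
  em_run := fun x => vect_isopair (run x)
|}.

Definition vect_enrichment : ebr_data B :=
  @EBrData B vect_emon (fun x y => vect_isopair (brd x y)).

End VectEnrichment.

(* Main.v *)
(* A morphism T -> y ⊗ x^* is determined by its transpose T ⊗ x -> y.  On
   transposes, composition in the self-enrichment is composition of evaluations,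
   and the tensor product first moves x to the left over the second hom object by
   the inverse braiding; the enriched monoidal axioms thereby reduce to coherence
   of this interchange.  Enriched naturality of a half-braiding b on x forces
   b_z = c_{x,z}, so the objects of the center are those of B, and a morphism
   T -> y ⊗ x^* equalizes the two maps defining the center at z if and only if it
   cannot distinguish the braiding with z from the inverse braiding.  Splitting T
   into simple objects, those on which such a morphism is nonzero are transparent,
   hence isomorphic to 1 by nondegeneracy; so the hom objects of the center are the
   1-isotypic parts B(x,y) 1 of y ⊗ x^*.  The axioms for the center and for the
   enrichment by B(x,y) 1 are inherited along these inclusions. *)
From HB Require Import structures.
Require Import Defs.
From mathcomp Require Import all_boot all_order all_algebra.
From mathcomp Require Import complex spectral boolp reals.

Set Implicit Arguments.
Unset Strict Implicit.
Unset Printing Implicit Defensive.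

Arguments Ob : simpl never.
Arguments Mor : simpl never.
Arguments mid : simpl never.
Arguments mcomp : simpl never.
Arguments tunit : simpl never.
Arguments ten : simpl never.
Arguments tenm : simpl never.
Arguments asc : simpl never.
Arguments lun : simpl never.
Arguments run : simpl never.
Arguments brd : simpl never.
Arguments bf_br : simpl never.

(** Two obstacles shape the proof. Since nothing is strict, coherence is made computational: a
    morphism is represented by its action on right-nested products with a spectator factor, where a
    braiding is a composite of elementary crossings; what then remains of an equation is mostly
    naturality. Moreover the hom objects of the center are an arbitrary choice of limits, and the
    result concerns every choice. Hence a general transfer principle: axioms pass backwards along
    monomorphisms of hom objects that preserve the structure. It is applied to [B(x,y) 1] inside the
    self-enrichment, and again to a given center, whose hom objects are compared with the [B(x,y) 1]
    by isomorphisms. The braiding cannot be transferred from the self-enrichment, whose tensor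
    product need not be commutative; it is established directly on the [B(x,y) 1], where
    transparency makes the two crossings equal. Algebraic closedness enters through Schur's lemma:
    endomorphisms of the unit are scalars, so every point of [V 1] comes from a vector of [V]. *)

Section CategoryLaws.
Variables (C : cat_data) (HC : is_category C).

Lemma mcomp1f (x y : C) (f : Mor x y) : mid y ∘ f = f.
Proof. by case: HC. Qed.

Lemma mcompf1 (x y : C) (f : Mor x y) : f ∘ mid x = f.
Proof. by case: HC. Qed.

Lemma mcompA (w x y z : C) (h : Mor y z) (g : Mor x y) (f : Mor w x) :
  h ∘ (g ∘ f) = h ∘ g ∘ f.
Proof. by case: HC. Qed.

Lemma iso_mono (x y : C) (f : Mor x y) : is_iso f -> is_mono f.
Proof.
move=> [g [_ gf]] t h k e; move: (congr1 (mcomp g) e).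
by rewrite !mcompA /= gf !mcomp1f.
Qed.

Lemma iso_epi (x y : C) (f : Mor x y) : is_iso f -> is_epi f.
Proof.
move=> [g [fg _]] t h k e; move: (congr1 (fun u => u ∘ g) e).
by rewrite /= -!mcompA fg !mcompf1.
Qed.

Lemma inverse_unique (x y : C) (f : Mor x y) (g g' : Mor y x) :
  f ∘ g = mid y -> g' ∘ f = mid x -> g = g'.
Proof. by move=> e e'; rewrite -(mcomp1f g) -e' -mcompA e mcompf1. Qed.

Lemma iso_comp (x y z : C) (g : Mor y z) (f : Mor x y) :
  is_iso g -> is_iso f -> is_iso (g ∘ f).
Proof.
move=> [g' [/= gg' g'g]] [f' [/= ff' f'f]]; exists (f' ∘ g'); split => /=.
  by rewrite mcompA -(mcompA g) ff' mcompf1.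
by rewrite mcompA -(mcompA f') g'g mcompf1.
Qed.

Lemma iso_mid (x : C) : is_iso (mid x).
Proof. by exists (mid x); split; rewrite /= mcomp1f. Qed.

Lemma mutually_inverse_iso (x y : C) (f : isopair x y) :
  mutually_inverse f -> is_iso (fwd f).
Proof. by move=> [fg gf]; exists (bwd f). Qed.

Lemma mutually_inverse_isoV (x y : C) (f : isopair x y) :
  mutually_inverse f -> is_iso (bwd f).
Proof. by move=> [fg gf]; exists (fwd f). Qed.

End CategoryLaws.

(* Locks definitions that rewriting up to associativity would unfold. *)
Fact strict_key : unit. Proof. exact: tt. Qed.

(** * Consequences of the braided monoidal axioms *)

Section Braided.
Variables (B : br_data) (HB : is_braided B).

Let HM : is_monoidal B := proj1 HB.
Let HK : is_category B := proj1 HM.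

Let comp1f := mcomp1f HK.
Let compf1 := mcompf1 HK.
Let compA := mcompA HK.

Lemma ten11 (x y : B) : mid x ⊠ mid y = mid (x ⊗ y).
Proof. by case: HM => _ []. Qed.

Lemma ten_comp (x x' x'' y y' y'' : B) (f' : Mor x' x'') (f : Mor x x')
    (g' : Mor y' y'') (g : Mor y y') :
  (f' ∘ f) ⊠ (g' ∘ g) = (f' ⊠ g') ∘ (f ⊠ g).
Proof. by case: HM => _ [_ []]. Qed.

Lemma ascK (x y z : B) : mutually_inverse (asc x y z).
Proof. by case: HM => _ [_ [_ []]]. Qed.

Lemma lunK (x : B) : mutually_inverse (lun x).
Proof. by case: HM => _ [_ [_ [_ []]]]. Qed.

Lemma runK (x : B) : mutually_inverse (run x).
Proof. by case: HM => _ [_ [_ [_ [_ []]]]]. Qed.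

Lemma asc_nat (x x' y y' z z' : B) (f : Mor x x') (g : Mor y y')
    (h : Mor z z') :
  asc x' y' z' ∘ ((f ⊠ g) ⊠ h) = (f ⊠ (g ⊠ h)) ∘ asc x y z.
Proof. by case: HM => _ [_ [_ [_ [_ [_ []]]]]]. Qed.

Lemma lun_nat (x y : B) (f : Mor x y) : lun y ∘ (mid 𝟙 ⊠ f) = f ∘ lun x.
Proof. by case: HM => _ [_ [_ [_ [_ [_ [_ []]]]]]]. Qed.

Lemma run_nat (x y : B) (f : Mor x y) : run y ∘ (f ⊠ mid 𝟙) = f ∘ run x.
Proof. by case: HM => _ [_ [_ [_ [_ [_ [_ [_ []]]]]]]]. Qed.

Lemma pentagon (w x y z : B) :
  asc w x (y ⊗ z) ∘ asc (w ⊗ x) y z =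
  (mid w ⊠ asc x y z) ∘ asc w (x ⊗ y) z ∘ (asc w x y ⊠ mid z).
Proof. by case: HM => _ [_ [_ [_ [_ [_ [_ [_ [_ []]]]]]]]]. Qed.

Lemma triangle (x y : B) : (mid x ⊠ lun y) ∘ asc x 𝟙 y = run x ⊠ mid y.
Proof. by case: HM => _ [_ [_ [_ [_ [_ [_ [_ [_ []]]]]]]]]. Qed.

Lemma brdK (x y : B) : mutually_inverse (brd x y).
Proof. by case: HB => _ []. Qed.

Lemma brd_nat (x x' y y' : B) (f : Mor x x') (g : Mor y y') :
  brd x' y' ∘ (f ⊠ g) = (g ⊠ f) ∘ brd x y.
Proof. by case: HB => _ [_ []]. Qed.

Lemma brdV_nat (x x' y y' : B) (f : Mor x x') (g : Mor y y') :
  bwd (brd x' y') ∘ (g ⊠ f) = (f ⊠ g) ∘ bwd (brd x y).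
Proof.
apply: (iso_epi HK (mutually_inverse_iso (brdK x y))).
rewrite -!compA -brd_nat (proj2 (brdK x y)) compf1 compA.
by rewrite (proj2 (brdK x' y')) comp1f.
Qed.

Lemma hexagon1 (x y z : B) :
  asc y z x ∘ brd x (y ⊗ z) ∘ asc x y z =
  (mid y ⊠ brd x z) ∘ asc y x z ∘ (brd x y ⊠ mid z).
Proof. by case: HB => _ [_ [_ []]]. Qed.

Lemma hexagon2 (x y z : B) :
  bwd (asc z x y) ∘ brd (x ⊗ y) z ∘ bwd (asc x y z) =
  (brd x z ⊠ mid y) ∘ bwd (asc x z y) ∘ (mid x ⊠ brd y z).
Proof. by case: HB => _ [_ [_ []]]. Qed.

Let asc_bwd (x y z : B) : asc x y z ∘ bwd (asc x y z) = mid _ := proj1 (ascK x y z).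
Let bwd_asc (x y z : B) : bwd (asc x y z) ∘ asc x y z = mid _ := proj2 (ascK x y z).

Lemma tenlD (a x y z : B) (g : Mor y z) (f : Mor x y) :
  mid a ⊠ (g ∘ f) = (mid a ⊠ g) ∘ (mid a ⊠ f).
Proof. by rewrite -ten_comp comp1f. Qed.

Lemma tenrD (a x y z : B) (g : Mor y z) (f : Mor x y) :
  (g ∘ f) ⊠ mid a = (g ⊠ mid a) ∘ (f ⊠ mid a).
Proof. by rewrite -ten_comp comp1f. Qed.

Lemma ten_compl (x y z a b : B) (g : Mor y z) (f : Mor x y) (k : Mor a b) :
  (g ∘ f) ⊠ k = (g ⊠ mid b) ∘ (f ⊠ k).
Proof. by rewrite -ten_comp comp1f. Qed.

Lemma ten_compr (x y z a b : B) (g : Mor y z) (f : Mor x y) (k : Mor a b) :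
  k ⊠ (g ∘ f) = (mid b ⊠ g) ∘ (k ⊠ f).
Proof. by rewrite -ten_comp comp1f. Qed.

Lemma ten_swap (x x' y y' : B) (f : Mor x x') (g : Mor y y') :
  (f ⊠ mid y') ∘ (mid x ⊠ g) = (mid x' ⊠ g) ∘ (f ⊠ mid y).
Proof. by rewrite -!ten_comp !comp1f !compf1. Qed.

Lemma tenlr (x x' y y' : B) (f : Mor x x') (g : Mor y y') :
  f ⊠ g = (f ⊠ mid y') ∘ (mid x ⊠ g).
Proof. by rewrite -ten_comp comp1f compf1. Qed.

Lemma tenr_inj (x y : B) (f g : Mor x y) : f ⊠ mid 𝟙 = g ⊠ mid (tunit B) -> f = g.
Proof.
move=> e; apply: (iso_epi HK (mutually_inverse_iso (runK x))).
by rewrite -!run_nat e.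
Qed.

Lemma tenl_inj (x y : B) (f g : Mor x y) : mid (tunit B) ⊠ f = mid 𝟙 ⊠ g -> f = g.
Proof.
move=> e; apply: (iso_epi HK (mutually_inverse_iso (lunK x))).
by rewrite -!lun_nat e.
Qed.

Lemma ten_mutually_inverse (x x' y y' : B) (f : Mor x x') (f' : Mor x' x)
    (g : Mor y y') (g' : Mor y' y) :
  mutually_inverse (IsoPair f f') -> mutually_inverse (IsoPair g g') ->
  mutually_inverse (IsoPair (f ⊠ g) (f' ⊠ g')).
Proof.
by move=> [/= a b] [/= c d]; split; rewrite /= -ten_comp ?a ?b ?c ?d ten11.
Qed.

Lemma ten_iso (x x' y y' : B) (f : Mor x x') (g : Mor y y') :
  is_iso f -> is_iso g -> is_iso (f ⊠ g).
Proof.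
move=> [f' Hf] [g' Hg]; exists (f' ⊠ g').
exact: ten_mutually_inverse.
Qed.

Lemma asc_natr (x y z z' : B) (h : Mor z z') :
  asc x y z' ∘ (mid (x ⊗ y) ⊠ h) = (mid x ⊠ (mid y ⊠ h)) ∘ asc x y z.
Proof. by rewrite -asc_nat ten11. Qed.

Lemma asc_natl (x x' y z : B) (f : Mor x x') :
  asc x' y z ∘ ((f ⊠ mid y) ⊠ mid z) = (f ⊠ mid (y ⊗ z)) ∘ asc x y z.
Proof. by rewrite asc_nat ten11. Qed.

(* Kelly's redundant unit axiom: it holds after tensoring with the unit. *)
Lemma lun_ten (x y : B) : lun (x ⊗ y) ∘ asc 𝟙 x y = lun x ⊠ mid y.
Proof.
apply: tenl_inj.
have e : is_iso (asc 𝟙 (𝟙 ⊗ x) y ∘ (asc 𝟙 𝟙 x ⊠ mid y)).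
  apply: (iso_comp HK); first exact: mutually_inverse_iso (ascK _ _ _).
  by apply: ten_iso; [exact: mutually_inverse_iso (ascK _ _ _) | exact: iso_mid].
apply: (iso_epi HK e).
rewrite tenlD -compA [X in _ ∘ X]compA -pentagon compA triangle.
rewrite [RHS]compA -asc_nat -compA -tenrD triangle.
by rewrite -(ten11 x y) asc_nat.
Qed.

(** * Strictification *)

Inductive oexp := OA of B | O1 | OT of oexp & oexp.

Fixpoint den (e : oexp) : B :=
  match e with OA a => a | O1 => 𝟙 | OT x y => den x ⊗ den y end.

(* [flat e t] is the right-nested product of the factors of e and a spectator t;
   there the associativity and unit isomorphisms become identities. *)
Fixpoint flat (e : oexp) (t : B) : B :=
  match e with OA a => a ⊗ t | O1 => t | OT x y => flat x (flat y t) end.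

Fixpoint act (e : oexp) (t s : B) (f : Mor t s) : Mor (flat e t) (flat e s) :=
  match e with
  | OA a => mid a ⊠ f
  | O1 => f
  | OT x y => act x (act y f)
  end.

Fixpoint fl (e : oexp) (t : B) : Mor (den e ⊗ t) (flat e t) :=
  match e with
  | OA a => mid (a ⊗ t)
  | O1 => fwd (lun t)
  | OT x y => fl x (flat y t) ∘ (mid (den x) ⊠ fl y t) ∘ asc (den x) (den y) t
  end.

Fixpoint flb (e : oexp) (t : B) : Mor (flat e t) (den e ⊗ t) :=
  match e with
  | OA a => mid (a ⊗ t)
  | O1 => bwd (lun t)
  | OT x y =>
      bwd (asc (den x) (den y) t) ∘ ((mid (den x) ⊠ flb y t) ∘ flb x (flat y t))
  end.

Lemma flK e t : mutually_inverse (IsoPair (fl e t) (flb e t)).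
Proof.
elim: e t => [a|| x IHx y IHy] t /=.
- by split; rewrite /= comp1f.
- exact: (lunK t).
have [/= x1 x2] := IHx (flat y t); have [/= y1 y2] := IHy t; split => /=.
  rewrite -!compA (compA (asc _ _ _)) asc_bwd comp1f.
  by rewrite (compA (mid (den x) ⊠ fl y t)) -tenlD y1 ten11 comp1f.
rewrite -!compA (compA (flb x _)) x2 comp1f.
by rewrite (compA (mid (den x) ⊠ flb y t)) -tenlD y2 ten11 comp1f bwd_asc.
Qed.

Lemma act1 e t : act e (mid t) = mid (flat e t).
Proof. by elim: e t => [a|| x IHx y IHy] t //=; rewrite ?ten11 // IHy IHx. Qed.

Lemma actD e t s r (g : Mor s r) (f : Mor t s) :
  act e (g ∘ f) = act e g ∘ act e f.
Proof.
elim: e t s r g f => [a|| x IHx y IHy] t s r g f //=; first by rewrite tenlD.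
by rewrite IHy IHx.
Qed.

Lemma fl_nat e t s (g : Mor t s) :
  fl e s ∘ (mid (den e) ⊠ g) = act e g ∘ fl e t.
Proof.
elim: e t s g => [a|| x IHx y IHy] t s g /=.
- by rewrite comp1f compf1.
- exact: lun_nat.
rewrite -!compA asc_natr (compA (mid (den x) ⊠ fl y s)) -tenlD IHy.
by rewrite tenlD -compA (compA (fl x _)) IHx !compA.
Qed.

(** [phi] is [f ⊠ mid t] transported along the isomorphisms [fl]. Being a relation, it lets a
    structural isomorphism be represented by a literal identity, the two flattened objects being
    convertible. *)
Definition St (x y : oexp) (f : Mor (den x) (den y))
    (phi : forall t, Mor (flat x t) (flat y t)) : Prop :=
  forall t, fl y t ∘ (f ⊠ mid t) = phi t ∘ fl x t.

Lemma St_ext x y (f : Mor (den x) (den y)) phi psi :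
  St f phi -> (forall t, phi t = psi t) -> St f psi.
Proof. by move=> H e t; rewrite H e. Qed.

Lemma fl_epi e t s (f g : Mor (flat e t) s) :
  f ∘ fl e t = g ∘ fl e t -> f = g.
Proof. by apply: (iso_epi HK); exact: mutually_inverse_iso (flK e t). Qed.

Lemma St_unique x y (f : Mor (den x) (den y)) phi psi :
  St f phi -> St f psi -> forall t, phi t = psi t.
Proof. by move=> H H' t; apply: (@fl_epi x); rewrite -H -H'. Qed.

Lemma St_eq x y (f g : Mor (den x) (den y)) phi psi :
  St f phi -> St g psi -> f = g -> forall t, phi t = psi t.
Proof. by move=> H + e; rewrite -e; exact: St_unique. Qed.

(** Faithfulness of the representation: the spectator 𝟙 already determines the morphism, as [fl] is
    invertible and tensoring with the unit is faithful. *)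
Lemma St_inj x y (f g : Mor (den x) (den y)) phi psi :
  St f phi -> St g psi -> (forall t, phi t = psi t) -> f = g.
Proof.
move=> H H' e; apply: tenr_inj.
apply: (iso_mono HK (mutually_inverse_iso (flK y 𝟙))) => /=.
by rewrite H H' e.
Qed.

Lemma St_nat x y (f : Mor (den x) (den y)) phi : St f phi ->
  forall t s (g : Mor t s), phi s ∘ act x g = act y g ∘ phi t.
Proof.
move=> H t s g; apply: (@fl_epi x).
by rewrite -compA -fl_nat compA -H -compA ten_swap compA fl_nat -!compA H.
Qed.

Lemma St_id x : St (mid (den x)) (fun t => mid (flat x t)).
Proof. by move=> t; rewrite ten11 compf1 comp1f. Qed.

Lemma St_comp x y z (g : Mor (den y) (den z)) (f : Mor (den x) (den y)) psi phi :
  St g psi -> St f phi -> St (g ∘ f) (fun t => psi t ∘ phi t).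
Proof. by move=> Hg Hf t; rewrite tenrD compA Hg -compA Hf compA. Qed.

(** The second factor becomes part of the spectator of the first; this is why representations are
    families over all spectators. *)
Lemma St_ten x x' y y' (f : Mor (den x) (den x')) (g : Mor (den y) (den y'))
    phi psi : St f phi -> St g psi ->
  @St (OT x y) (OT x' y') (f ⊠ g) (fun t => phi (flat y' t) ∘ act x (psi t)).
Proof.
move=> Hf Hg t /=.
rewrite -!compA asc_nat (compA (mid _ ⊠ fl y' t)) -ten_comp comp1f Hg.
rewrite -{1}(compf1 f) ten_comp -!compA (compA (fl x' _)).
rewrite [fl x' _ ∘ _](_ : _ = phi (flat y' t) ∘ act x (psi t) ∘ fl x (flat y t)).
  by rewrite -!compA.
by rewrite tenlr compA Hf -!compA fl_nat.
Qed.

(** Kelly's axiom here, and the triangle and the pentagon in the next two lemmas, are what turns the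
    structural isomorphisms into identities. *)
Lemma St_lun x : @St (OT O1 x) x (lun (den x)) (fun t => mid (flat x t)).
Proof.
by move=> t /=; rewrite comp1f -lun_ten compA -lun_nat.
Qed.

Lemma St_run x : @St (OT x O1) x (run (den x)) (fun t => mid (flat x t)).
Proof. by move=> t /=; rewrite comp1f -triangle compA. Qed.

Lemma St_asc x y z :
  @St (OT (OT x y) z) (OT x (OT y z)) (asc (den x) (den y) (den z))
    (fun t => mid (flat x (flat y (flat z t)))).
Proof.
move=> t /=; rewrite comp1f -!compA; congr (_ ∘ _).
rewrite !tenlD -!compA; congr (_ ∘ _).
by rewrite [asc _ _ _ ∘ (mid _ ⊠ _ ∘ _)]compA asc_natr -!compA pentagon !compA.
Qed.

Lemma St_inverse x y (f : Mor (den x) (den y)) (f' : Mor (den y) (den x)) phi psi :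
  mutually_inverse (IsoPair f f') ->
  (forall t, mutually_inverse (IsoPair (phi t) (psi t))) -> St f phi -> St f' psi.
Proof.
move=> [/= ff' _] Hp Hf t.
apply: (iso_mono HK (_ : is_iso (phi t))).
  by exists (psi t); exact: Hp.
rewrite compA -Hf -compA -tenrD ff' ten11 compf1.
by rewrite compA (proj1 (Hp t)) comp1f.
Qed.

Lemma mid_inv (x : B) : mutually_inverse (IsoPair (mid x) (mid x)).
Proof. by split; rewrite /= comp1f. Qed.

Lemma St_lunV x : @St x (OT O1 x) (bwd (lun (den x))) (fun t => mid (flat x t)).
Proof.
apply: (@St_inverse (OT O1 x) x _ _ _ _ (lunK _) (fun=> mid_inv _)).
exact: St_lun.
Qed.

Lemma St_runV x : @St x (OT x O1) (bwd (run (den x))) (fun t => mid (flat x t)).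
Proof.
apply: (@St_inverse (OT x O1) x _ _ _ _ (runK _) (fun=> mid_inv _)).
exact: St_run.
Qed.

Lemma St_ascV x y z :
  @St (OT x (OT y z)) (OT (OT x y) z) (bwd (asc (den x) (den y) (den z)))
    (fun t => mid (flat x (flat y (flat z t)))).
Proof.
apply: (@St_inverse (OT (OT x y) z) (OT x (OT y z)) _ _ _ _
  (ascK _ _ _) (fun=> mid_inv _)).
exact: St_asc.
Qed.

(** The tautological representative, for morphisms with no structure to exploit. *)
Definition sat (x y : oexp) (f : Mor (den x) (den y)) (t : B) :
    Mor (flat x t) (flat y t) :=
  locked_with strict_key (fl y t ∘ (f ⊠ mid t) ∘ flb x t).

Lemma St_sat x y (f : Mor (den x) (den y)) : St f (sat f).
Proof. by move=> t; rewrite /sat unlock -!compA; have [_ /= ->] := flK x t; rewrite compf1. Qed.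

Lemma sat_iso x y (f : Mor (den x) (den y)) t : is_iso f -> is_iso (sat f t).
Proof.
move=> Hf; rewrite /sat unlock; apply: (iso_comp HK).
  apply: (iso_comp HK); first exact: mutually_inverse_iso (flK y t).
  by apply: ten_iso => //; exact: iso_mid.
exact: mutually_inverse_isoV (flK x t).
Qed.

(** * Crossing the unit object *)

Lemma idem_iso (x : B) (f : Mor x x) : is_iso f -> f ∘ f = f -> f = mid x.
Proof. by move=> Hf e; apply: (iso_mono HK Hf); rewrite e compf1. Qed.

(** Naturality along [lun 𝟙] identifies the strict braidings of 𝟙 ⊗ 𝟙 and of 𝟙 with [y], while the
    hexagon makes the former the square of the latter. So the strict form is an idempotent
    isomorphism. *)
Lemma brd1l (y : B) : fwd (brd 𝟙 y) = bwd (run y) ∘ lun y.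
Proof.
pose Y := OA y; pose c := @sat (OT O1 Y) (OT Y O1) (brd 𝟙 y).
have H : @St (OT O1 Y) (OT Y O1) (brd 𝟙 y) c by exact: St_sat.
pose d := @sat (OT (OT O1 O1) Y) (OT Y (OT O1 O1)) (brd (𝟙 ⊗ 𝟙) y).
have Hd : @St (OT (OT O1 O1) Y) (OT Y (OT O1 O1)) (brd (𝟙 ⊗ 𝟙) y) d by exact: St_sat.
apply: (St_inj H (St_comp (St_runV Y) (St_lun Y))) => t /=.
rewrite comp1f; apply: idem_iso.
  exact: (@sat_iso (OT O1 Y) (OT Y O1)) (mutually_inverse_iso (brdK _ _)).
have e1 := St_comp H (St_ten (St_lun O1) (St_id Y)).
have e2 := St_comp (St_ten (St_id Y) (St_lun O1)) Hd.
have ed : c t = d t.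
  have := St_eq e1 e2 (brd_nat _ _) t.
  by rewrite /= ten11 !compf1 comp1f.
have e3 := St_comp (St_ascV Y O1 O1) (St_comp Hd (St_ascV O1 O1 Y)).
have e4 := St_comp (St_ten H (St_id O1))
  (St_comp (St_ascV O1 Y O1) (St_ten (St_id O1) H)).
have := St_eq e3 e4 _ t; rewrite compA hexagon2 -compA => /(_ erefl).
by rewrite /= ?ten11 !compf1 !comp1f -ed => <-.
Qed.

(** The same argument in the other variable. It is stated for an arbitrary half-braiding because it
    must also apply to the unknown half-braidings in the center. *)
Lemma half_braiding_unit (x : B) (c : forall z, Mor (x ⊗ z) (z ⊗ x)) :
  is_half_braiding c -> c 𝟙 = bwd (lun x) ∘ run x.
Proof.
case=> c_iso c_nat c_hex.
pose X := OA x; pose p := @sat (OT X O1) (OT O1 X) (c 𝟙).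
have H : @St (OT X O1) (OT O1 X) (c 𝟙) p by exact: St_sat.
pose d := @sat (OT X (OT O1 O1)) (OT (OT O1 O1) X) (c (𝟙 ⊗ 𝟙)).
have Hd : @St (OT X (OT O1 O1)) (OT (OT O1 O1) X) (c (𝟙 ⊗ 𝟙)) d by exact: St_sat.
apply: (St_inj H (St_comp (St_lunV X) (St_run X))) => t /=.
rewrite comp1f; apply: idem_iso; first exact: (@sat_iso (OT X O1) (OT O1 X) _ _ (c_iso 𝟙)).
have e1 := St_comp H (St_ten (St_id X) (St_lun O1)).
have e2 := St_comp (St_ten (St_lun O1) (St_id X)) Hd.
have ed : p t = d t.
  have := St_eq e1 e2 (c_nat _ _ _) t.
  by rewrite /= ten11 !compf1 comp1f.
have e3 := St_comp (St_asc O1 O1 X) (St_comp Hd (St_asc X O1 O1)).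
have e4 := St_comp (St_ten (St_id O1) H)
  (St_comp (St_asc O1 X O1) (St_ten H (St_id O1))).
have := St_eq e3 e4 _ t; rewrite compA c_hex -compA => /(_ erefl).
by rewrite /= ?ten11 !compf1 !comp1f -ed => <-.
Qed.

Lemma brd_half_braiding (x : B) : is_half_braiding (fun z => fwd (brd x z)).
Proof.
split=> [z | z w f | z w]; first exact: mutually_inverse_iso (brdK _ _).
  by rewrite brd_nat.
exact: hexagon1.
Qed.

Lemma brd1r (x : B) : fwd (brd x 𝟙) = bwd (lun x) ∘ run x.
Proof. exact: half_braiding_unit (brd_half_braiding x). Qed.

(* [Xc x y] is the braiding and [Yc x y] its inverse; composite objects cross
   one factor at a time. *)
Definition X0 (a b t : B) : Mor (a ⊗ (b ⊗ t)) (b ⊗ (a ⊗ t)) :=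
  locked_with strict_key (asc b a t ∘ ((brd a b ⊠ mid t) ∘ bwd (asc a b t))).
Definition Y0 (a b t : B) : Mor (b ⊗ (a ⊗ t)) (a ⊗ (b ⊗ t)) :=
  locked_with strict_key
    (asc a b t ∘ ((bwd (brd a b) ⊠ mid t) ∘ bwd (asc b a t))).

Fixpoint Xa (a : B) (y : oexp) (t : B) : Mor (a ⊗ flat y t) (flat y (a ⊗ t)) :=
  match y with
  | OA b => X0 a b t
  | O1 => mid (a ⊗ t)
  | OT y1 y2 => act y1 (Xa a y2 t) ∘ Xa a y1 (flat y2 t)
  end.
Fixpoint Ya (a : B) (y : oexp) (t : B) : Mor (flat y (a ⊗ t)) (a ⊗ flat y t) :=
  match y with
  | OA b => Y0 a b t
  | O1 => mid (a ⊗ t)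
  | OT y1 y2 => Ya a y1 (flat y2 t) ∘ act y1 (Ya a y2 t)
  end.

Fixpoint Xc (x y : oexp) (t : B) : Mor (flat x (flat y t)) (flat y (flat x t)) :=
  match x with
  | OA a => Xa a y t
  | O1 => mid (flat y t)
  | OT x1 x2 => Xc x1 y (flat x2 t) ∘ act x1 (Xc x2 y t)
  end.
Fixpoint Yc (x y : oexp) (t : B) : Mor (flat y (flat x t)) (flat x (flat y t)) :=
  match x with
  | OA a => Ya a y t
  | O1 => mid (flat y t)
  | OT x1 x2 => act x1 (Yc x2 y t) ∘ Yc x1 y (flat x2 t)
  end.

Lemma comp_mutually_inverse (x y z : B) (g : isopair y z) (f : isopair x y) :
  mutually_inverse g -> mutually_inverse f ->
  mutually_inverse (IsoPair (g ∘ f) (bwd f ∘ bwd g)).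
Proof.
move=> [/= a b] [/= c d]; split => /=.
  by rewrite -compA (compA (fwd f)) c comp1f.
by rewrite -compA (compA (bwd g)) b comp1f.
Qed.

Lemma act_mutually_inverse e t s (f : isopair t s) :
  mutually_inverse f -> mutually_inverse (IsoPair (act e f) (act e (bwd f))).
Proof. by move=> [a b]; split; rewrite /= -actD ?a ?b act1. Qed.

Lemma X0K a b t : mutually_inverse (IsoPair (X0 a b t) (Y0 a b t)).
Proof.
have E : mutually_inverse (IsoPair (brd a b ⊠ mid t) (bwd (brd a b) ⊠ mid t)).
  by apply: ten_mutually_inverse; [exact: brdK | exact: mid_inv].
have [a1 a2] := ascK a b t; have [b1 b2] := ascK b a t; have [e1 e2] := E.
split; rewrite /= /X0 /Y0 !unlock -!compA.
  rewrite (compA (bwd (asc a b t))) a2 comp1f.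
  by rewrite [(brd a b ⊠ mid t) ∘ _]compA e1 comp1f.
rewrite (compA (bwd (asc b a t))) b2 comp1f.
by rewrite [(bwd (brd a b) ⊠ mid t) ∘ _]compA e2 comp1f.
Qed.

Lemma XaK a y t : mutually_inverse (IsoPair (Xa a y t) (Ya a y t)).
Proof.
elim: y t => [b|| y1 IH1 y2 IH2] t; [exact: X0K | exact: mid_inv |].
exact: comp_mutually_inverse (act_mutually_inverse y1 (IH2 t)) (IH1 (flat y2 t)).
Qed.

Lemma XcK x y t : mutually_inverse (IsoPair (Xc x y t) (Yc x y t)).
Proof.
elim: x t => [b|| y1 IH1 y2 IH2] t; [exact: XaK | exact: mid_inv |].
exact: comp_mutually_inverse (IH1 (flat y2 t)) (act_mutually_inverse y1 (IH2 t)).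
Qed.

Lemma St_X0 a b : @St (OT (OA a) (OA b)) (OT (OA b) (OA a)) (brd a b) (X0 a b).
Proof.
move=> t /=; rewrite /X0 unlock !ten11 !comp1f -!compA.
by rewrite (proj2 (ascK a b t)) compf1.
Qed.

Lemma hexagon1' (x y z : B) :
  fwd (brd x (y ⊗ z)) =
  bwd (asc y z x) ∘ ((mid y ⊠ brd x z) ∘
    (asc y x z ∘ ((brd x y ⊠ mid z) ∘ bwd (asc x y z)))).
Proof.
rewrite [mid y ⊠ brd x z ∘ _]compA [mid y ⊠ brd x z ∘ asc y x z ∘ _]compA -hexagon1.
by rewrite -!compA asc_bwd compf1 compA bwd_asc comp1f.
Qed.

Lemma hexagon2' (x y z : B) :
  fwd (brd (x ⊗ y) z) =
  asc z x y ∘ ((brd x z ⊠ mid y) ∘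
    (bwd (asc x z y) ∘ ((mid x ⊠ brd y z) ∘ asc x y z))).
Proof.
rewrite [brd x z ⊠ mid y ∘ _]compA [brd x z ⊠ mid y ∘ bwd _ ∘ _]compA -hexagon2.
by rewrite -!compA bwd_asc compf1 compA asc_bwd comp1f.
Qed.

Lemma St_Xa a y : @St (OT (OA a) y) (OT y (OA a)) (brd a (den y)) (Xa a y).
Proof.
elim: y => [b|| y IHy z IHz]; first exact: St_X0.
  rewrite brd1r; apply: St_ext (St_comp (St_lunV (OA a)) (St_run (OA a))) _ => t /=.
  by rewrite comp1f.
rewrite /= hexagon1'.
apply: (St_ext (St_comp (St_ascV y z (OA a)) (St_comp (St_ten (St_id y) IHz)
  (St_comp (St_asc y (OA a) z)
    (St_comp (St_ten IHy (St_id z)) (St_ascV (OA a) y z)))))).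
by move=> t /=; rewrite !act1 !comp1f ?ten11 !compf1.
Qed.

(** The hexagons split a crossing of composite objects into crossings of their factors, and crossing
    the unit is trivial by [brd1l] and [brd1r]. *)
Lemma St_brd x y : @St (OT x y) (OT y x) (brd (den x) (den y)) (Xc x y).
Proof.
elim: x => [b|| x IHx z IHz]; first exact: St_Xa.
  rewrite brd1l; apply: St_ext (St_comp (St_runV y) (St_lun y)) _ => t /=.
  by rewrite comp1f.
rewrite /= hexagon2'.
apply: (St_ext (St_comp (St_asc y x z) (St_comp (St_ten IHx (St_id z))
  (St_comp (St_ascV x y z)
    (St_comp (St_ten (St_id x) IHz) (St_asc x z y)))))).
by move=> t /=; rewrite !act1 !comp1f ?act1 !compf1.
Qed.

Lemma St_brdV x y : @St (OT y x) (OT x y) (bwd (brd (den x) (den y))) (Yc x y).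
Proof. exact: (@St_inverse (OT x y) (OT y x) _ _ _ _ (brdK _ _) (XcK x y) (St_brd x y)). Qed.

Lemma St_interchange a b y d :
  @St (OT (OT a b) (OT y d)) (OT (OT a y) (OT b d))
    (Defs.interchange (den a) (den b) (den y) (den d))
    (fun t => act a (Yc y b (flat d t))).
Proof.
rewrite /Defs.interchange.
apply: (St_ext (St_comp (St_comp (St_ascV a y (OT b d))
  (St_ten (St_id a) (St_comp (St_comp (St_asc y b d)
    (St_ten (St_brdV y b) (St_id d))) (St_ascV b y d))))
  (St_asc a b (OT y d)))).
by move=> t /=; rewrite !compf1 !comp1f !act1 !compf1.
Qed.

Lemma Xc_nat x x' y (f : Mor (den x) (den x')) phi : St f phi ->
  forall t, Xc x' y t ∘ phi (flat y t) = act y (phi t) ∘ Xc x y t.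
Proof.
move=> Hf t.
have e1 := St_comp (St_brd x' y) (St_ten Hf (St_id y)).
have e2 := St_comp (St_ten (St_id y) Hf) (St_brd x y).
have := St_eq e1 e2 (brd_nat _ _) t.
by rewrite /= act1 compf1 comp1f.
Qed.

Lemma Yc_nat x x' y (f : Mor (den x) (den x')) phi : St f phi ->
  forall t, Yc x' y t ∘ act y (phi t) = phi (flat y t) ∘ Yc x y t.
Proof.
move=> Hf t; have [/= x1 x2] := XcK x y t; have [/= y1 y2] := XcK x' y t.
by rewrite -[LHS]compf1 -x1 -!compA (compA (act y _)) -(Xc_nat _ Hf) -!compA
  (compA (Yc x' y t)) y2 comp1f.
Qed.

Lemma Xc_nat2 x y y' (f : Mor (den y) (den y')) phi : St f phi ->
  forall t, Xc x y' t ∘ act x (phi t) = phi (flat x t) ∘ Xc x y t.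
Proof.
move=> Hf t.
have e1 := St_comp (St_brd x y') (St_ten (St_id x) Hf).
have e2 := St_comp (St_ten Hf (St_id x)) (St_brd x y).
have := St_eq e1 e2 (brd_nat _ _) t.
by rewrite /= act1 compf1 comp1f.
Qed.

Lemma Yc_nat2 x y y' (f : Mor (den y) (den y')) phi : St f phi ->
  forall t, Yc x y' t ∘ phi (flat x t) = act x (phi t) ∘ Yc x y t.
Proof.
move=> Hf t; have [/= x1 x2] := XcK x y t; have [/= y1 y2] := XcK x y' t.
by rewrite -[LHS]compf1 -x1 -!compA (compA (phi _)) -(Xc_nat2 _ Hf) -!compA
  (compA (Yc x y' t)) y2 comp1f.
Qed.

Lemma Y0_nat a b t s (g : Mor t s) :
  Y0 a b s ∘ (mid b ⊠ (mid a ⊠ g)) = (mid a ⊠ (mid b ⊠ g)) ∘ Y0 a b t.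
Proof. exact: (St_nat (St_brdV (OA a) (OA b)) g). Qed.

Lemma sat_nat x y (f : Mor (den x) (den y)) t s (g : Mor t s) :
  sat f s ∘ act x g = act y g ∘ sat f t.
Proof. exact: (St_nat (St_sat f) g). Qed.

(** Lets a rule for [g ∘ f] fire inside a right-associated composite. *)
Lemma comp_tail (x y z : B) (g : Mor y z) (f : Mor x y) (h : Mor x z) :
  g ∘ f = h -> forall (w : B) (k : Mor w x), g ∘ (f ∘ k) = h ∘ k.
Proof. by move=> e w k; rewrite compA e. Qed.

End Braided.

(** * Reification of objects and morphisms *)

Ltac reify_ob B x :=
  lazymatch x with
  | @ten _ ?a ?b =>
      let a' := reify_ob B a in let b' := reify_ob B b in constr:(@OT B a' b')
  | @tunit _ => constr:(@O1 B)
  | @ehom _ _ _ _ =>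
      let h := eval cbn in x in
      lazymatch h with
      | @ehom _ _ _ _ => constr:(@OA B x)
      | _ => reify_ob B h
      end
  | _ => constr:(@OA B x)
  end.

Ltac reify_sat B HB f :=
  lazymatch type of f with
  | @Mor _ ?x ?y =>
      let x' := reify_ob B x in let y' := reify_ob B y in
      constr:(@St_sat B HB x' y' f)
  | @uHom _ ?C ?x ?y =>
      let h' := reify_ob B (@ehom B C x y) in
      constr:(@St_sat B HB (@O1 B) h' f)
  end.

(** A separate entry point, so that evaluations and coevaluations can later receive named
    representatives instead of tautological ones. *)
Ltac reify_atom B HB f := reify_sat B HB f.

Ltac reify_mor B HB f :=
  lazymatch f with
  | @mcomp _ _ _ _ ?g ?h =>
      let G := reify_mor B HB g in let H := reify_mor B HB h in
      constr:(St_comp HB G H)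
  | @tenm _ _ _ _ _ ?g ?h =>
      let G := reify_mor B HB g in let H := reify_mor B HB h in
      constr:(St_ten HB G H)
  | @mid _ ?x => let x' := reify_ob B x in constr:(St_id HB x')
  | @fwd _ _ _ (@asc _ ?x ?y ?z) =>
      let x' := reify_ob B x in let y' := reify_ob B y in
      let z' := reify_ob B z in constr:(St_asc HB x' y' z')
  | @bwd _ _ _ (@asc _ ?x ?y ?z) =>
      let x' := reify_ob B x in let y' := reify_ob B y in
      let z' := reify_ob B z in constr:(St_ascV HB x' y' z')
  | @fwd _ _ _ (@lun _ ?x) => let x' := reify_ob B x in constr:(St_lun HB x')
  | @bwd _ _ _ (@lun _ ?x) => let x' := reify_ob B x in constr:(St_lunV HB x')
  | @fwd _ _ _ (@run _ ?x) => let x' := reify_ob B x in constr:(St_run HB x')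
  | @bwd _ _ _ (@run _ ?x) => let x' := reify_ob B x in constr:(St_runV HB x')
  | @fwd _ _ _ (@brd _ ?x ?y) =>
      let x' := reify_ob B x in let y' := reify_ob B y in
      constr:(St_brd HB x' y')
  | @bwd _ _ _ (@brd _ ?x ?y) =>
      let x' := reify_ob B x in let y' := reify_ob B y in
      constr:(St_brdV HB x' y')
  | @Defs.interchange _ ?a ?b ?c ?d =>
      let a' := reify_ob B a in let b' := reify_ob B b in
      let c' := reify_ob B c in let d' := reify_ob B d in
      constr:(St_interchange HB a' b' c' d')
  | _ => reify_atom B HB f
  end.

Ltac strict_simpl HB :=
  cbn [flat act Xc Xa Yc Ya den];
  rewrite ?(ten11 HB) ?(mcomp1f (proj1 (proj1 HB))) ?(mcompf1 (proj1 (proj1 HB)));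
  rewrite ?(tenlD HB) -?(mcompA (proj1 (proj1 HB))) -?(tenlD HB).

(* Both sides are turned into families of morphisms between right-nested
   tensor products, in which all structural isomorphisms are identities. *)
Ltac strict HB :=
  let B := lazymatch type of HB with is_braided ?B => B end in
  lazymatch goal with
  | |- @eq _ ?f ?g =>
      let F := reify_mor B HB f in let G := reify_mor B HB g in
      let t := fresh "t" in
      refine (St_inj HB F G _); intro t; strict_simpl HB
  end.

Ltac strict_hyp HB H :=
  let B := lazymatch type of HB with is_braided ?B => B end in
  lazymatch type of H with
  | @eq _ ?f ?g =>
      let F := reify_mor B HB f in let G := reify_mor B HB g in
      let E := constr:(St_eq HB F G H) in
      have := E; clear H; move=> H
  end.

(** * Calculus of the interchange *)

Section Interchange.
Variables (B : br_data) (HB : is_braided B).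
Let comp1f := mcomp1f (proj1 (proj1 HB)).
Let compf1 := mcompf1 (proj1 (proj1 HB)).
Let compA := mcompA (proj1 (proj1 HB)).

Lemma interchange_asc (a a' b b' x y : B) :
  Defs.interchange a b (a' ⊗ x) (b' ⊗ y) ∘ (mid _ ⊠ Defs.interchange a' b' x y)
    ∘ asc (a ⊗ b) (a' ⊗ b') (x ⊗ y) =
  (asc a a' x ⊠ asc b b' y) ∘ Defs.interchange (a ⊗ a') (b ⊗ b') x y
    ∘ (Defs.interchange a b a' b' ⊠ mid _).
Proof. by strict HB; rewrite Y0_nat. Qed.

Lemma interchange_nat (a a' b b' x x' y y' : B) (f : Mor a a') (g : Mor b b')
    (h : Mor x x') (k : Mor y y') :
  Defs.interchange a' b' x' y' ∘ ((f ⊠ g) ⊠ (h ⊠ k)) =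
  ((f ⊠ h) ⊠ (g ⊠ k)) ∘ Defs.interchange a b x y.
Proof.
strict HB.
have /= nat1 := Yc_nat HB (OA b') (@St_sat _ HB (OA x) (OA x') h).
have /= nat2 := Yc_nat2 HB (OA x) (@St_sat _ HB (OA b) (OA b') g).
have /= natf := @sat_nat _ HB (OA a) (OA a') f.
have /= natg := @sat_nat _ HB (OA b) (OA b') g.
rewrite compA -natf -compA -(tenlD HB); congr (_ ∘ (_ ⊠ _)).
rewrite (tenlD HB b) (comp_tail HB (natg _ _ _)) -compA (comp_tail HB (nat1 _)).
by rewrite -compA (comp_tail HB (nat2 _)) -compA Y0_nat.
Qed.

Lemma asc_interchange (a b c x y z : B) :
  (mid (a ⊗ x) ⊠ Defs.interchange b c y z) ∘ Defs.interchange a (b ⊗ c) x (y ⊗ z)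
    ∘ (asc a b c ⊠ asc x y z) =
  asc (a ⊗ x) (b ⊗ y) (c ⊗ z) ∘ (Defs.interchange a b x y ⊠ mid (c ⊗ z))
    ∘ Defs.interchange (a ⊗ b) c (x ⊗ y) z.
Proof.
strict HB.
congr (_ ⊠ _).
by rewrite (tenlD HB b) (comp_tail HB (Y0_nat HB _ _ _)) -compA.
Qed.

(** With [e] and [f] evaluations, this is the transposed form of functoriality of the tensor product
    on the self-enrichment. *)
Lemma interchange_comp (h h' k k' x x' y y' z z' : B) (e : Mor (h ⊗ y) z)
    (e' : Mor (h' ⊗ y') z') (f : Mor (k ⊗ x) y) (f' : Mor (k' ⊗ x') y') :
  ((e ∘ (mid h ⊠ f) ∘ asc h k x) ⊠ (e' ∘ (mid h' ⊠ f') ∘ asc h' k' x'))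
    ∘ Defs.interchange (h ⊗ k) (h' ⊗ k') x x'
    ∘ (Defs.interchange h h' k k' ⊠ mid (x ⊗ x')) =
  (e ⊠ e') ∘ Defs.interchange h h' y y'
    ∘ (mid (h ⊗ h') ⊠ ((f ⊠ f') ∘ Defs.interchange k k' x x'))
    ∘ asc (h ⊗ h') (k ⊗ k') (x ⊗ x').
Proof.
rewrite [_ ⊠ ((f ⊠ f') ∘ _)](tenlD HB) -[in RHS](ten11 HB h h').
rewrite -[X in _ = X ∘ _]compA [X in _ = _ ∘ X ∘ _]compA (interchange_nat _ _ _ _).
rewrite !(ten_comp HB) -3![LHS]compA -[RHS]compA.
congr (_ ∘ _); rewrite -2![RHS]compA; congr (_ ∘ _).
by rewrite [LHS]compA -interchange_asc !(ten11 HB) -[LHS]compA.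
Qed.

(** With each [e] an evaluation, this is the transposed form of enriched naturality of the
    associator. *)
Lemma interchange_assoc (h1 h2 h3 x1 x2 x3 y1 y2 y3 : B) (e1 : Mor (h1 ⊗ x1) y1)
    (e2 : Mor (h2 ⊗ x2) y2) (e3 : Mor (h3 ⊗ x3) y3) :
  asc y1 y2 y3 ∘ ((((e1 ⊠ e2) ∘ Defs.interchange h1 h2 x1 x2) ⊠ e3)
    ∘ Defs.interchange (h1 ⊗ h2) h3 (x1 ⊗ x2) x3) =
  (e1 ⊠ ((e2 ⊠ e3) ∘ Defs.interchange h2 h3 x2 x3))
    ∘ (Defs.interchange h1 (h2 ⊗ h3) x1 (x2 ⊗ x3) ∘ (asc h1 h2 h3 ⊠ asc x1 x2 x3)).
Proof.
have -> : ((e1 ⊠ e2) ∘ Defs.interchange h1 h2 x1 x2) ⊠ e3 =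
    ((e1 ⊠ e2) ⊠ e3) ∘ (Defs.interchange h1 h2 x1 x2 ⊠ mid _).
  by rewrite -(ten_comp HB) compf1.
have -> : e1 ⊠ ((e2 ⊠ e3) ∘ Defs.interchange h2 h3 x2 x3) =
    (e1 ⊠ (e2 ⊠ e3)) ∘ (mid _ ⊠ Defs.interchange h2 h3 x2 x3).
  by rewrite -(ten_comp HB) compf1.
rewrite -[X in _ ∘ X]compA [LHS]compA (asc_nat HB) -[LHS]compA -[RHS]compA.
congr (_ ∘ _); rewrite [LHS]compA [RHS]compA.
exact: esym (asc_interchange _ _ _ _ _ _).
Qed.

(** By naturality in [e], crossing [w] means crossing [h] and then [z]; the first cancels against
    the inverse braiding. With [e] an evaluation, this is enriched naturality of the half-braiding
    given by the braiding with [x]. *)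
Lemma brd_slide (x h z w : B) (e : Mor (h ⊗ z) w) :
  brd x w ∘ ((mid x ⊠ e) ∘ asc x h z ∘ (bwd (brd x h) ⊠ mid z) ∘ bwd (asc h x z)) =
  (e ⊠ mid x) ∘ bwd (asc h z x) ∘ (mid h ⊠ brd x z).
Proof.
strict HB.
have /= E := Xc_nat2 HB (OA x) (@St_sat _ HB (OT (OA h) (OA z)) (OA w) e).
rewrite compA E -!compA; congr (_ ∘ _).
by rewrite (proj1 (X0K HB _ _ _)) compf1.
Qed.

(** Here nothing cancels: a positive crossing of [h] with [z] survives, which the center condition
    compares with the inverse one. *)
Lemma brd_slide_left (z h x y : B) (e : Mor (h ⊗ x) y) :
  brd y z ∘ (e ⊠ mid z) ∘ bwd (asc h x z) =
  (mid z ⊠ e) ∘ asc z h x ∘ (brd h z ⊠ mid x) ∘ bwd (asc h z x)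
    ∘ (mid h ⊠ brd x z).
Proof.
strict HB.
have /= E := Xc_nat HB (OA z) (@St_sat _ HB (OT (OA h) (OA x)) (OA y) e).
by rewrite E.
Qed.

(* The braiding is natural with respect to the interchange of factors only
   when the crossing of [h] and [y] does not depend on its sign. *)
Lemma brd_interchange (h k x y v w : B) (e : Mor (h ⊗ x) v) (f : Mor (k ⊗ y) w) :
  fwd (brd h y) = bwd (brd y h) ->
  brd v w ∘ ((e ⊠ f) ∘ Defs.interchange h k x y) =
  (f ⊠ e) ∘ Defs.interchange k h y x ∘ (brd h k ⊠ brd x y).
Proof.
move=> hy; rewrite [LHS]compA (brd_nat HB) -!(compA (f ⊠ e)); congr (_ ∘ _).
have E t : X0 h y t = Y0 y h t.
  have S1 := St_brd HB (OA h) (OA y); have S2 := St_brdV HB (OA y) (OA h).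
  exact: (St_eq HB S1 S2 hy).
by strict HB; rewrite (proj1 (X0K HB _ _ _)) compf1 E.
Qed.

End Interchange.

(** * Strict evaluation and coevaluation *)

Section Evaluation.
Variables (R : realType) (B : braided_fusion R).
Let HB : is_braided B := bf_braidedP B.
Let HM : is_monoidal B := proj1 HB.
Let HK : is_category B := proj1 HM.
Let comp1f := mcomp1f HK.
Let compf1 := mcompf1 HK.
Let compA := mcompA HK.

Local Notation "x ^*" := (bf_dual x).

Definition evs (e : oexp B) (t : B) : Mor ((den e)^* ⊗ flat e t) t :=
  @sat B (OT (OA (den e)^*) e) (O1 B) (bf_ev (den e)) t.
Definition coevs (e : oexp B) (t : B) : Mor t (flat e ((den e)^* ⊗ t)) :=
  @sat B (O1 B) (OT e (OA (den e)^*)) (bf_coev (den e)) t.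

Lemma St_ev e : @St B (OT (OA (den e)^*) e) (O1 B) (bf_ev (den e)) (evs e).
Proof. exact: (St_sat HB). Qed.
Lemma St_coev e : @St B (O1 B) (OT e (OA (den e)^*)) (bf_coev (den e)) (coevs e).
Proof. exact: (St_sat HB). Qed.

Lemma evs_nat e t s (g : Mor t s) :
  evs e s ∘ (mid (den e)^* ⊠ act e g) = g ∘ evs e t.
Proof. exact: (St_nat HB (St_ev e) g). Qed.

Lemma coevs_nat e t s (g : Mor t s) :
  coevs e s ∘ g = act e (mid (den e)^* ⊠ g) ∘ coevs e t.
Proof. exact: (St_nat HB (St_coev e) g). Qed.

Lemma zigzag1 e t : act e (evs e t) ∘ coevs e (flat e t) = mid (flat e t).
Proof.
have [H _] := bf_ldualP (den e).
have E1 := St_comp HB (St_comp HB (St_comp HB (St_comp HB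
  (St_run HB e) (St_ten HB (St_id HB e) (St_ev e)))
  (St_asc HB e (OA (den e)^*) e)) (St_ten HB (St_coev e) (St_id HB e)))
  (St_lunV HB e).
have := St_eq HB E1 (St_id HB e) H t.
by rewrite /= ?(act1 HB) ?comp1f ?compf1 ?(ten11 HB) ?comp1f ?compf1.
Qed.

Lemma zigzag2 e t : evs e ((den e)^* ⊗ t) ∘ (mid (den e)^* ⊠ coevs e t) = mid _.
Proof.
have [_ H] := bf_ldualP (den e); pose d := OA (den e)^*.
have E1 := St_comp HB (St_comp HB (St_comp HB (St_comp HB
  (St_lun HB d) (St_ten HB (St_ev e) (St_id HB d)))
  (St_ascV HB d e d)) (St_ten HB (St_id HB d) (St_coev e)))
  (St_runV HB d).
have := St_eq HB E1 (St_id HB d) H t.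
by rewrite /= ?(act1 HB) ?(ten11 HB) ?comp1f ?compf1.
Qed.

End Evaluation.

Ltac reify_atom B HB f ::=
  lazymatch f with
  | bf_ev ?x => let x' := reify_ob B x in constr:(St_ev x')
  | bf_coev ?x => let x' := reify_ob B x in constr:(St_coev x')
  | _ => reify_sat B HB f
  end.

(** * Evaluation and the self-enrichment *)

Section InternalHom.
Variables (R : realType) (B : braided_fusion R).
Let HB : is_braided B := bf_braidedP B.
Let HM : is_monoidal B := proj1 HB.
Let HK : is_category B := proj1 HM.
Let comp1f := mcomp1f HK.
Let compf1 := mcompf1 HK.
Let compA := mcompA HK.

Local Notation "x ^*" := (bf_dual x).

(** The counit of the adjunction between tensoring on the right with [x] and with its dual. *)
Definition evm (x y : B) : Mor ((y ⊗ x^*) ⊗ x) y :=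
  locked_with strict_key (run y ∘ (mid y ⊠ bf_ev x) ∘ asc y x^* x).

Lemma evm_coev (x y z : B) (f : Mor z (y ⊗ x^*)) :
  ((evm x y ∘ (f ⊠ mid x)) ⊠ mid x^*) ∘ bwd (asc z x x^*) ∘ (mid z ⊠ bf_coev x)
    ∘ bwd (run z) = f.
Proof.
rewrite /evm !unlock; strict HB.
have /= -> := sat_nat HB (x := OA z) (y := OT (OA y) (OA x^*)) f (coevs (OA x) t).
by rewrite compA -!(tenlD HB) (zigzag2 (OA x)) !(ten11 HB) comp1f.
Qed.

Lemma evm_inj (x y z : B) (f g : Mor z (y ⊗ x^*)) :
  evm x y ∘ (f ⊠ mid x) = evm x y ∘ (g ⊠ mid x) -> f = g.
Proof. by move=> e; rewrite -(evm_coev f) e evm_coev. Qed.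

Lemma evm_name (x y z : B) (f : Mor (z ⊗ x) y) :
  evm x y ∘ (((f ⊠ mid x^*) ∘ bwd (asc z x x^*) ∘ (mid z ⊠ bf_coev x)
    ∘ bwd (run z)) ⊠ mid x) = f.
Proof.
rewrite /evm !unlock; strict HB.
rewrite compA; have /= <- := sat_nat HB (x := OT (OA z) (OA x)) (y := OA y) f (evs (OA x) t).
by rewrite -compA -!(tenlD HB) (zigzag1 (OA x)) (ten11 HB) compf1.
Qed.

Lemma evm_id (x : B) : evm x x ∘ (bf_coev x ⊠ mid x) = lun x.
Proof. by rewrite /evm !unlock; strict HB; exact: (zigzag1 (OA x)). Qed.

Lemma evm_comp (x y z : B) :
  evm x z ∘ (@ecomp _ (self_ecat B) x y z ⊠ mid x) =
  evm y z ∘ (mid (z ⊗ y^*) ⊠ evm x y) ∘ asc (z ⊗ y^*) (y ⊗ x^*) x.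
Proof.
rewrite /evm !unlock /=; strict HB.
congr (_ ⊠ _); exact: esym (evs_nat (OA y) _).
Qed.

Lemma evm_self_name (x y : B) (f : Mor x y) :
  evm x y ∘ (self_name f ⊠ mid x) = f ∘ lun x.
Proof.
rewrite /evm /self_name !unlock; strict HB.
rewrite compA; have /= <- := sat_nat HB (x := OA x) (y := OA y) f (evs (OA x) t).
by rewrite -compA (zigzag1 (OA x)) compf1.
Qed.

(** The comparison of duals carries one evaluation to the other, by a zigzag for the chosen dual of
    [x ⊗ y]. Under evaluation that dual therefore disappears. *)
Lemma ev_dual_ten (x y : B) :
  bf_ev (x ⊗ y) ∘ (dual_ten x y ⊠ mid (x ⊗ y)) = ev_ten x y.
Proof.
rewrite /dual_ten /ev_ten; strict HB.
rewrite (comp_tail HB (esym (evs_nat (OA y) _))) -compA -(tenlD HB).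
rewrite (comp_tail HB (esym (evs_nat (OA x) _))) -compA -(tenlD HB).
by rewrite (zigzag1 (OT (OA x) (OA y))) (ten11 HB) compf1.
Qed.

(* Moving the dual of x to the right over h, or x to the left over h, before
   evaluating. *)
Lemma evs_crossing (x : B) (h : oexp B) (t : B) :
  act h (evs (OA x) t) ∘ Xc (OA x^*) h (x ⊗ t) =
  evs (OA x) (flat h t) ∘ (mid x^* ⊠ Yc (OA x) h t).
Proof.
have /= E := Xc_nat HB h (St_ev (OA x)) t.
have /= [K1 _] := XaK HB x h t.
rewrite -[Xa _ _ _]compf1 -(ten11 HB) -{1}K1.
by rewrite (tenlD HB) !compA -(compA (act _ _)) -E comp1f.
Qed.

Lemma evm_ten (x x' y y' : B) :
  evm (x ⊗ y) (x' ⊗ y') ∘ (@em_tenm _ (self_enrichment B) x x' y y' ⊠ mid _) =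
  (evm x x' ⊠ evm y y') ∘ Defs.interchange (x' ⊗ x^*) (y' ⊗ y^*) x y.
Proof.
rewrite /= !(tenrD HB) /evm !unlock !compA.
have -> : run (x' ⊗ y') ∘ mid (x' ⊗ y') ⊠ bf_ev (x ⊗ y)
    ∘ asc (x' ⊗ y') (x ⊗ y)^* (x ⊗ y) ∘ mid (x' ⊗ y') ⊠ dual_ten x y ⊠ mid (x ⊗ y)
    = run (x' ⊗ y') ∘ mid (x' ⊗ y') ⊠ ev_ten x y ∘ asc (x' ⊗ y') (y^* ⊗ x^*) (x ⊗ y).
  by rewrite -ev_dual_ten (tenlD HB) -!compA (asc_nat HB).
rewrite /ev_ten; strict HB.
have /= E := evs_crossing x (OT (OA y') (OA y^*)) (y ⊗ t).
apply: congr1; rewrite (tenlD HB x^*) (comp_tail HB (evs_nat (OA x) _)) -compA.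
by rewrite -E.
Qed.

End InternalHom.

(** * Reflecting axioms along faithful maps *)

Section Reflection.
Variables (M : mon_data) (Mor1 : M -> M -> Type) (id1 : forall x, Mor1 x x)
  (comp1 : forall x y z, Mor1 y z -> Mor1 x y -> Mor1 x z).
Let C1 := @CatData M Mor1 id1 comp1.
Variables (tm1 : forall x x' y y' : M,
    Mor1 x x' -> Mor1 y y' -> Mor1 (x ⊗ y) (x' ⊗ y'))
  (a1 : forall x y z : M, @isopair C1 ((x ⊗ y) ⊗ z) (x ⊗ (y ⊗ z)))
  (l1 : forall x : M, @isopair C1 (𝟙 ⊗ x) x)
  (r1 : forall x : M, @isopair C1 (x ⊗ 𝟙) x).
Let M1 := @MonData C1 (@MonStruct C1 (tunit M) (@ten M) tm1 a1 l1 r1).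
Variables (N : forall x y, Mor1 x y -> Mor x y).
Hypotheses (N_inj : forall x y, injective (@N x y))
  (N_id : forall x, N (id1 x) = mid x)
  (N_comp : forall x y z (g : Mor1 y z) (f : Mor1 x y),
     N (comp1 g f) = N g ∘ N f)
  (N_ten : forall x x' y y' (f : Mor1 x x') (g : Mor1 y y'),
     N (tm1 f g) = N f ⊠ N g)
  (N_asc : forall x y z, N (fwd (a1 x y z)) = fwd (asc x y z) /\
     N (bwd (a1 x y z)) = bwd (asc x y z))
  (N_lun : forall x, N (fwd (l1 x)) = fwd (lun x) /\
     N (bwd (l1 x)) = bwd (lun x))
  (N_run : forall x, N (fwd (r1 x)) = fwd (run x) /\
     N (bwd (r1 x)) = bwd (run x)).

Let NE := (N_comp, N_ten, N_id, (fun x y z => (N_asc x y z).1),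
  (fun x y z => (N_asc x y z).2), (fun x => (N_lun x).1),
  (fun x => (N_lun x).2), (fun x => (N_run x).1), (fun x => (N_run x).2)).

Lemma reflect_inverse (x y : M) (f : @isopair C1 x y) (f' : isopair x y) :
  N (fwd f) = fwd f' -> N (bwd f) = bwd f' -> mutually_inverse f' ->
  mutually_inverse f.
Proof.
by move=> e e' [p q]; split; apply: N_inj; rewrite [LHS]NE e e' ?p ?q [RHS]NE.
Qed.

(** [N] acts as a faithful, strictly monoidal functor that is the identity on objects, so equations
    may be checked after applying it; inverses belong to the data, hence invertibility is equational
    too. *)
Lemma reflect_monoidal : is_monoidal M -> is_monoidal M1.
Proof.
case=> [[c1 c2 cA] [t1 [tc [aK [lK [rK [an [ln [rn [pe tr]]]]]]]]]].
split; first split.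
- by move=> x y f; apply: N_inj; rewrite !NE c1.
- by move=> x y f; apply: N_inj; rewrite !NE c2.
- by move=> w x y z h g f; apply: N_inj; rewrite !NE cA.
split; first by move=> x y; apply: N_inj; rewrite !NE t1.
split; first by move=> *; apply: N_inj; rewrite !NE tc.
split; first by move=> x y z; have [e e'] := N_asc x y z; apply: reflect_inverse e e' _.
split; first by move=> x; have [e e'] := N_lun x; apply: reflect_inverse e e' _.
split; first by move=> x; have [e e'] := N_run x; apply: reflect_inverse e e' _.
split; first by move=> *; apply: N_inj; rewrite !NE an.
split; first by move=> *; apply: N_inj; rewrite !NE ln.
split; first by move=> *; apply: N_inj; rewrite !NE rn.
split; first by move=> *; apply: N_inj; rewrite !NE pe.
by move=> *; apply: N_inj; rewrite !NE tr.
Qed.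

Lemma reflect_braided (brd0 : forall x y : M, isopair (x ⊗ y) (y ⊗ x))
    (b1 : forall x y : M, @isopair C1 (x ⊗ y) (y ⊗ x)) :
  (forall x y, N (fwd (b1 x y)) = fwd (brd0 x y)) ->
  (forall x y, mutually_inverse (b1 x y)) ->
  is_braided (BrData brd0) -> is_braided (@BrData M1 b1).
Proof.
move=> Nb bK [HM [_ [bn [h1 h2]]]].
split; first exact: reflect_monoidal.
split; first exact: bK.
split; first by move=> *; apply: N_inj; rewrite !NE !Nb; exact: bn.
by split=> *; apply: N_inj; rewrite !(NE, Nb) /=; [exact: h1 | exact: h2].
Qed.

End Reflection.

(** * Composition with points in enriched categories *)

Section Enriched.
Variables (B : br_data) (HB : is_braided B).
Let HM : is_monoidal B := proj1 HB.
Let HK : is_category B := proj1 HM.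
Let comp1f := mcomp1f HK.
Let compf1 := mcompf1 HK.
Let compA := mcompA HK.

Lemma lunV_nat (x y : B) (f : Mor x y) :
  bwd (lun y) ∘ f = (mid 𝟙 ⊠ f) ∘ bwd (lun x).
Proof. by strict HB. Qed.

Lemma runV_nat (x y : B) (f : Mor x y) :
  bwd (run y) ∘ f = (f ⊠ mid 𝟙) ∘ bwd (run x).
Proof. by strict HB. Qed.

Lemma lunV1_runV1 : bwd (lun (tunit B)) = bwd (run 𝟙).
Proof. by strict HB. Qed.

Lemma postcomp_point (C : ecat_data B) (w x y : C) (f : uHom x y) (g : uHom w x) :
  postcomp w f ∘ g = @mcomp (underlying C) w x y f g.
Proof.
rewrite /postcomp -compA lunV_nat compA -(compA (ecomp _ _ _)) -(ten_comp HB).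
by rewrite compf1 comp1f.
Qed.

Lemma precomp_point (C : ecat_data B) (w x y : C) (f : uHom x y) (g : uHom y w) :
  precomp w f ∘ g = @mcomp (underlying C) x y w g f.
Proof.
rewrite /precomp -compA runV_nat compA -(compA (ecomp _ _ _)) -(ten_comp HB).
by rewrite compf1 comp1f -lunV1_runV1.
Qed.

(** Composing the identity on hom objects with a point [f] gives ordinary naturality at [f]. *)
Lemma enat_of_hom (C D : ecat_data B) (F G : efun_data C D)
    (xi : forall x : C, uHom (F x) (G x)) :
  (forall x y : C,
     postcomp (F x) (xi y) ∘ fm F x y = precomp (G y) (xi x) ∘ fm G x y) ->
  is_enat xi.
Proof.
move=> H; split=> // x y f.
have := congr1 (fun u => u ∘ (f : Mor 𝟙 (ehom x y))) (H x y).
by rewrite /= -(compA (postcomp _ _)) -(compA (precomp _ _)) postcomp_point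
  precomp_point.
Qed.

Lemma postcomp_id (C : ecat_data B) (x y : C) : is_ecategory C ->
  postcomp x (eid y) = mid (ehom x y).
Proof. by case=> _ H _; rewrite /postcomp H (proj1 (lunK HB _)). Qed.

Lemma precomp_id (C : ecat_data B) (x y : C) : is_ecategory C ->
  precomp y (eid x) = mid (ehom x y).
Proof. by case=> _ _ H; rewrite /precomp H (proj1 (runK HB _)). Qed.

End Enriched.

(** * Enriched monoidal categories with smaller hom objects *)

Section Sub.
Variables (B : br_data) (HB : is_braided B) (C : emon_data B).
Let HM : is_monoidal B := proj1 HB.
Let HK : is_category B := proj1 HM.
Let comp1f := mcomp1f HK.
Let compf1 := mcompf1 HK.
Let compA := mcompA HK.

Variables (h : C -> C -> B) (i : forall x, Mor 𝟙 (h x x))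
  (m : forall x y z, Mor (h y z ⊗ h x y) (h x z)).
Let D0 := @ECatData B C h i m.
Variables (tm : forall x x' y y' : C,
    Mor (h x x' ⊗ h y y') (h (em_ten x y) (em_ten x' y')))
  (a : forall x y z : C,
    @uisopair B D0 (em_ten (em_ten x y) z) (em_ten x (em_ten y z)))
  (l : forall x : C, @uisopair B D0 (em_ten (em_unit C) x) x)
  (r : forall x : C, @uisopair B D0 (em_ten x (em_unit C)) x).
Let D := @EMonData B D0 (em_unit C) (@em_ten B C) tm a l r.

Variable J : forall x y, Mor (h x y) (ehom x y).
Hypotheses (J_mono : forall x y, is_mono (J x y))
  (J_id : forall x, J x x ∘ i x = eid x)
  (J_comp : forall x y z, J x z ∘ m x y z = ecomp x y z ∘ (J y z ⊠ J x y))
  (J_ten : forall x x' y y', J (em_ten x y) (em_ten x' y') ∘ tm x x' y y' =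
     em_tenm x x' y y' ∘ (J x x' ⊠ J y y'))
  (J_asc : forall x y z, J _ _ ∘ fwd (a x y z) = fwd (em_asc x y z) /\
     J _ _ ∘ bwd (a x y z) = bwd (em_asc x y z))
  (J_lun : forall x, J _ _ ∘ fwd (l x) = fwd (em_lun x) /\
     J _ _ ∘ bwd (l x) = bwd (em_lun x))
  (J_run : forall x, J _ _ ∘ fwd (r x) = fwd (em_run x) /\
     J _ _ ∘ bwd (r x) = bwd (em_run x)).

Lemma sub_ecategory : is_ecategory C -> is_ecategory D.
Proof.
case=> [cA c1 c2]; split.
- move=> w x y z; apply: J_mono; rewrite /= !compA !J_comp.
  rewrite -[LHS]compA -(compA (ecomp _ _ _) _ (mid _ ⊠ _)) -!(ten_comp HB).
  rewrite !J_comp !compf1 (ten_compl HB) (ten_compr HB) compA cA.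
  by rewrite -!compA (asc_nat HB).
- move=> x y; apply: J_mono; rewrite /= compA J_comp -compA -(ten_comp HB).
  by rewrite J_id compf1 (tenlr HB) compA c1 (lun_nat HB).
- move=> x y; apply: J_mono; rewrite /= compA J_comp -compA -(ten_comp HB).
  by rewrite J_id compf1 (tenlr HB) (ten_swap HB) compA c2 (run_nat HB).
Qed.

Lemma sub_postcomp (w x y : C) (f : @uHom B D x y) :
  J w y ∘ postcomp (C := D) w f = postcomp (C := C) w (J x y ∘ f) ∘ J w x.
Proof.
rewrite /postcomp /= !compA J_comp -!compA; congr (_ ∘ _).
rewrite (lunV_nat HB) !compA -!(ten_comp HB).
by rewrite !compf1 !comp1f.
Qed.

Lemma sub_precomp (w x y : C) (f : @uHom B D x y) :
  J x w ∘ precomp (C := D) w f = precomp (C := C) w (J x y ∘ f) ∘ J y w.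
Proof.
rewrite /precomp /= !compA J_comp -!compA; congr (_ ∘ _).
rewrite (runV_nat HB) !compA -!(ten_comp HB).
by rewrite !compf1 !comp1f.
Qed.

Let N (x y : C) (f : @uHom B D x y) : @uHom B C x y := J x y ∘ f.

Let N_inj x y : injective (@N x y).
Proof. by move=> f g; apply: J_mono. Qed.

Let N_comp (x y z : C) (g : @uHom B D y z) (f : @uHom B D x y) :
  @N x z (@mcomp (underlying D) x y z g f) =
  @mcomp (underlying C) x y z (N g) (N f).
Proof.
change (J x z ∘ (m x y z ∘ (g ⊠ f) ∘ bwd (lun 𝟙)) =
  ecomp x y z ∘ ((J y z ∘ g) ⊠ (J x y ∘ f)) ∘ bwd (lun 𝟙)).
by rewrite !compA J_comp -(compA (ecomp _ _ _)) -(ten_comp HB).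
Qed.

Let N_id (x : C) : @N x x (i x) = eid x.
Proof. exact: J_id. Qed.

Let N_ten (x x' y y' : C) (f : @uHom B D x x') (g : @uHom B D y y') :
  @N (em_ten x y) (em_ten x' y') (@tenm (underlying_mon D) x x' y y' f g) =
  @tenm (underlying_mon C) x x' y y' (N f) (N g).
Proof.
change (J _ _ ∘ (tm x x' y y' ∘ (f ⊠ g) ∘ bwd (lun 𝟙)) =
  em_tenm x x' y y' ∘ ((J x x' ∘ f) ⊠ (J y y' ∘ g)) ∘ bwd (lun 𝟙)).
by rewrite !compA J_ten -(compA (em_tenm _ _ _ _)) -(ten_comp HB).
Qed.

Lemma sub_underlying_monoidal :
  is_monoidal (underlying_mon C) -> is_monoidal (underlying_mon D).
Proof.
exact: (@reflect_monoidal (underlying_mon C) _ _ _ _ _ _ _ N N_inj N_id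
  N_comp N_ten J_asc J_lun J_run).
Qed.

(** [J] is the identity on objects and commutes strictly with all structure, so each axiom holds
    after composition with [J], and [J_mono] cancels it. *)
Lemma sub_emonoidal : is_emonoidal C -> is_emonoidal D.
Proof.
move=> [Cc [[F1 F2] [[[_ nl] _] [[[_ nr] _] [[[_ na] _] HC]]]]].
have HD := sub_underlying_monoidal HC.
split; first exact: sub_ecategory.
split.
  split.
    move=> [x y]; apply: J_mono; rewrite /= !compA J_ten.
    rewrite -(compA (em_tenm _ _ _ _)) -(ten_comp HB) !J_id.
    by have := F1 (x, y); rewrite /= compA => ->.
  move=> [x1 x2] [y1 y2] [z1 z2]; apply: J_mono; rewrite /= !compA J_ten J_comp.
  rewrite -(compA (em_tenm _ _ _ _)) -(ten_comp HB) !J_comp.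
  have := F2 (x1, x2) (y1, y2) (z1, z2); rewrite /= compA => E.
  rewrite -[RHS]compA -(ten_comp HB) !J_ten !(ten_comp HB).
  by rewrite [RHS]compA -E -[RHS]compA (interchange_nat HB) !compA.
have [_ [_ [_ [aK [lK [rK _]]]]]] := HD.
split; first split.
- apply: (enat_of_hom HB) => x y; apply: J_mono.
  rewrite [LHS]compA [RHS]compA sub_postcomp sub_precomp (proj1 (J_lun _)) (proj1 (J_lun _)).
  have := nl x y; rewrite /= !compf1 => <-.
  rewrite -[LHS]compA -[RHS]compA; congr (_ ∘ _).
  rewrite !compA J_ten -!compA; congr (_ ∘ _).
  by rewrite (lunV_nat HB) !compA -!(ten_comp HB) J_id comp1f !compf1.
- by move=> x; exact: mutually_inverse_iso (lK x).
split; first split.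
- apply: (enat_of_hom HB) => x y; apply: J_mono.
  rewrite [LHS]compA [RHS]compA sub_postcomp sub_precomp (proj1 (J_run _)) (proj1 (J_run _)).
  have := nr x y; rewrite /= !compf1 => <-.
  rewrite -[LHS]compA -[RHS]compA; congr (_ ∘ _).
  rewrite !compA J_ten -!compA; congr (_ ∘ _).
  by rewrite (runV_nat HB) !compA -!(ten_comp HB) J_id comp1f !compf1.
- by move=> x; exact: mutually_inverse_iso (rK x).
split=> //; split.
- apply: (enat_of_hom HB) => x y; apply: J_mono.
  rewrite [LHS]compA [RHS]compA sub_postcomp sub_precomp (proj1 (J_asc _ _ _)) (proj1 (J_asc _ _ _)).
  case: x y => [[x1 x2] x3] [[y1 y2] y3] /=.
  have /= E := na ((x1, x2), x3) ((y1, y2), y3).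
  have e1 : J _ _ ∘ (tm _ _ _ _ ∘ (tm x1 y1 x2 y2 ⊠ mid (h x3 y3))) =
      em_tenm _ _ _ _ ∘ (em_tenm _ _ _ _ ⊠ mid _)
        ∘ ((J x1 y1 ⊠ J x2 y2) ⊠ J x3 y3).
    rewrite !compA J_ten -!compA -!(ten_comp HB); congr (_ ∘ _).
    by rewrite J_ten comp1f compf1.
  have e2 : J _ _ ∘ (tm _ _ _ _ ∘ ((mid (h x1 y1) ⊠ tm x2 y2 x3 y3) ∘ asc _ _ _)) =
      em_tenm _ _ _ _ ∘ ((mid _ ⊠ em_tenm _ _ _ _) ∘ asc _ _ _)
        ∘ ((J x1 y1 ⊠ J x2 y2) ⊠ J x3 y3).
    rewrite !compA J_ten -!compA (asc_nat HB) !compA -!(compA (em_tenm _ _ _ _)).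
    by rewrite -!(ten_comp HB) J_ten comp1f compf1.
  by rewrite -[LHS]compA e1 -[RHS]compA e2 [LHS]compA [RHS]compA E.
- by move=> x; exact: mutually_inverse_iso (aK x.1.1 x.1.2 x.2).
Qed.
Variables (brdC : forall x y : C, uisopair (em_ten x y) (em_ten y x))
  (b : forall x y : C, @uisopair B D (em_ten x y) (em_ten y x)).
Let Cb := EBrData brdC.
Let Db := @EBrData B D b.
Hypotheses (J_brd : forall x y, J _ _ ∘ fwd (b x y) = fwd (brdC x y))
  (bK : forall x y, @mutually_inverse (underlying D) _ _ (b x y)).

Lemma sub_ebraided : is_ebraided Cb -> is_ebraided Db.
Proof.
move=> [HC [com [[[_ nb] _] Hbr]]].
split; first exact: sub_emonoidal HC.
split.
  move=> [x1 x2] [y1 y2]; apply: J_mono.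
  have /= E := com (x1, x2) (y1, y2); rewrite compA in E.
  rewrite /= !compA J_ten -!compA (compA (J _ _ ⊠ _)) -!(brd_nat HB).
  by rewrite -compA -(brd_nat HB) !compA E.
split; last first.
  exact: (@reflect_braided (underlying_mon C) _ _ _ _ _ _ _ N N_inj N_id
    N_comp N_ten J_asc J_lun J_run _ _ J_brd bK Hbr).
split; last by move=> x; exact: mutually_inverse_iso (bK x.1 x.2).
apply: (enat_of_hom HB) => -[x1 x2] [y1 y2]; apply: J_mono.
have /= E := nb (x1, x2) (y1, y2).
rewrite [LHS]compA [RHS]compA sub_postcomp sub_precomp !J_brd /=.
rewrite -[LHS]compA -[RHS]compA J_ten (compA (J _ _)) J_ten.
by rewrite -[X in _ = _ ∘ X]compA -(brd_nat HB) !(compA (em_tenm _ _ _ _))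
  [LHS]compA [RHS]compA E.
Qed.

Let F := @EMFunData B D C (@EFunData B D C id J) (@eid B C (em_unit C))
  (fun x y : C => @eid B C (em_ten x y)).

(** The constraints of [F] are identities, so the axioms of a braided monoidal functor only say that
    [J] preserves the structure morphisms. *)
Lemma sub_ebraided_equivalence : (forall x y, is_iso (J x y)) -> is_ebraided Cb ->
  @is_ebraided_equivalence B Db Cb F.
Proof.
move=> J_iso [HC [_ [_ Hbr]]].
have [HK' [t1 _]] := proj1 Hbr.
have u1 := mcomp1f HK'; have u2 := mcompf1 HK'.
pose U := underlying_mon C; pose U' := underlying_mon D.
pose G : mfun_data U' U := underlying_mfun F.
have FF : is_efunctor F by split=> *; [exact: J_id | exact: J_comp].
have Hfun : is_functor (underlying_fun F) by split=> *; [exact: J_id | exact: N_comp].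
have Ga (x y z : U') : fmor G (@asc U' x y z) = fwd (@asc U x y z) := (J_asc x y z).1.
have Gl (x : U') : fmor G (@lun U' x) = fwd (@lun U x) := (J_lun x).1.
have Gr (x : U') : fmor G (@run U' x) = fwd (@run U x) := (J_run x).1.
have Gb (x y : U') : fmor G (b x y) = fwd (brdC x y) := J_brd x y.
have G1 : mf_unit G = @mid U (em_unit C) by [].
have G2 (x y : U') : mf_ten G x y = @mid U (@ten U x y) by [].
have HF : is_monoidal_functor G.
  split=> //; split; first exact: (iso_mid HK').
  split; first by move=> x y; exact: (iso_mid HK').
  split; first by move=> x x' y y' f g; rewrite [LHS]u1 [RHS]u2 -N_ten.
  split.
    by move=> x y z; rewrite !G2 Ga !t1 !u1 !u2.
  by split=> x; rewrite G1 G2 ?Gl ?Gr !t1 !u2.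
split; first split=> //.
  split=> //; split; last by move=> x; exact: (iso_mid HK').
  apply: (enat_of_hom HB) => -[x1 x2] [y1 y2] /=.
  rewrite (postcomp_id HB _ _ (proj1 HC)) (precomp_id HB _ _ (proj1 HC)).
  by rewrite !comp1f J_ten.
split.
  by split=> // x y; rewrite !G2 u1; exact: etrans (u2 _ _ _) (Gb x y).
split=> // d; exists d; exists (eid d); exact: (iso_mid HK').
Qed.
End Sub.

(** * Monoidal axioms of the self-enrichment *)

Section SelfMonoidal.
Variables (R : realType) (B : braided_fusion R).
Let HB : is_braided B := bf_braidedP B.
Let HM : is_monoidal B := proj1 HB.
Let HK : is_category B := proj1 HM.
Let comp1f := mcomp1f HK.
Let compf1 := mcompf1 HK.
Let compA := mcompA HK.

Local Notation "x ^*" := (bf_dual x).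
Local Notation S := (self_enrichment B).

Definition unname (x y : B) (f : @uHom B S x y) : Mor x y :=
  evm x y ∘ (f ⊠ mid x) ∘ bwd (lun x).

Lemma unname_inj (x y : B) : injective (@unname x y).
Proof.
move=> f g e; apply: evm_inj.
by apply: (iso_epi HK (mutually_inverse_isoV (lunK HB x))).
Qed.

Lemma self_nameK (x y : B) : cancel (@self_name R B x y) (@unname x y).
Proof.
move=> f; rewrite /unname evm_self_name -compA.
by rewrite (proj1 (lunK HB x)) compf1.
Qed.

Lemma unnameK (x y : B) : cancel (@unname x y) (@self_name R B x y).
Proof. by move=> f; apply: unname_inj; rewrite self_nameK. Qed.

Lemma self_name_inj (x y : B) : injective (@self_name R B x y).
Proof. exact: can_inj (@self_nameK x y). Qed.

Lemma unname_id (x : B) : unname (@eid _ S x) = mid x.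
Proof. by rewrite /unname evm_id (proj1 (lunK HB x)). Qed.

Lemma unname_comp (x y z : B) (g : Mor 𝟙 (z ⊗ y^*)) (f : Mor 𝟙 (y ⊗ x^*)) :
  unname (@mcomp (underlying S) x y z g f) = @unname y z g ∘ @unname x y f.
Proof.
(* Composition in the underlying category is unfolded to composition in [B], which the reification
   can see. *)
change (evm x z ∘ ((@ecomp _ (self_ecat B) x y z ∘ (g ⊠ f) ∘ bwd (lun 𝟙)) ⊠ mid x) ∘ bwd (lun x) =
  @unname y z g ∘ @unname x y f).
rewrite 2!(tenrD HB) !compA evm_comp /unname.
strict HB.
have /= E := @sat_nat _ HB (O1 B) (OT (OA z) (OA y^*)) g.
by rewrite !E !(tenlD HB) -!compA.
Qed.

Lemma unname_ten (x x' y y' : B) (f : Mor 𝟙 (x' ⊗ x^*)) (g : Mor 𝟙 (y' ⊗ y^*)) :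
  @unname (x ⊗ y) (x' ⊗ y') (@tenm (underlying_mon S) x x' y y' f g) =
  @unname x x' f ⊠ @unname y y' g.
Proof.
change (evm (x ⊗ y) (x' ⊗ y') ∘ ((@em_tenm _ S x x' y y' ∘ (f ⊠ g) ∘ bwd (lun 𝟙))
  ⊠ mid (x ⊗ y)) ∘ bwd (lun (x ⊗ y)) =
  @unname x x' f ⊠ @unname y y' g).
rewrite 2!(tenrD HB) !compA evm_ten /unname.
strict HB; congr (_ ∘ _).
have /= E := @sat_nat _ HB (O1 B) (OT (OA x') (OA x^*)) f.
rewrite !E !compA; congr (_ ∘ _); rewrite -!compA -!(tenlD HB).
apply: congr1; apply: congr1.
have /= E2 := Yc_nat2 HB (OA x)
  (@St_sat _ HB (O1 B) (OT (OA y') (OA y^*)) g) (y ⊗ t).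
rewrite -compA compf1 in E2.
by rewrite E2 (tenlD HB).
Qed.
Lemma unname_struct (x y : B) (f : isopair x y) :
  unname (fwd (self_isopair f)) = fwd f /\ unname (bwd (self_isopair f)) = bwd f.
Proof. by split; exact: self_nameK. Qed.

Lemma self_underlying_monoidal : is_monoidal (underlying_mon S).
Proof.
exact: (@reflect_monoidal B _ _ _ _ _ _ _ unname unname_inj unname_id unname_comp
  unname_ten (fun x y z => unname_struct (asc x y z))
  (fun x => unname_struct (lun x)) (fun x => unname_struct (run x)) HM).
Qed.

Lemma sat_evm_name (x y : B) (f : Mor x y) (t : B) :
  @sat B (OT (OT (OA y) (OA x^*)) (OA x)) (OA y) (evm x y) t
    ∘ @sat B (O1 B) (OT (OA y) (OA x^*)) (self_name f) (x ⊗ t) =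
  @sat B (OA x) (OA y) f t.
Proof.
have E := evm_self_name f; strict_hyp HB E; move: (E t).
by strict_simpl HB.
Qed.

Lemma evm_postcomp (w x y : B) (f : Mor x y) :
  evm w y ∘ (@postcomp _ (self_ecat B) w x y (self_name f) ⊠ mid w) =
  f ∘ evm w x.
Proof.
have -> : @postcomp _ (self_ecat B) w x y (self_name f) ⊠ mid w =
    (@ecomp _ (self_ecat B) w x y ⊠ mid w) ∘ ((self_name f ⊠ mid (x ⊗ w^*)) ⊠ mid w)
    ∘ (bwd (lun (x ⊗ w^*)) ⊠ mid w).
  by rewrite -!(tenrD HB).
rewrite !compA evm_comp; strict HB.
have /= E := @sat_nat _ HB (O1 B) (OT (OA y) (OA x^*)) (self_name f).
by rewrite -E !compA sat_evm_name.
Qed.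

Lemma evm_precomp (w x y : B) (f : Mor x y) :
  evm x w ∘ (@precomp _ (self_ecat B) w x y (self_name f) ⊠ mid x) =
  evm y w ∘ (mid (w ⊗ y^*) ⊠ f).
Proof.
have -> : @precomp _ (self_ecat B) w x y (self_name f) ⊠ mid x =
    (@ecomp _ (self_ecat B) x y w ⊠ mid x) ∘ ((mid (w ⊗ y^*) ⊠ self_name f) ⊠ mid x)
    ∘ (bwd (run (w ⊗ y^*)) ⊠ mid x).
  by rewrite -!(tenrD HB).
rewrite !compA evm_comp; strict HB.
by rewrite sat_evm_name.
Qed.

Lemma sat_evm_coev (x t : B) :
  @sat B (OT (OT (OA x) (OA x^*)) (OA x)) (OA x) (evm x x) t
    ∘ coevs (OA x) (x ⊗ t) = mid (x ⊗ t).
Proof.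
have E := evm_id x; strict_hyp HB E; move: (E t).
by strict_simpl HB.
Qed.

(** Inserting the identity of [x] in [evm_ten] leaves an inverse crossing of [x] with the hom
    object, whereas [evm_fixr] has none. This asymmetry governs both half-braidings and the hom
    objects of the center. *)
Lemma evm_fixl (x z w : B) :
  evm (x ⊗ z) (x ⊗ w) ∘ (fm (efun_fixl (eten S) x) z w ⊠ mid (x ⊗ z)) =
  (mid x ⊠ evm z w) ∘ asc x (w ⊗ z^*) z
    ∘ (bwd (brd x (w ⊗ z^*)) ⊠ mid z) ∘ bwd (asc (w ⊗ z^*) x z).
Proof.
have -> : fm (efun_fixl (eten S) x) z w ⊠ mid (x ⊗ z) =
  (@em_tenm _ S x x z w ⊠ mid (x ⊗ z))
  ∘ ((bf_coev x ⊠ mid (w ⊗ z^*)) ⊠ mid (x ⊗ z))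
  ∘ (bwd (lun (w ⊗ z^*)) ⊠ mid (x ⊗ z)) by rewrite -!(tenrD HB).
rewrite !compA evm_ten.
have -> : evm x x ⊠ evm z w = (mid x ⊠ evm z w) ∘ (evm x x ⊠ mid _).
  by rewrite -(ten_comp HB) comp1f compf1.
strict HB; congr (_ ∘ _).
have /= E := coevs_nat (OA x).
by rewrite -E (compA _ (coevs (OA x) _)) -E !compA sat_evm_coev comp1f.
Qed.

Lemma evm_fixr (y z w : B) :
  evm (z ⊗ y) (w ⊗ y) ∘ (fm (efun_fixr (eten S) y) z w ⊠ mid (z ⊗ y)) =
  (evm z w ⊠ mid y) ∘ bwd (asc (w ⊗ z^*) z y).
Proof.
have -> : fm (efun_fixr (eten S) y) z w ⊠ mid (z ⊗ y) =
  (@em_tenm _ S z w y y ⊠ mid (z ⊗ y))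
  ∘ ((mid (w ⊗ z^*) ⊠ bf_coev y) ⊠ mid (z ⊗ y))
  ∘ (bwd (run (w ⊗ z^*)) ⊠ mid (z ⊗ y)) by rewrite -!(tenrD HB).
rewrite !compA evm_ten.
strict HB.
have /= E := Yc_nat2 HB (OA z) (St_coev (OA y)) (y ⊗ t).
rewrite -compA compf1 in E.
by rewrite E -!(tenlD HB) sat_evm_coev !(ten11 HB) compf1.
Qed.

Lemma evm_comp_tail (T x y z : B) (h : Mor T ((z ⊗ y^*) ⊗ (y ⊗ x^*))) :
  evm x z ∘ ((@ecomp _ (self_ecat B) x y z ∘ h) ⊠ mid x) =
  evm y z ∘ (mid (z ⊗ y^*) ⊠ evm x y) ∘ asc (z ⊗ y^*) (y ⊗ x^*) x ∘ (h ⊠ mid x).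
Proof. by rewrite [X in _ ∘ X](tenrD HB) [LHS]compA evm_comp. Qed.

Lemma evm_ten_tail (T x x' y y' : B) (h : Mor T ((x' ⊗ x^*) ⊗ (y' ⊗ y^*))) :
  evm (x ⊗ y) (x' ⊗ y') ∘ ((@em_tenm _ S x x' y y' ∘ h) ⊠ mid (x ⊗ y)) =
  (evm x x' ⊠ evm y y') ∘ Defs.interchange (x' ⊗ x^*) (y' ⊗ y^*) x y
    ∘ (h ⊠ mid (x ⊗ y)).
Proof. by rewrite [X in _ ∘ X](tenrD HB) [LHS]compA evm_ten. Qed.

Lemma evm_postcomp_tail (T w x y : B) (f : Mor x y) (h : Mor T (x ⊗ w^*)) :
  evm w y ∘ ((@postcomp _ (self_ecat B) w x y (self_name f) ∘ h) ⊠ mid w) =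
  f ∘ evm w x ∘ (h ⊠ mid w).
Proof. by rewrite [X in _ ∘ X](tenrD HB) [LHS]compA evm_postcomp. Qed.

Lemma evm_precomp_tail (T w x y : B) (f : Mor x y) (h : Mor T (w ⊗ y^*)) :
  evm x w ∘ ((@precomp _ (self_ecat B) w x y (self_name f) ∘ h) ⊠ mid x) =
  evm y w ∘ (h ⊠ f).
Proof.
by rewrite [X in _ ∘ X](tenrD HB) [LHS]compA evm_precomp -compA -(ten_comp HB)
  comp1f compf1.
Qed.

Local Notation E := (self_ecat B).

Lemma self_ecategory : is_ecategory E.
Proof.
split.
- change (forall w x y z : B, @ecomp _ E w x z ∘ (@ecomp _ E x y z ⊠ mid (x ⊗ w^*)) =
    @ecomp _ E w y z ∘ (mid (z ⊗ y^*) ⊠ @ecomp _ E w x y)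
    ∘ asc (z ⊗ y^*) (y ⊗ x^*) (x ⊗ w^*)).
  move=> w x y z; apply: evm_inj.
  rewrite evm_comp_tail -(compA (_ ∘ _) (fwd (asc _ _ _))) (asc_natl HB) compA.
  rewrite -(compA (evm x z)) -(ten_swap HB) compA evm_comp.
  rewrite -(compA (@ecomp _ E w y z)) evm_comp_tail [X in _ = _ ∘ X](tenrD HB).
  rewrite [RHS]compA -(compA (_ ∘ _) (fwd (asc _ _ _))) (asc_nat HB) !compA.
  rewrite -(compA (evm y z) (_ ⊠ evm w y)) -(tenlD HB) evm_comp.
  by strict HB.
- change (forall x y : B, @ecomp _ E x y y ∘ (bf_coev y ⊠ mid (y ⊗ x^*)) = fwd (lun (y ⊗ x^*))).
  move=> x y; apply: evm_inj.
  rewrite evm_comp_tail; strict HB.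
  have /= F := coevs_nat (OA y).
  by rewrite -F compA sat_evm_coev comp1f.
- change (forall x y : B, @ecomp _ E x x y ∘ (mid (y ⊗ x^*) ⊠ bf_coev x) =
    fwd (run (y ⊗ x^*))).
  move=> x y; apply: evm_inj.
  rewrite evm_comp_tail; strict HB.
  by rewrite sat_evm_coev !(ten11 HB) compf1.
Qed.

Lemma self_tenm_id (x y : B) :
  @em_tenm _ S x x y y ∘ ((bf_coev x ⊠ bf_coev y) ∘ bwd (lun 𝟙)) = bf_coev (x ⊗ y).
Proof.
apply: (@evm_inj R B (x ⊗ y) (x ⊗ y)).
rewrite evm_ten_tail evm_id; strict HB.
(* The coevaluation of [x] slides past the crossings and the evaluation of [y] until it meets the
   evaluation of [x] and cancels; then the same happens for [y]. *)
have /= F := coevs_nat (OA x).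
rewrite (comp_tail HB (esym (F _ _ (mid y ⊠ Y0 x y^* (y ⊗ t))))) -compA.
rewrite (comp_tail HB (esym (F _ _ (Y0 x y (y^* ⊗ (y ⊗ t)))))) -compA.
rewrite (comp_tail HB (esym (F _ _ (mid x ⊠
  @sat B (OT (OT (OA y) (OA y^*)) (OA y)) (OA y) (evm y y) t)))) -compA.
rewrite (comp_tail HB (sat_evm_coev x (y ⊗ t))) comp1f.
have /= G := Yc_nat2 HB (OA x) (St_coev (OA y)) (y ⊗ t).
rewrite -compA compf1 in G.
by rewrite G -(tenlD HB) sat_evm_coev !(ten11 HB).
Qed.

Lemma self_eten_functor : is_efunctor (eten S).
Proof.
split; first by case=> x y; exact: self_tenm_id.
case=> x1 x2 [y1 y2] [z1 z2]; apply: (@evm_inj R B (x1 ⊗ x2) (z1 ⊗ z2)).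
change (evm (x1 ⊗ x2) (z1 ⊗ z2) ∘ ((@em_tenm _ S x1 z1 x2 z2 ∘
    ((@ecomp _ E x1 y1 z1 ⊠ @ecomp _ E x2 y2 z2)
     ∘ Defs.interchange (z1 ⊗ y1^*) (z2 ⊗ y2^*) (y1 ⊗ x1^*) (y2 ⊗ x2^*))) ⊠ mid (x1 ⊗ x2)) =
  evm (x1 ⊗ x2) (z1 ⊗ z2) ∘ ((@ecomp _ E (x1 ⊗ x2) (y1 ⊗ y2) (z1 ⊗ z2) ∘
    (@em_tenm _ S y1 z1 y2 z2 ⊠ @em_tenm _ S x1 y1 x2 y2)) ⊠ mid (x1 ⊗ x2))).
rewrite evm_ten_tail [X in _ ∘ X](tenrD HB) -[in LHS](ten11 HB x1 x2).
rewrite [LHS]compA -[X in X ∘ _]compA (interchange_nat HB) [X in X ∘ _]compA.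
rewrite -(ten_comp HB) !evm_comp (ten11 HB) (interchange_comp HB).
rewrite evm_comp_tail -[RHS]compA (asc_nat HB) [RHS]compA -[X in _ = X ∘ _]compA.
by rewrite -(ten_comp HB) comp1f evm_ten [X in _ = _ ∘ X ∘ _](tenlr HB)
  [X in _ = X ∘ _]compA evm_ten.
Qed.

Lemma self_lun_nat :
  is_enat_iso (F := efun_fixl (eten S) (em_unit S)) (G := efun_id S)
    (fun x => fwd (em_lun x)).
Proof.
have [_ [_ [_ [_ [lK _]]]]] := self_underlying_monoidal.
split; last by move=> x; exact: mutually_inverse_iso (lK x).
apply: (enat_of_hom HB); change (forall x y : B,
  @postcomp _ E (𝟙 ⊗ x) _ _ (self_name (lun y)) ∘ fm (efun_fixl (eten S) 𝟙) x y =
  @precomp _ E y _ _ (self_name (lun x)) ∘ mid (y ⊗ x^*)) => x y.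
apply: (@evm_inj R B (𝟙 ⊗ x) y).
rewrite evm_postcomp_tail evm_precomp_tail -compA evm_fixl.
by strict HB.
Qed.

Lemma self_run_nat :
  is_enat_iso (F := efun_fixr (eten S) (em_unit S)) (G := efun_id S)
    (fun x => fwd (em_run x)).
Proof.
have [_ [_ [_ [_ [_ [rK _]]]]]] := self_underlying_monoidal.
split; last by move=> x; exact: mutually_inverse_iso (rK x).
apply: (enat_of_hom HB); change (forall x y : B,
  @postcomp _ E (x ⊗ 𝟙) _ _ (self_name (run y)) ∘ fm (efun_fixr (eten S) 𝟙) x y =
  @precomp _ E y _ _ (self_name (run x)) ∘ mid (y ⊗ x^*)) => x y.
apply: (@evm_inj R B (x ⊗ 𝟙) y).
rewrite evm_postcomp_tail evm_precomp_tail -compA evm_fixr.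
by strict HB.
Qed.

Lemma self_asc_nat :
  is_enat_iso
    (F := efun_comp (eten S) (efun_prod (eten S) (efun_id S)))
    (G := efun_comp (eten S)
            (efun_comp (efun_prod (efun_id S) (eten S)) (efun_assoc S S S)))
    (fun p => fwd (em_asc p.1.1 p.1.2 p.2)).
Proof.
have [_ [_ [_ [aK _]]]] := self_underlying_monoidal.
split; last by move=> [[x y] z]; exact: mutually_inverse_iso (aK x y z).
apply: (enat_of_hom HB) => -[[x1 x2] x3] [[y1 y2] y3].
apply: (@evm_inj R B (x1 ⊗ x2 ⊗ x3) (y1 ⊗ (y2 ⊗ y3))).
change (evm (x1 ⊗ x2 ⊗ x3) (y1 ⊗ (y2 ⊗ y3)) ∘ ((@postcomp _ E _ _ _
    (self_name (asc y1 y2 y3)) ∘ (@em_tenm _ S (x1 ⊗ x2) (y1 ⊗ y2) x3 y3 ∘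
    (@em_tenm _ S x1 y1 x2 y2 ⊠ mid (y3 ⊗ x3^*)))) ⊠ mid (x1 ⊗ x2 ⊗ x3)) =
  evm (x1 ⊗ x2 ⊗ x3) (y1 ⊗ (y2 ⊗ y3)) ∘ ((@precomp _ E _ _ _
    (self_name (asc x1 x2 x3)) ∘ (@em_tenm _ S x1 y1 (x2 ⊗ x3) (y2 ⊗ y3) ∘
    ((mid (y1 ⊗ x1^*) ⊠ @em_tenm _ S x2 y2 x3 y3) ∘ asc _ _ _)))
    ⊠ mid (x1 ⊗ x2 ⊗ x3))).
rewrite evm_postcomp_tail evm_precomp_tail -[LHS]compA evm_ten_tail.
rewrite -(ten11 HB (x1 ⊗ x2) x3) -[X in _ ∘ X]compA (interchange_nat HB).
rewrite [X in _ ∘ X]compA -(ten_comp HB) evm_ten (ten11 HB) compf1 (interchange_assoc HB).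
rewrite -[X in _ = _ ∘ (_ ⊠ X)]comp1f (ten_compl HB).
rewrite [RHS]compA evm_ten (ten_comp HB) -[in RHS](ten11 HB x1 (x2 ⊗ x3)).
rewrite [RHS]compA -[X in _ = X ∘ _]compA (interchange_nat HB) [X in _ = X ∘ _]compA.
by rewrite -(ten_comp HB) (ten11 HB) compf1 evm_ten -[RHS]compA.
Qed.

Lemma self_emonoidal : is_emonoidal S.
Proof.
split; first exact: self_ecategory.
split; first exact: self_eten_functor.
split; first exact: self_lun_nat.
split; first exact: self_run_nat.
split; [exact: self_asc_nat | exact: self_underlying_monoidal].
Qed.
End SelfMonoidal.

(** * Half-braidings of the self-enrichment *)

Section SelfCenter.
Variables (R : realType) (B : braided_fusion R).
Let HB : is_braided B := bf_braidedP B.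
Let HM : is_monoidal B := proj1 HB.
Let HK : is_category B := proj1 HM.
Let comp1f := mcomp1f HK.
Let compf1 := mcompf1 HK.
Let compA := mcompA HK.

Local Notation "x ^*" := (bf_dual x).
Local Notation S := (self_enrichment B).
Local Notation E := (self_ecat B).

Lemma unname_iso (x y : B) (f : @uHom B S x y) :
  @is_iso (underlying S) x y f -> is_iso (unname f).
Proof.
by case=> g [/= p q]; exists (@unname _ B y x g); split;
  rewrite /= -unname_comp ?p ?q unname_id.
Qed.

Lemma unname_half_braiding (x : B) (b : forall z : S, uHom (em_ten (x : S) z) (em_ten z x)) :
  @is_half_braiding (underlying_mon S) x b ->
  @is_half_braiding B x (fun z => @unname R B (x ⊗ z) (z ⊗ x) (b z)).
Proof.
case=> b_iso b_nat b_hex; split.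
- by move=> z; exact: unname_iso (b_iso z).
- move=> z w f.
  have := congr1 (@unname R B (x ⊗ z) (w ⊗ x)) (b_nat z w (self_name f)).
  have n1 : @unname R B x x (@mid (underlying_mon S) x) = mid x := unname_id x.
  rewrite (unname_comp (y := x ⊗ w)) (unname_comp (y := z ⊗ x)).
  by rewrite (unname_ten (x := x)) (unname_ten (x := z)) self_nameK n1.
- move=> z w.
  have := congr1 (@unname R B ((x ⊗ z) ⊗ w) (z ⊗ (w ⊗ x))) (b_hex z w).
  have n1 y : @unname R B y y (@mid (underlying_mon S) y) = mid y := unname_id y.
  have na p q r : @unname R B ((p ⊗ q) ⊗ r) (p ⊗ (q ⊗ r))
    (fwd (@asc (underlying_mon S) p q r)) = fwd (asc p q r) by exact: self_nameK.
  rewrite (unname_comp (y := x ⊗ (z ⊗ w))) (unname_comp (y := (z ⊗ w) ⊗ x)).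
  rewrite (unname_comp (y := (z ⊗ x) ⊗ w)) (unname_comp (y := z ⊗ (x ⊗ w))).
  by rewrite !na (unname_ten (x := z)) (unname_ten (x := x ⊗ z)) !n1.
Qed.

Lemma self_isopair_inverse (x y : B) (f : isopair x y) :
  mutually_inverse f -> @mutually_inverse (underlying S) x y (self_isopair f).
Proof.
by case=> p q; split; apply: unname_inj; rewrite unname_comp !self_nameK ?p ?q;
  exact: esym (unname_id _).
Qed.

Lemma self_name_comp (x y z : B) (g : Mor y z) (f : Mor x y) :
  self_name (g ∘ f) = @mcomp (underlying S) x y z (self_name g) (self_name f).
Proof. by apply: unname_inj; rewrite unname_comp !self_nameK. Qed.

Lemma self_name_ten (x x' y y' : B) (f : Mor x x') (g : Mor y y') :
  self_name (f ⊠ g) = @tenm (underlying_mon S) x x' y y' (self_name f) (self_name g).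
Proof. by apply: unname_inj; rewrite unname_ten !self_nameK. Qed.

Lemma self_name_id (x : B) : self_name (mid x) = @mid (underlying S) x.
Proof. by apply: unname_inj; rewrite unname_id self_nameK. Qed.

Lemma evm_fixr_tail (T y z w v : B) (m : Mor T (w ⊗ z^*)) (f : Mor v (z ⊗ y)) :
  evm (z ⊗ y) (w ⊗ y) ∘ ((fm (efun_fixr (eten S) y) z w ∘ m) ⊠ f) =
  (evm z w ⊠ mid y) ∘ bwd (asc (w ⊗ z^*) z y) ∘ (m ⊠ f).
Proof. by rewrite -evm_fixr -[RHS]compA -(ten_comp HB) comp1f. Qed.

Lemma evm_fixl_tail (T x z w v : B) (m : Mor T (w ⊗ z^*)) (f : Mor v (x ⊗ z)) :
  evm (x ⊗ z) (x ⊗ w) ∘ ((fm (efun_fixl (eten S) x) z w ∘ m) ⊠ f) =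
  (mid x ⊠ evm z w) ∘ asc x (w ⊗ z^*) z
    ∘ (bwd (brd x (w ⊗ z^*)) ⊠ mid z) ∘ bwd (asc (w ⊗ z^*) x z) ∘ (m ⊠ f).
Proof. by rewrite -evm_fixl -[RHS]compA -(ten_comp HB) comp1f. Qed.

(** Enriched naturality is [brd_slide] after transposition: the inverse crossing created by
    tensoring with [x] on the left is undone by the half-braiding. *)
Lemma name_brd_half_braiding (x : B) :
  @is_ehalf_braiding B S x (fun z => @self_name R B (x ⊗ z) (z ⊗ x) (brd x z)).
Proof.
have [_ _ h_hex] := brd_half_braiding HB x.
split; last split.
- split; last first.
    move=> z; apply: (@mutually_inverse_iso (underlying S) (x ⊗ z) (z ⊗ x)
      (@self_isopair R B (x ⊗ z) (z ⊗ x) (brd x z))).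
    exact: (self_isopair_inverse (brdK HB x z)).
  apply: (enat_of_hom HB) => z w.
  apply: (@evm_inj R B (x ⊗ z) (w ⊗ x)).
  rewrite evm_postcomp_tail evm_precomp_tail -[LHS]compA evm_fixl (brd_slide HB).
  by rewrite -[X in _ = _ ∘ (X ⊠ _)]compf1 evm_fixr_tail.
- move=> z; apply: (@mutually_inverse_iso (underlying S) (x ⊗ z) (z ⊗ x)
      (@self_isopair R B (x ⊗ z) (z ⊗ x) (brd x z))).
  exact: (self_isopair_inverse (brdK HB x z)).
- move=> z w f; apply: (@unname_inj R B (x ⊗ z) (w ⊗ x)).
  rewrite (unname_comp (y := x ⊗ w)) (unname_comp (y := z ⊗ x)) !self_nameK.
  rewrite (unname_ten (x := x)) (unname_ten (x := z)).
  have n1 : @unname R B x x (@mid (underlying_mon S) x) = mid x := unname_id x.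
  by rewrite n1 (brd_nat HB).
- move=> z w.
  have na p q r : @self_name R B ((p ⊗ q) ⊗ r) (p ⊗ (q ⊗ r)) (fwd (asc p q r)) =
    fwd (@asc (underlying_mon S) p q r) by [].
  have := congr1 (@self_name R B ((x ⊗ z) ⊗ w) (z ⊗ (w ⊗ x))) (h_hex z w).
  rewrite (self_name_comp (y := x ⊗ (z ⊗ w))) (self_name_comp (y := (z ⊗ w) ⊗ x)).
  rewrite (self_name_comp (y := (z ⊗ x) ⊗ w)) (self_name_comp (y := z ⊗ (x ⊗ w))).
  by rewrite !na (self_name_ten (x := z)) (self_name_ten (x := x ⊗ z)) !self_name_id.
Qed.

(* Enriched naturality out of the unit object suffices, because [evm 𝟙 w] is a
   split epimorphism. *)
Lemma half_braiding_name (x : B) (b : forall z : S, uHom (em_ten (x : S) z) (em_ten z x)) :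
  @is_ehalf_braiding B S x b ->
  forall z : B, b z = @self_name R B (x ⊗ z) (z ⊗ x) (brd x z).
Proof.
move=> [[[_ b_nat] _] /unname_half_braiding Hh] w.
pose c z := @unname R B (x ⊗ z) (z ⊗ x) (b z).
have bE z : b z = @self_name R B (x ⊗ z) (z ⊗ x) (c z) by rewrite unnameK.
(* The value at 𝟙 is forced by the half-braiding axioms; naturality from 𝟙 to [w] then propagates it
   to [w]. *)
have c1 : c 𝟙 = brd x 𝟙.
  by rewrite (brd1r HB); exact: (half_braiding_unit HB Hh).
rewrite bE; apply: congr1.
have := b_nat 𝟙 w; rewrite !bE => e.
have := congr1 (fun u => evm (x ⊗ 𝟙) (w ⊗ x) ∘ (u ⊠ mid (x ⊗ 𝟙))) e.
change (evm (x ⊗ 𝟙) (w ⊗ x) ∘ ((@postcomp _ E (x ⊗ 𝟙) _ _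
   (@self_name R B (x ⊗ w) (w ⊗ x) (c w)) ∘ fm (efun_fixl (eten S) x) 𝟙 w) ⊠ mid (x ⊗ 𝟙)) =
   evm (x ⊗ 𝟙) (w ⊗ x) ∘ ((@precomp _ E (w ⊗ x) _ _
   (@self_name R B (x ⊗ 𝟙) (𝟙 ⊗ x) (c 𝟙)) ∘ fm (efun_fixr (eten S) x) 𝟙 w) ⊠ mid (x ⊗ 𝟙)) ->
   c w = brd x w).
rewrite evm_postcomp_tail evm_precomp_tail -[X in X = _ -> _]compA evm_fixl.
rewrite -[X in _ = _ ∘ (X ⊠ _) -> _]compf1 evm_fixr_tail c1 -(brd_slide HB).
pose L := asc x (w ⊗ 𝟙^*) 𝟙 ∘ (bwd (brd x (w ⊗ 𝟙^*)) ⊠ mid 𝟙)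
  ∘ bwd (asc (w ⊗ 𝟙^*) x 𝟙).
have HL : is_iso L.
  apply: (iso_comp HK); last exact: mutually_inverse_isoV (ascK HB _ _ _).
  apply: (iso_comp HK); first exact: mutually_inverse_iso (ascK HB _ _ _).
  by apply: (ten_iso HB); [exact: mutually_inverse_isoV (brdK HB _ _) | exact: (iso_mid HK)].
have -> : (mid x ⊠ evm 𝟙 w) ∘ asc x (w ⊗ 𝟙^*) 𝟙 ∘ (bwd (brd x (w ⊗ 𝟙^*)) ⊠ mid 𝟙)
    ∘ bwd (asc (w ⊗ 𝟙^*) x 𝟙) = (mid x ⊠ evm 𝟙 w) ∘ L by rewrite /L !compA.
rewrite [X in X = _ -> _]compA [X in _ = X -> _]compA => e0.
have e1 := iso_epi HK HL e0.
(* The inserted morphism is the transpose of [run w], so after it [evm 𝟙 w] becomes the isomorphism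
   [run w], which can be cancelled. *)
have := congr1 (fun u => u ∘ (mid x ⊠ ((((run w ⊠ mid (bf_dual (tunit B)))
  ∘ bwd (asc w 𝟙 (bf_dual (tunit B)))
  ∘ (mid w ⊠ bf_coev 𝟙) ∘ bwd (run w)) ⊠ mid 𝟙)))) e1.
rewrite -!(compA _ (_ ⊠ evm _ _)) -(tenlD HB) evm_name; apply: (iso_epi HK).
by apply: (ten_iso HB); [exact: (iso_mid HK) | exact: mutually_inverse_iso (runK HB _)].
Qed.

Lemma center_hb (X : center_ob S) (z : B) :
  co_hb X z = @self_name R B (co_ob X ⊗ z) (z ⊗ co_ob X) (brd (co_ob X : B) z).
Proof. exact: half_braiding_name (co_hbP X) z. Qed.

Definition center_of (x : B) : center_ob S :=
  @CenterOb B S x _ (name_brd_half_braiding x).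

Lemma evm_shift (x y z T : B) (g : Mor T (z ⊗ (y ⊗ x^*))) :
  evm x (z ⊗ y) ∘ ((bwd (asc z y x^*) ∘ g) ⊠ mid x) =
  (mid z ⊠ evm x y) ∘ asc z (y ⊗ x^*) x ∘ (g ⊠ mid x).
Proof. by rewrite /evm !unlock; strict HB. Qed.

(** Up to associativity the target is the hom object from [x] to [z ⊗ y], so this is again
    uniqueness of transposes. *)
Lemma ten_evm_inj (x y z T : B) (f g : Mor T (z ⊗ (y ⊗ x^*))) :
  (mid z ⊠ evm x y) ∘ asc z (y ⊗ x^*) x ∘ (f ⊠ mid x) =
  (mid z ⊠ evm x y) ∘ asc z (y ⊗ x^*) x ∘ (g ⊠ mid x) -> f = g.
Proof.
rewrite -!evm_shift => /evm_inj.
exact: (iso_mono HK (mutually_inverse_isoV (ascK HB _ _ _))).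
Qed.

(** Transparency relative to a morphism: for [m] an identity and all [z] it says that [H] is
    transparent. *)
Definition centralizes (T H : B) (m : Mor T H) (z : B) : Prop :=
  brd H z ∘ (m ⊠ mid z) = bwd (brd z H) ∘ (m ⊠ mid z).

(** Both transposes consist of the same isomorphism [V], a crossing of the hom object with [z], and
    the same evaluation [W]. The crossing is inverse on one side, by [evm_fixl], and direct on the
    other, by [brd_slide_left]. *)
Lemma center_eql_eqr (X Y : center_ob S) (z T : B)
    (m : Mor T (co_ob Y ⊗ (co_ob X)^* : B)) :
  center_eql X Y z ∘ m = center_eqr X Y z ∘ m <-> centralizes m z.
Proof.
case: X Y m => [x bx Hx] [y by_ Hy]; rewrite /center_eql /center_eqr.
have /= -> := half_braiding_name Hx z; have /= -> := half_braiding_name Hy z.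
change (forall m : Mor T (y ⊗ x^*),
  @precomp _ E (z ⊗ y) _ _ (@self_name R B (x ⊗ z) (z ⊗ x) (brd x z))
    ∘ fm (efun_fixl (eten S) z) x y ∘ m =
  @postcomp _ E (x ⊗ z) _ _ (@self_name R B (y ⊗ z) (z ⊗ y) (brd y z))
    ∘ fm (efun_fixr (eten S) z) x y ∘ m <-> centralizes m z) => m.
pose W := (mid z ⊠ evm x y) ∘ asc z (y ⊗ x^*) x.
pose V := bwd (asc T z x) ∘ (mid T ⊠ brd x z).
have HV : is_iso V.
  apply: (iso_comp HK); first exact: mutually_inverse_isoV (ascK HB _ _ _).
  by apply: (ten_iso HB); [exact: (iso_mid HK) | exact: mutually_inverse_iso (brdK HB _ _)].
have eL : evm (x ⊗ z) (z ⊗ y) ∘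
    ((@precomp _ E (z ⊗ y) _ _ (@self_name R B (x ⊗ z) (z ⊗ x) (brd x z))
    ∘ fm (efun_fixl (eten S) z) x y ∘ m) ⊠ mid (x ⊗ z)) =
    W ∘ ((bwd (brd z (y ⊗ x^*)) ∘ (m ⊠ mid z)) ⊠ mid x) ∘ V.
  rewrite -[X in X ⊠ _]compA evm_precomp_tail evm_fixl_tail /W /V !compA.
  rewrite -!compA; do 2! congr (_ ∘ _).
  by strict HB.
have eR : evm (x ⊗ z) (z ⊗ y) ∘
    ((@postcomp _ E (x ⊗ z) _ _ (@self_name R B (y ⊗ z) (z ⊗ y) (brd y z))
    ∘ fm (efun_fixr (eten S) z) x y ∘ m) ⊠ mid (x ⊗ z)) =
    W ∘ ((brd (y ⊗ x^*) z ∘ (m ⊠ mid z)) ⊠ mid x) ∘ V.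
  rewrite -[X in X ⊠ _]compA evm_postcomp_tail -[LHS]compA evm_fixr_tail.
  rewrite !compA (brd_slide_left HB) /W /V -!compA; do 2! congr (_ ∘ _).
  strict HB.
  have /= F := @sat_nat _ HB (OA T) (OT (OA y) (OA x^*)) m.
  by rewrite F.
split=> [e | e].
  apply: (@ten_evm_inj x y z (T ⊗ z)).
  refine (iso_epi HK HV _).
  by rewrite -/W -eL -eR e.
by apply: evm_inj; rewrite eL eR e.
Qed.

End SelfCenter.

Import GRing.Theory.
Local Open Scope ring_scope.

(** * Linear algebra of hom spaces *)

Section Eigenvector.
Import VectorInternalTheory.

Lemma linear_eigenvector (K : numClosedFieldType) (V : vectType K) (f : V -> V) (v0 : V) :
  linear f -> v0 != 0 -> exists a v, v != 0 /\ f v = a *: v.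
Proof.
move=> f_lin v0N0.
pose F : {linear V -> V} := HB.pack f (GRing.isLinear.Build K V V *:%R f f_lin).
pose M := lin1_mx (v2r \o F \o r2v).
have dim_gt0 : (0 < dim V)%N.
  rewrite lt0n; apply: contraNneq v0N0 => d0.
  apply/eqP; apply: (can_inj v2rK); move: (v2r v0) (v2r 0); rewrite d0 => u w.
  by apply/rowP => -[].
have [a /eigenvalueP [u uM uN0]] := eigenvalue_closed M dim_gt0.
exists a, (r2v u); split.
  by apply: contraNneq uN0 => u0; rewrite -(r2vK u) u0 linear0.
by rewrite -[LHS](v2rK) -[v2r _]/((v2r \o F \o r2v) u) -mul_rV_lin1 uM linearZ.
Qed.

End Eigenvector.

Section Bilinear.
Variables (K : fieldType) (U V W : vectType K) (m : U -> V -> W).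
Hypothesis m_bil : is_bilinear m.

Lemma bilinDl u u' v : m (u + u') v = m u v + m u' v.
Proof. by have := m_bil.1 1 u u' v; rewrite !scale1r. Qed.

Lemma bilinDr u v v' : m u (v + v') = m u v + m u v'.
Proof. by have := m_bil.2 1 u v v'; rewrite !scale1r. Qed.

Lemma bilin0l v : m 0 v = 0.
Proof. by apply: (addIr (m 0 v)); rewrite -bilinDl !add0r. Qed.

Lemma bilin0r u : m u 0 = 0.
Proof. by apply: (addIr (m u 0)); rewrite -bilinDr !add0r. Qed.

Lemma bilinZl a u v : m (a *: u) v = a *: m u v.
Proof. by have := m_bil.1 a u 0 v; rewrite bilin0l !addr0. Qed.

Lemma bilinZr a u v : m u (a *: v) = a *: m u v.
Proof. by have := m_bil.2 a u v 0; rewrite bilin0r !addr0. Qed.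

Lemma bilinBl u u' v : m (u - u') v = m u v - m u' v.
Proof. by rewrite bilinDl -scaleN1r bilinZl scaleN1r. Qed.

Lemma bilinBr u v v' : m u (v - v') = m u v - m u v'.
Proof. by rewrite bilinDr -scaleN1r bilinZr scaleN1r. Qed.

Lemma bilin_suml (I : Type) (r : seq I) (F : I -> U) v :
  m (\sum_(i <- r) F i) v = \sum_(i <- r) m (F i) v.
Proof. by elim/big_rec2: _ => [|i y1 y2 _ <-]; rewrite ?bilin0l ?bilinDl. Qed.

Lemma bilin_sumr (I : Type) (r : seq I) (F : I -> V) u :
  m u (\sum_(i <- r) F i) = \sum_(i <- r) m u (F i).
Proof. by elim/big_rec2: _ => [|i y1 y2 _ <-]; rewrite ?bilin0r ?bilinDr. Qed.

End Bilinear.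

(** * Schur's lemma and semisimplicity *)

Section Linear.
Variables (R : realType) (B : braided_fusion R).
Let HB : is_braided B := bf_braidedP B.
Let HM : is_monoidal B := proj1 HB.
Let HK : is_category B := proj1 HM.
Let comp1f := mcomp1f HK.
Let compf1 := mcompf1 HK.
Let compA := mcompA HK.
Local Notation L := (bf_lin B).
Local Notation hom x y := (@lhom _ L x y).

Let ab : is_abelian L := proj1 (bf_semisimpleP B).
Let comp_bil (x y z : B) : is_bilinear (@lcomp _ L x y z) := proj2 (proj1 ab) x y z.
Let ten_bil (x x' y y' : B) := @bf_bilinearP R B x x' y y'.

Lemma comp0l (x y z : B) (f : Mor x y) : @mcomp B x y z (0 : hom y z) f = 0 :> hom x z.
Proof. exact: bilin0l (comp_bil x y z) f. Qed.

Lemma comp0r (x y z : B) (g : Mor y z) : @mcomp B x y z g (0 : hom x y) = 0 :> hom x z.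
Proof. exact: bilin0r (comp_bil x y z) g. Qed.

Lemma compZl (x y z : B) a (g : Mor y z) (f : Mor x y) :
  @mcomp B x y z (a *: (g : hom y z)) f = a *: (g ∘ f : hom x z).
Proof. exact: bilinZl (comp_bil x y z) a g f. Qed.

Lemma compZr (x y z : B) a (g : Mor y z) (f : Mor x y) :
  @mcomp B x y z g (a *: (f : hom x y)) = a *: (g ∘ f : hom x z).
Proof. exact: bilinZr (comp_bil x y z) a g f. Qed.

Lemma compBl (x y z : B) (g g' : Mor y z) (f : Mor x y) :
  @mcomp B x y z ((g : hom y z) - g') f = (g ∘ f : hom x z) - (g' ∘ f).
Proof. exact: bilinBl (comp_bil x y z) g g' f. Qed.

Lemma compBr (x y z : B) (g : Mor y z) (f f' : Mor x y) :
  @mcomp B x y z g ((f : hom x y) - f') = (g ∘ f : hom x z) - (g ∘ f').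
Proof. exact: bilinBr (comp_bil x y z) g f f'. Qed.

Lemma comp_suml (x y z : B) (I : Type) (r : seq I) (F : I -> Mor y z) (f : Mor x y) :
  @mcomp B x y z (\sum_(i <- r) (F i : hom y z)) f = \sum_(i <- r) (F i ∘ f : hom x z).
Proof. exact (bilin_suml (comp_bil x y z) r F f). Qed.

Lemma comp_sumr (x y z : B) (I : Type) (r : seq I) (F : I -> Mor x y) (g : Mor y z) :
  @mcomp B x y z g (\sum_(i <- r) (F i : hom x y)) = \sum_(i <- r) (g ∘ F i : hom x z).
Proof. exact (bilin_sumr (comp_bil x y z) r F g). Qed.

Lemma ten_suml (x x' y y' : B) (I : Type) (r : seq I) (F : I -> Mor x x')
    (f : Mor y y') :
  @tenm B x x' y y' (\sum_(i <- r) (F i : hom x x')) f = \sum_(i <- r) (F i ⊠ f : hom (x ⊗ y) (x' ⊗ y')).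
Proof. exact (bilin_suml (ten_bil x x' y y') r F f). Qed.

Lemma ten_sumr (x x' y y' : B) (I : Type) (r : seq I) (F : I -> Mor y y')
    (f : Mor x x') :
  @tenm B x x' y y' f (\sum_(i <- r) (F i : hom y y')) = \sum_(i <- r) (f ⊠ F i : hom (x ⊗ y) (x' ⊗ y')).
Proof. exact (bilin_sumr (ten_bil x x' y y') r F f). Qed.

Lemma tenZl (x x' y y' : B) a (f : Mor x x') (g : Mor y y') :
  @tenm B x x' y y' (a *: (f : hom x x')) g = a *: (f ⊠ g : hom (x ⊗ y) (x' ⊗ y')).
Proof. exact (bilinZl (ten_bil x x' y y') a f g). Qed.

(** Kernels of the linear category, restated with the composition of [B] and with unique
    factorization traded for monicity. *)
Lemma kernel_exists (x y : B) (f : Mor x y) : exists (k : B) (m : Mor k x),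
  [/\ f ∘ m = 0 :> hom k y, is_mono m
    & forall (t : B) (h : Mor t x), f ∘ h = 0 :> hom t y ->
        exists u : Mor t k, m ∘ u = h].
Proof.
have [_ [_ [ker _]]] := ab.
have [k0 [m0]] := ker x y f; move: k0 m0.
change (forall (k : B) (m : Mor k x), @is_equalizer B x y f (0 : hom x y) k m ->
  exists (k : B) (m : Mor k x),
  [/\ f ∘ m = 0 :> hom k y, is_mono m
    & forall (t : B) (h : Mor t x), f ∘ h = 0 :> hom t y ->
        exists u : Mor t k, m ∘ u = h]) => k m [fm m_univ].
exists k, m; split; first by rewrite fm comp0l.
  move=> t g h e; have e' : f ∘ (m ∘ g) = @mcomp B t x y (0 : hom x y) (m ∘ g).
    by rewrite !compA fm.
  have [u [_ u_uniq]] := m_univ t (m ∘ g) e'.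
  by rewrite -(u_uniq g erefl) (u_uniq h (esym e)).
move=> t h fh; have [|u [mu _]] := m_univ t h; first by rewrite fh comp0l.
by exists u.
Qed.

Lemma simple_mono (s k : B) (m : Mor k s) : is_simple (C := L) s -> is_mono m ->
  mid k = 0 :> hom k k \/ is_iso m.
Proof. by move=> [_ H]; exact: H. Qed.

Lemma schur (s s' : B) (f : Mor s s') :
  is_simple (C := L) s -> is_simple (C := L) s' -> f = 0 :> hom s s' \/ is_iso f.
Proof.
move=> s_simple s'_simple; have [s_n0 _] := s_simple.
have [k [m [fm m_mono m_univ]]] := kernel_exists f.
have [k0|m_iso] := simple_mono s_simple m_mono; last first.
  by left; apply: (iso_epi HK m_iso); rewrite fm comp0l.
suff f_mono : is_mono f.
  by have [s0|] := simple_mono s'_simple f_mono; [case: s_n0 | right].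
move=> t g h e.
have gh : f ∘ ((g : hom t s) - h : Mor t s) = 0 :> hom t s'.
  by rewrite compBr e subrr.
have [u mu] := m_univ t _ gh.
apply/eqP; rewrite -subr_eq0; apply/eqP; rewrite -mu -(comp1f u) k0.
by rewrite comp0l comp0r.
Qed.

(** Composition with [f] has an eigenvector [g] in the endomorphism space. Then [f] minus the
    eigenvalue kills [g], so it is not invertible and vanishes by Schur's lemma. *)
Lemma simple_end (s : B) (f : Mor s s) : is_simple (C := L) s ->
  exists a, f = a *: (mid s : hom s s).
Proof.
move=> s_simple; have [s_n0 _] := s_simple.
have f_lin : linear (fun g : hom s s => (f ∘ g : hom s s)).
  by move=> a g h; exact: (comp_bil s s s).2.
have [a [g [g_n0 fg]]] := linear_eigenvector f_lin (introN eqP s_n0).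
exists a; apply/eqP; rewrite -subr_eq0; apply/eqP.
have [//|h_iso] := schur (s := s) (s' := s) ((f : hom s s) - a *: (mid s : hom s s))
  s_simple s_simple.
case/eqP: g_n0; apply: (iso_mono HK h_iso).
by rewrite compBl compZl comp1f fg comp0r subrr.
Qed.

(** A resolution of the identity lets morphisms out of [x] be tested for vanishing, or assembled, on
    simple summands. *)
Lemma semisimple_resolution (x : B) : exists (n : nat) (s : 'I_n -> B)
    (inj : forall i, Mor (s i) x) (proj : forall i, Mor x (s i)),
  (forall i, is_simple (C := L) (s i)) /\
  mid x = \sum_i (inj i ∘ proj i : hom x x).
Proof.
have [n [s [s_simple [a [b [/= ab1 ba1]]]]]] := proj2 (bf_semisimpleP B) x.
have [_ [/(_ n s) [_ _ sum1] _]] := ab.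
exists n, s, (fun i => (b : Mor (dsum s : B) x) ∘ (dinj s i : @Mor B (s i) (dsum s))).
exists (fun i => (dproj s i : @Mor B (dsum s) (s i)) ∘ (a : Mor x (dsum s : B))).
split=> //; rewrite -[LHS]ba1 -[X in X ∘ a]compf1 [mid _](esym sum1).
rewrite comp_sumr comp_suml; apply: eq_bigr => i _.
by rewrite !compA.
Qed.

(** If [h] is nonzero, so is one of its components into a simple summand of [x]; by Schur's lemma
    that component is invertible. *)
Lemma simple_retract (s x : B) (h : Mor s x) : is_simple (C := L) s ->
  h = 0 :> hom s x \/ exists r : Mor x s, r ∘ h = mid s.
Proof.
move=> s_simple; have [n [t [inj [proj [t_simple id_x]]]]] := semisimple_resolution x.
case: (boolP [exists i, (proj i ∘ h : hom s (t i)) != 0]) => [/existsP[i ih]|].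
  right; have [ph0|[g [/= _ gh]]] := schur (proj i ∘ h) s_simple (t_simple i).
    by case/eqP: ih.
  by exists (g ∘ proj i); rewrite -compA.
rewrite negb_exists => /forallP h0; left.
rewrite -(comp1f h) id_x comp_suml big1 // => i _.
by have := h0 i; rewrite negbK => /eqP e; rewrite -compA e comp0r.
Qed.

(** * Transparent objects *)

Lemma unit_transparent (z : B) : brd z 𝟙 ∘ brd 𝟙 z = mid (𝟙 ⊗ z).
Proof.
rewrite (brd1l HB) (brd1r HB) compA -(compA _ (fwd (run z))).
by rewrite (proj1 (runK HB z)) compf1 (proj2 (lunK HB z)).
Qed.

Lemma vobj_id (V : vectType R[i]) :
  mid (vobj B V) = \sum_k ((vinj B k : Mor (tunit B) (vobj B V)) ∘ vproj B k : hom (vobj B V) (vobj B V)).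
Proof.
have [_ [ds _]] := ab; have [_ _ /= sum1] := ds _ (@vcopies R B V).
exact: (esym sum1).
Qed.

Lemma vobj_transparent (V : vectType R[i]) : transparent (vobj B V).
Proof.
move=> z; rewrite -[LHS]compf1 -[in X in _ ∘ X](ten11 HB) vobj_id ten_suml comp_sumr.
rewrite -[RHS](ten11 HB) vobj_id ten_suml; apply: eq_bigr => k _.
rewrite (tenrD HB) -compA [X in _ ∘ X]compA (brd_nat HB) !compA (brd_nat HB).
by rewrite -(compA (_ ⊠ _)) unit_transparent compf1.
Qed.

Lemma centralizes_comp (S T H : B) (m : Mor T H) (g : Mor S T) z :
  centralizes m z -> centralizes (m ∘ g) z.
Proof. by rewrite /centralizes (tenrD HB) !compA => ->. Qed.

Lemma transparent_brdV (x z : B) : transparent x -> fwd (brd x z) = bwd (brd z x).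
Proof.
by move=> x_tr; exact: (inverse_unique HK (x_tr z) (proj2 (brdK HB z x))).
Qed.

Lemma transparent_centralizes (T H : B) (m : Mor T H) (z : B) :
  transparent T -> centralizes m z.
Proof.
move=> T_tr; rewrite /centralizes (brd_nat HB) (transparent_brdV _ T_tr).
by rewrite (brdV_nat HB).
Qed.

(** Naturality moves [m] to the left of both crossings, where its retraction makes it
    cancellable. *)
Lemma centralizes_transparent (T H : B) (m : Mor T H) (r : Mor H T) :
  r ∘ m = mid T -> (forall z, centralizes m z) -> transparent T.
Proof.
move=> rm mc z; suff -> : fwd (brd T z) = bwd (brd z T) by case: (brdK HB z T).
have mz_mono : is_mono (mid z ⊠ m).
  move=> t g h e; have := congr1 (fun u => (mid z ⊠ r) ∘ u) e.
  by rewrite !compA -(tenlD HB) rm (ten11 HB) !comp1f.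
by apply: mz_mono; rewrite -(brd_nat HB) -(brdV_nat HB); exact: mc.
Qed.

Lemma vproj_vinj (V : vectType R[i]) (i j : 'I_(\dim {:V})) :
  @mcomp B (tunit B) (vobj B V) (tunit B) (vproj B i) (vinj B j) =
  if j == i then (mid (tunit B) : hom (tunit B) (tunit B)) else 0.
Proof.
have [_ [ds _]] := ab; have [d1 d0 _] := ds _ (@vcopies R B V).
by case: eqVneq => [->|ji]; [exact: d1 | exact: d0].
Qed.

Lemma vproj_velem (V : vectType R[i]) (v : V) i :
  @mcomp B (tunit B) (vobj B V) (tunit B) (vproj B i) (velem B v) =
  coord (vbasis {:V}) i v *: (mid (tunit B) : hom (tunit B) (tunit B)).
Proof.
rewrite comp_sumr (bigD1 i) //= big1 => [|j ji].
  by rewrite addr0 compZr vproj_vinj eqxx.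
by rewrite compZr vproj_vinj (negPf ji) scaler0.
Qed.

Lemma velem_surj (V : vectType R[i]) (f : Mor (tunit B) (vobj B V)) :
  exists v : V, f = velem B v.
Proof.
have /fin_all_exists[c cE] i : exists a : R[i], vproj B i ∘ f =
    a *: (mid (tunit B) : hom (tunit B) (tunit B)).
  exact: simple_end (bf_unitP B).
exists (\sum_i c i *: vbas i); rewrite -[LHS]comp1f vobj_id comp_suml.
apply: eq_bigr => i _; rewrite coord_sum_free ?(basis_free (vbasisP _)) //.
by rewrite -compA cE compZr compf1.
Qed.

Lemma velem0 (V : vectType R[i]) : velem B (0 : V) = 0 :> hom (tunit B) (vobj B V).
Proof. by rewrite /velem big1 // => i _; rewrite linear0 scale0r. Qed.

(** * The embedding of [B(x,y) 1] into the internal hom *)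

Section HomObject.
Variables x y : B.
Local Notation V := (hom x y).
Local Notation H := (y ⊗ bf_dual x).

Lemma self_name_sum (I : Type) (r : seq I) (F : I -> Mor x y) :
  self_name (\sum_(i <- r) (F i : hom x y)) =
  \sum_(i <- r) (self_name (F i) : hom (tunit B) H).
Proof. by rewrite /self_name ten_suml comp_suml. Qed.

Lemma self_nameZ a (f : Mor x y) :
  self_name (a *: (f : hom x y)) = a *: (self_name f : hom (tunit B) H).
Proof. by rewrite /self_name tenZl compZl. Qed.

(** Up to the bijection [self_name], the counit at [H] of the adjunction between the embedding of
    vector spaces and the functor of points [B(1,-)]. *)
Definition hom_inc : Mor (vobj B V) H :=
  \sum_i (@mcomp B (vobj B V) (tunit B) H (@self_name R B x y (@vbas R V i))
    (vproj B i) : hom (vobj B V) H).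

Lemma hom_inc_velem (f : Mor x y) : @mcomp B (tunit B) (vobj B V) H hom_inc (velem B (f : V)) =
  self_name f.
Proof.
rewrite comp_suml [in RHS](coord_vbasis (memvf (f : V))).
rewrite self_name_sum; apply: eq_bigr => i _.
by rewrite -compA vproj_velem compZr compf1 self_nameZ.
Qed.

(** A difference [d] killed by [hom_inc] is tested on simple summands. Where it is nonzero, the
    summand is isomorphic to 𝟙, so [d] becomes the point of a vector [v]; its name vanishes, and
    naming is injective. *)
Lemma hom_inc_mono : is_mono hom_inc.
Proof.
move=> t g h e; apply/eqP; rewrite -subr_eq0; apply/eqP.
set d : Mor t (vobj B V) := _ - _.
have inc_d : hom_inc ∘ d = 0 :> hom t H by rewrite compBr e subrr.
have [n [s [inj [proj [s_simple id_t]]]]] := semisimple_resolution t.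
suff d0 i : d ∘ inj i = 0 :> hom (s i) (vobj B V).
  by rewrite -(compf1 d) id_t comp_sumr big1 // => i _; rewrite compA d0 comp0l.
case: (boolP [exists k, (vproj B k ∘ (d ∘ inj i) : hom (s i) (tunit B)) != 0]).
  case/existsP => k /eqP pd.
  have [//|u_iso] := schur (vproj B k ∘ (d ∘ inj i)) (s_simple i) (bf_unitP B).
  case: u_iso => u [/= _ uK].
  have [v vE] := velem_surj (d ∘ inj i ∘ u).
  suff v0 : v = 0.
    by rewrite -[LHS]compf1 -uK compA vE v0 velem0 comp0l.
  apply: (@self_name_inj R B x y); rewrite -!hom_inc_velem -vE !compA inc_d.
  by rewrite !comp0l velem0 comp0r.
rewrite negb_exists => /forallP pd.
rewrite -(comp1f (d ∘ inj i)) vobj_id comp_suml big1 // => k _.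
by have := pd k; rewrite negbK => /eqP e0; rewrite -compA e0 comp0r.
Qed.

Lemma hom_inc_factor (hB : nondegenerate_braided B) (T : B) (h : Mor T H) :
  (forall z, centralizes h z) -> factors_through h hom_inc.
Proof.
move=> hc; have [_ _ nd] := hB.
have [n [s [inj [proj [s_simple id_T]]]]] := semisimple_resolution T.
have fac i : exists k : Mor (s i) (vobj B V), hom_inc ∘ k = h ∘ inj i.
  have [h0|[r rK]] := simple_retract (h ∘ inj i) (s_simple i).
    by exists (0 : hom (s i) (vobj B V)); rewrite comp0r h0.
  have s_tr : transparent (s i).
    by apply: (centralizes_transparent rK) => z; exact: centralizes_comp.
  have [u [u' [/= _ uK]]] := nd (s i) (s_simple i) s_tr.
  (* Since the summand is isomorphic to 𝟙, [h] restricted to it is a point of [H], that is, the name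
     of a morphism from [x] to [y]. *)
  exists (velem B (unname (h ∘ inj i ∘ u') : V) ∘ u).
  by rewrite compA hom_inc_velem unnameK -(compA _ u') uK compf1.
have [k kE] := fin_all_exists fac.
exists (\sum_i (k i ∘ proj i : hom T (vobj B V))).
rewrite comp_sumr -[RHS]compf1 id_T comp_sumr; apply: eq_bigr => i _.
by rewrite !compA kE.
Qed.

Lemma hom_inc_centralizes z : centralizes hom_inc z.
Proof. exact: transparent_centralizes (vobj_transparent V). Qed.

End HomObject.

End Linear.

(** * The vector enrichment *)

Section VectEnrichment.
Variables (R : realType) (B : braided_fusion R).
Let HB : is_braided B := bf_braidedP B.
Let HM : is_monoidal B := proj1 HB.
Let HK : is_category B := proj1 HM.
Let comp1f := mcomp1f HK.
Let compf1 := mcompf1 HK.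
Let compA := mcompA HK.
Local Notation L := (bf_lin B).
Local Notation hom x y := (@lhom _ L x y).
Local Notation S := (self_enrichment B).
Local Notation E := (self_ecat B).
Local Notation V := (vect_emon B).

(** Both sides expand over pairs of basis vectors, so compatibility of [hom_inc] with composition
    and with the tensor product reduces to that of naming. *)
Lemma hom_inc_vbilin (a b c d p q : B) (m : hom a b -> hom c d -> hom p q)
    (e : Mor ((b ⊗ bf_dual a) ⊗ (d ⊗ bf_dual c)) (q ⊗ bf_dual p)) :
  (forall (f : Mor a b) (g : Mor c d), self_name (m f g : Mor p q) =
     e ∘ (self_name f ⊠ self_name g) ∘ bwd (lun 𝟙)) ->
  hom_inc p q ∘ vbilin B m = e ∘ (hom_inc a b ⊠ hom_inc c d).
Proof.
move=> He; rewrite ten_suml !comp_sumr; apply: eq_bigr => i _.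
rewrite ten_sumr !comp_sumr; apply: eq_bigr => j _.
rewrite !compA hom_inc_velem He.
rewrite -2![LHS]compA [X in _ ∘ X]compA (proj2 (lunK HB _)) comp1f.
by rewrite -[LHS]compA -(ten_comp HB).
Qed.

Local Notation J := (@hom_inc R B).

Lemma hom_inc_id (x : B) : J x x ∘ @eid _ V x = @eid _ S x.
Proof. by rewrite hom_inc_velem; exact: self_name_id. Qed.

Lemma hom_inc_comp (x y z : B) : J x z ∘ @ecomp _ V x y z = @ecomp _ S x y z ∘ (J y z ⊠ J x y).
Proof. by apply: hom_inc_vbilin => f g; exact: self_name_comp. Qed.

Lemma hom_inc_ten (x x' y y' : B) : J (x ⊗ y) (x' ⊗ y') ∘ @em_tenm _ V x x' y y' =
  @em_tenm _ S x x' y y' ∘ (J x x' ⊠ J y y').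
Proof. by apply: hom_inc_vbilin => f g; exact: self_name_ten. Qed.

Lemma hom_inc_isopair (x y : B) (f : isopair x y) :
  J x y ∘ fwd (vect_isopair f) = fwd (self_isopair f) /\
  J y x ∘ bwd (vect_isopair f) = bwd (self_isopair f).
Proof. by split; exact: hom_inc_velem. Qed.

Lemma hom_inc_postcomp (w x y : B) (f : Mor x y) :
  J w y ∘ @postcomp _ V w x y (velem B (f : hom x y)) =
  @postcomp _ E w x y (self_name f) ∘ J w x.
Proof. by rewrite (sub_postcomp HB (C := S) hom_inc_comp) [J _ _ ∘ velem B _]hom_inc_velem. Qed.

Lemma hom_inc_precomp (w x y : B) (f : Mor x y) :
  J x w ∘ @precomp _ V w x y (velem B (f : hom x y)) =
  @precomp _ E w x y (self_name f) ∘ J y w.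
Proof. by rewrite (sub_precomp HB (C := S) hom_inc_comp) [J _ _ ∘ velem B _]hom_inc_velem. Qed.

Lemma vect_emonoidal : is_emonoidal V.
Proof.
exact: (@sub_emonoidal B HB S _ _ _ _ _ _ _ J (@hom_inc_mono R B) hom_inc_id
  hom_inc_comp hom_inc_ten
  (fun x y z => hom_inc_isopair (asc x y z)) (fun x => hom_inc_isopair (lun x))
  (fun x => hom_inc_isopair (run x)) (self_emonoidal B)).
Qed.

Let N (x y : B) (f : @uHom B V x y) : Mor x y := @unname R B x y (J x y ∘ f).

Let N_inj (x y : B) : injective (@N x y).
Proof. by move=> f g /unname_inj; apply: hom_inc_mono. Qed.

Let N_velem (x y : B) (f : Mor x y) : N (velem B (f : hom x y)) = f.
Proof. by rewrite /N hom_inc_velem self_nameK. Qed.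

Let N_comp (x y z : B) (g : @uHom B V y z) (f : @uHom B V x y) :
  @N x z (@mcomp (underlying V) x y z g f) = N g ∘ N f.
Proof.
rewrite -unname_comp; apply: (congr1 (@unname R B x z)).
change (J x z ∘ (@ecomp _ V x y z ∘ (g ⊠ f) ∘ bwd (lun 𝟙)) =
  @ecomp _ S x y z ∘ ((J y z ∘ g) ⊠ (J x y ∘ f)) ∘ bwd (lun 𝟙)).
by rewrite [LHS]compA [X in X ∘ _ = _]compA hom_inc_comp -[X in X ∘ _ = _]compA -(ten_comp HB).
Qed.

Let N_ten (x x' y y' : B) (f : @uHom B V x x') (g : @uHom B V y y') :
  @N (x ⊗ y) (x' ⊗ y') (@tenm (underlying_mon V) x x' y y' f g) = N f ⊠ N g.
Proof.
rewrite -unname_ten; apply: (congr1 (@unname R B (x ⊗ y) (x' ⊗ y'))).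
change (J (x ⊗ y) (x' ⊗ y') ∘ (@em_tenm _ V x x' y y' ∘ (f ⊠ g) ∘ bwd (lun 𝟙)) =
  @em_tenm _ S x x' y y' ∘ ((J x x' ∘ f) ⊠ (J y y' ∘ g)) ∘ bwd (lun 𝟙)).
by rewrite [LHS]compA [X in X ∘ _ = _]compA hom_inc_ten -[X in X ∘ _ = _]compA -(ten_comp HB).
Qed.

Lemma vect_isopair_inverse (x y : B) (f : isopair x y) : mutually_inverse f ->
  @mutually_inverse (underlying V) x y (vect_isopair f).
Proof.
by case=> p q; split; apply: N_inj; rewrite N_comp !N_velem ?p ?q.
Qed.

Lemma vect_underlying_braided : is_braided (underlying_br (vect_enrichment B)).
Proof.
apply: (@reflect_braided B _ _ _ _ _ _ _ N N_inj _ N_comp N_ten _ _ _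
  (brd (b := B)) _ _ _ HB).
- by move=> x; exact: N_velem.
- by move=> x y z; split; exact: N_velem.
- by move=> x; split; exact: N_velem.
- by move=> x; split; exact: N_velem.
- by move=> x y; exact: N_velem.
- by move=> x y; exact: vect_isopair_inverse (brdK HB x y).
Qed.

(** Commutativity is transparency of the hom objects. Naturality of the braiding is checked on
    transposes in the self-enrichment, where [brd_interchange] needs a crossing independent of its
    sign, again by transparency. *)
Lemma vect_ebraided : is_ebraided (vect_enrichment B).
Proof.
split; first exact: vect_emonoidal.
split.
  by move=> [x1 x2] [y1 y2]; rewrite (vobj_transparent _ (vobj B _)) compf1.
split; last exact: vect_underlying_braided.
split; last first.
  move=> [x y]; apply: (@mutually_inverse_iso (underlying V)).
  exact: vect_isopair_inverse (brdK HB x y).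
apply: (enat_of_hom HB) => -[x1 x2] [y1 y2].
move: x1 x2 y1 y2.
change (forall x1 x2 y1 y2 : B,
  @postcomp _ V (x1 ⊗ x2) _ _ (velem B (fwd (brd y1 y2) : hom (y1 ⊗ y2) (y2 ⊗ y1)))
    ∘ @em_tenm _ V x1 y1 x2 y2 =
  @precomp _ V (y2 ⊗ y1) _ _ (velem B (fwd (brd x1 x2) : hom (x1 ⊗ x2) (x2 ⊗ x1)))
    ∘ (@em_tenm _ V x2 y2 x1 y1 ∘ brd (vobj B (hom x1 y1)) (vobj B (hom x2 y2)))).
move=> x1 x2 y1 y2; apply: hom_inc_mono.
rewrite [LHS]compA [RHS]compA hom_inc_postcomp hom_inc_precomp.
rewrite -[LHS]compA -[RHS]compA hom_inc_ten [X in _ = _ ∘ X]compA hom_inc_ten.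
rewrite -[X in _ = _ ∘ X]compA.
apply: (@evm_inj R B (x1 ⊗ x2) (y2 ⊗ y1)).
rewrite evm_postcomp_tail evm_precomp_tail -[LHS]compA evm_ten_tail.
rewrite (ten_compl HB) [RHS]compA evm_ten (ten_compl HB) [RHS]compA.
rewrite -(ten11 HB x1 x2) -(ten11 HB x2 x1).
rewrite -[X in _ ∘ X = _]compA -[X in _ = X ∘ _]compA !(interchange_nat HB).
rewrite [X in _ ∘ X = _]compA [X in _ = X ∘ _]compA -!(ten_comp HB).
apply: (brd_interchange HB); apply: transparent_brdV; exact: vobj_transparent.
Qed.

End VectEnrichment.

(** * The center *)

Section Center.
Variables (R : realType) (B : braided_fusion R).
Hypothesis hB : nondegenerate_braided B.
Let HB : is_braided B := bf_braidedP B.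
Let HM : is_monoidal B := proj1 HB.
Let HK : is_category B := proj1 HM.
Let comp1f := mcomp1f HK.
Let compf1 := mcompf1 HK.
Let compA := mcompA HK.
Local Notation L := (bf_lin B).
Local Notation hom x y := (@lhom _ L x y).
Local Notation S := (self_enrichment B).
Local Notation E := (self_ecat B).
Local Notation V := (vect_emon B).

(** By [center_eql_eqr] the intersection of equalizers becomes a universal property among morphisms
    centralizing every object. In the converse direction the equalizers are kernels of differences,
    chosen for all [z] at once. *)
Lemma center_homP (X Y : center_ob S) (h : B)
    (m : Mor h (co_ob Y ⊗ bf_dual (co_ob X : B))) :
  @is_center_hom B S X Y h m <->
  [/\ is_mono m, forall z, centralizes m z
    & forall (T : B) (f : Mor T _), (forall z, centralizes f z) ->
        factors_through f m].
Proof.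
split.
  move=> [e [n [n_eq [m_mono m_fac m_univ]]]]; split=> // [z|T f fc].
    apply/center_eql_eqr; have [k <-] := m_fac z.
    by rewrite !compA (proj1 (n_eq z)).
  apply: m_univ => z; have [nz n_univ] := n_eq z.
  have [|k [nk _]] := n_univ T f; first exact/center_eql_eqr.
  by exists k.
move=> [m_mono mc m_univ].
have /choice[e He] z : exists e : B, exists n : Mor e (co_ob Y ⊗ bf_dual (co_ob X : B)),
    is_equalizer (@center_eql B S X Y z) (@center_eqr B S X Y z) n.
  have [k [n [fn n_mono n_univ]]] := kernel_exists
    ((center_eql X Y z : hom _ _) - (center_eqr X Y z)).
  have sub0 T (f : Mor T (co_ob Y ⊗ bf_dual (co_ob X : B))) :
      center_eql X Y z ∘ f = center_eqr X Y z ∘ f <->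
      @mcomp B _ _ _ ((center_eql X Y z : hom _ _) - (center_eqr X Y z)) f =
        0 :> hom _ _.
    rewrite compBl; split=> [->|/eqP]; first by rewrite subrr.
    by rewrite subr_eq0 => /eqP.
  exists k, n; split; first exact/sub0.
  move=> T f /sub0 /n_univ[u nu]; exists u; split=> // u' nu'.
  by apply: n_mono; rewrite nu nu'.
have [n Hn] : {n : forall z, Mor (e z) (co_ob Y ⊗ bf_dual (co_ob X : B)) &
    forall z, is_equalizer (@center_eql B S X Y z) (@center_eqr B S X Y z) (n z)}.
  exists (fun z => projT1 (cid (He z))) => z.
  exact: projT2 (cid (He z)).
exists e, n; split=> //; split=> //.
  move=> z; have [_ n_univ] := Hn z.
  have [|k [nk _]] := n_univ h m; first exact/center_eql_eqr.
  by exists k.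
move=> T f f_fac; apply: m_univ => z; apply/center_eql_eqr.
have [k <-] := f_fac z; by rewrite !compA (proj1 (Hn z)).
Qed.

Lemma hom_inc_center_hom (X Y : center_ob S) :
  @is_center_hom B S X Y _ (hom_inc (co_ob X : B) (co_ob Y)).
Proof.
apply/center_homP; split; first exact: hom_inc_mono.
  exact: hom_inc_centralizes.
move=> T f; exact: hom_inc_factor.
Qed.

Lemma center_hom_unique (X Y : center_ob S) (h : B)
    (m : Mor h (co_ob Y ⊗ bf_dual (co_ob X : B))) : @is_center_hom B S X Y h m ->
  exists phi : Mor h (vobj B (hom (co_ob X : B) (co_ob Y))),
    is_iso phi /\ hom_inc _ _ ∘ phi = m.
Proof.
move=> /center_homP[m_mono mc m_univ].
have [phi phiE] := hom_inc_factor hB mc.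
have [psi psiE] := m_univ _ _ (hom_inc_centralizes (co_ob X : B) (co_ob Y)).
exists phi; split=> //; exists psi; split => /=.
  by apply: hom_inc_mono; rewrite compA phiE psiE compf1.
by apply: m_mono; rewrite compA psiE phiE compf1.
Qed.

Lemma hb_unitE : @hb_unit (underlying_mon S) =
  fun z : B => @self_name R B (𝟙 ⊗ z) (z ⊗ 𝟙) (brd 𝟙 z).
Proof.
apply: functional_extensionality_dep => z.
by rewrite (brd1l HB) (self_name_comp (y := z)).
Qed.

(** This is the second hexagon, read through [self_name]. *)
Lemma hb_tenE (x y : B) :
  @hb_ten (underlying_mon S) x y
    (fun z : B => @self_name R B (x ⊗ z) (z ⊗ x) (brd x z))
    (fun z : B => @self_name R B (y ⊗ z) (z ⊗ y) (brd y z)) =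
  fun z : B => @self_name R B ((x ⊗ y) ⊗ z) (z ⊗ (x ⊗ y)) (brd (x ⊗ y) z).
Proof.
apply: functional_extensionality_dep => z.
rewrite (hexagon2' HB) (self_name_comp (y := (z ⊗ x) ⊗ y)).
rewrite (self_name_comp (y := (x ⊗ z) ⊗ y)) (self_name_comp (y := x ⊗ (z ⊗ y))).
rewrite (self_name_comp (y := x ⊗ (y ⊗ z))).
rewrite (self_name_ten (x := x ⊗ z)) (self_name_ten (x := x)) !self_name_id.
by rewrite /hb_ten -3![LHS](mcompA (proj1 (self_underlying_monoidal B))).
Qed.

Lemma center_obE (X : center_ob S) :
  co_hb X = fun z : B => @self_name R B (co_ob X ⊗ z) (z ⊗ co_ob X) (brd (co_ob X : B) z).
Proof. by apply: functional_extensionality_dep => z; exact: center_hb. Qed.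

Lemma center_unitP : @is_ehalf_braiding B S (em_unit S) (@hb_unit (underlying_mon S)).
Proof. by rewrite hb_unitE; exact: name_brd_half_braiding. Qed.

Lemma center_tenP (X Y : center_ob S) : @is_ehalf_braiding B S (em_ten (co_ob X) (co_ob Y))
  (@hb_ten (underlying_mon S) (co_ob X) (co_ob Y) (co_hb X) (co_hb Y)).
Proof. by rewrite !center_obE hb_tenE; exact: name_brd_half_braiding. Qed.

(* Pulled back to the objects of the center, so that the two enrichments to be
   compared share their objects. *)

Definition center_ecat : ecat_data B := {|
  eob := center_ob S;
  ehom := fun X Y => @ehom _ V (co_ob X) (co_ob Y);
  eid := fun X => @eid _ V (co_ob X);
  ecomp := fun X Y Z => @ecomp _ V (co_ob X) (co_ob Y) (co_ob Z)
|}.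

Definition center_isopair (X Y : center_ob S) (f : isopair (co_ob X : B) (co_ob Y)) :
    @uisopair B center_ecat X Y :=
  @IsoPair (underlying center_ecat) X Y
    (fwd (vect_isopair f)) (bwd (vect_isopair f)).

Section Pullback.
Variables (uP : @is_ehalf_braiding B S (em_unit S) (@hb_unit (underlying_mon S)))
  (tP : forall X Y : center_ob S, @is_ehalf_braiding B S (em_ten (co_ob X) (co_ob Y))
    (@hb_ten (underlying_mon S) (co_ob X) (co_ob Y) (co_hb X) (co_hb Y))).

Let u : center_ob S := CenterOb uP.
Let t (X Y : center_ob S) : center_ob S := CenterOb (tP X Y).

(** The proofs [uP] and [tP] are components of the unit and product objects. As parameters they can
    be taken from any given center, whose unit and products then coincide with these on the nose. *)
Definition center_emon : emon_data B := {|
  em_cat := center_ecat;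
  em_unit := u : center_ecat;
  em_ten := t : center_ecat -> center_ecat -> center_ecat;
  em_tenm := fun X X' Y Y' => @em_tenm _ V (co_ob X) (co_ob X') (co_ob Y) (co_ob Y');
  em_asc := fun X Y Z => @center_isopair (t (t X Y) Z) (t X (t Y Z))
    (asc (co_ob X : B) (co_ob Y) (co_ob Z));
  em_lun := fun X => @center_isopair (t u X) X (lun (co_ob X : B));
  em_run := fun X => @center_isopair (t X u) X (run (co_ob X : B))
|}.

Definition vect_center : ebr_data B := @EBrData B center_emon
  (fun X Y => @center_isopair (t X Y) (t Y X) (brd (co_ob X : B) (co_ob Y))).

Let o (X : center_ob S) : V := co_ob X.
Let o2 (p : center_ob S * center_ob S) : V * V := (o p.1, o p.2).

(** Each axiom is, up to conversion, the one for the vector enrichment at the underlying objects. *)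
Lemma vect_center_ebraided : is_ebraided vect_center.
Proof.
have [[[c1 c2 c3] [[F1 F2] [[[l1 l2] l3] [[[r1 r2] r3] [[[a1 a2] a3] Hm]]]]]
  [com [[[b1 b2] b3] Hb]]] := vect_ebraided B.
have Hm' : is_monoidal (underlying_mon center_emon).
  have [[k1 k2 k3] [m1 [m2 [m3 [m4 [m5 [m6 [m7 [m8 [m9 m10]]]]]]]]]] := Hm.
  split; first split.
  - exact (fun X Y => k1 (o X) (o Y)).
  - exact (fun X Y => k2 (o X) (o Y)).
  - exact (fun W X Y Z => k3 (o W) (o X) (o Y) (o Z)).
  split; first exact (fun X Y => m1 (o X) (o Y)).
  split; first exact (fun X X' X'' Y Y' Y'' =>
    m2 (o X) (o X') (o X'') (o Y) (o Y') (o Y'')).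
  split; first exact (fun X Y Z => m3 (o X) (o Y) (o Z)).
  split; first exact (fun X => m4 (o X)).
  split; first exact (fun X => m5 (o X)).
  split; first exact (fun X X' Y Y' Z Z' =>
    m6 (o X) (o X') (o Y) (o Y') (o Z) (o Z')).
  split; first exact (fun X Y => m7 (o X) (o Y)).
  split; first exact (fun X Y => m8 (o X) (o Y)).
  split; first exact (fun W X Y Z => m9 (o W) (o X) (o Y) (o Z)).
  exact (fun X Y => m10 (o X) (o Y)).
have iso_pull (X Y : center_ob S) (f : @uHom B V (o X) (o Y)) :
    @is_iso (underlying V) (o X) (o Y) f -> @is_iso (underlying center_ecat) X Y f.
  by case=> g [p q]; exists g; split; [exact p | exact q].
split.
  split.
    split.
    - exact (fun W X Y Z => c1 (o W) (o X) (o Y) (o Z)).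
    - exact (fun X Y => c2 (o X) (o Y)).
    - exact (fun X Y => c3 (o X) (o Y)).
  split; first split.
  - exact (fun p => F1 (o2 p)).
  - exact (fun p q r => F2 (o2 p) (o2 q) (o2 r)).
  split; first split; first split.
  - exact (fun X Y => l1 (o X) (o Y)).
  - exact (fun X Y => l2 (o X) (o Y)).
  - exact (fun X => iso_pull (t u X) X _ (l3 (o X))).
  split; first split; first split.
  - exact (fun X Y => r1 (o X) (o Y)).
  - exact (fun X Y => r2 (o X) (o Y)).
  - exact (fun X => iso_pull (t X u) X _ (r3 (o X))).
  split; first split; first split.
  - exact (fun p q => a1 (o2 p.1, o p.2) (o2 q.1, o q.2)).
  - exact (fun p q => a2 (o2 p.1, o p.2) (o2 q.1, o q.2)).
  - exact (fun p => iso_pull (t (t p.1.1 p.1.2) p.2) (t p.1.1 (t p.1.2 p.2)) _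
      (a3 (o2 p.1, o p.2))).
  exact: Hm'.
split; first exact (fun p q => com (o2 p) (o2 q)).
split; first split; first split.
- exact (fun p q => b1 (o2 p) (o2 q)).
- exact (fun p q => b2 (o2 p) (o2 q)).
- exact (fun p => iso_pull (t p.1 p.2) (t p.2 p.1) _ (b3 (o2 p))).
split; first exact: Hm'.
have [_ [h1 [h2 [h3 h4]]]] := Hb.
split; first exact (fun X Y => h1 (o X) (o Y)).
split; first exact (fun X X' Y Y' => h2 (o X) (o X') (o Y) (o Y')).
split; first exact (fun X Y Z => h3 (o X) (o Y) (o Z)).
exact (fun X Y Z => h4 (o X) (o Y) (o Z)).
Qed.

End Pullback.

Lemma center_isopair_inverse (X Y : center_ob S) (f : isopair (co_ob X : B) (co_ob Y)) :
  mutually_inverse f -> @mutually_inverse (underlying center_ecat) X Y (center_isopair f).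
Proof. by move=> /vect_isopair_inverse[p q]; split; [exact p | exact q]. Qed.

(** The pulled-back vector enrichment is itself a valid choice of center, so the claim about every
    center is not vacuous. *)
Lemma center_exists : inhabited (drinfeld_center S).
Proof.
constructor.
refine (@DrinfeldCenter B S (fun X Y => vobj B (hom (co_ob X : B) (co_ob Y)))
  (fun X Y => hom_inc (co_ob X : B) (co_ob Y)) hom_inc_center_hom
  (fun X => @eid _ V (co_ob X)) (fun X => hom_inc_id (co_ob X : B))
  (fun X Y Z => @ecomp _ V (co_ob X) (co_ob Y) (co_ob Z))
  (fun X Y Z => hom_inc_comp (co_ob X : B) (co_ob Y) (co_ob Z))
  center_unitP center_tenP
  (fun X X' Y Y' => @em_tenm _ V (co_ob X) (co_ob X') (co_ob Y) (co_ob Y'))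
  (fun X X' Y Y' => hom_inc_ten (co_ob X : B) (co_ob X') (co_ob Y) (co_ob Y'))
  (@em_asc _ (center_emon center_unitP center_tenP))
  (fun X Y Z => hom_inc_isopair (asc (co_ob X : B) (co_ob Y) (co_ob Z)))
  (@em_lun _ (center_emon center_unitP center_tenP))
  (fun X => hom_inc_isopair (lun (co_ob X : B)))
  (@em_run _ (center_emon center_unitP center_tenP))
  (fun X => hom_inc_isopair (run (co_ob X : B)))
  (@eb_brd _ (vect_center center_unitP center_tenP)) _ _).
- move=> X Y; rewrite center_hb.
  exact: (proj1 (hom_inc_isopair (brd (co_ob X : B) (co_ob Y)))).
- move=> X Y.
  exact (@center_isopair_inverse (CenterOb (center_tenP X Y)) (CenterOb (center_tenP Y X))
    _ (brdK HB (co_ob X : B) (co_ob Y))).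
Qed.

(** * Comparison with an arbitrary center *)

Section Equivalence.
Variable Z : drinfeld_center S.

Local Notation D := (center_emon (dc_unitP Z) (dc_tenP Z)).
Local Notation Db := (vect_center (dc_unitP Z) (dc_tenP Z)).

Lemma center_comparison : exists phi : forall X Y : center_ob S,
    Mor (dc_hom Z X Y) (@ehom _ center_ecat X Y),
  forall X Y, is_iso (phi X Y) /\
    hom_inc (co_ob X : B) (co_ob Y) ∘ phi X Y = dc_inc Z X Y.
Proof.
exists (fun X Y => projT1 (cid (center_hom_unique (dc_homP Z X Y)))) => X Y.
exact: projT2 (cid (center_hom_unique (dc_homP Z X Y))).
Qed.

Lemma center_equivalent : ebraided_equivalent (center_ebr Z) (vect_enrichment B).
Proof.
have [J HJ] := center_comparison.
have J_iso (X Y : center_ob S) : is_iso (J X Y) := proj1 (HJ X Y).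
have JE (X Y : center_ob S) : hom_inc (co_ob X : B) (co_ob Y) ∘ J X Y = dc_inc Z X Y := proj2 (HJ X Y).
have J_mono (X Y : center_ob S) : is_mono (J X Y) := iso_mono HK (J_iso X Y).
have J_id (X : center_ob S) : J X X ∘ dc_id Z X = @eid _ center_ecat X.
  apply: hom_inc_mono; rewrite compA JE dc_idP.
  exact: esym (hom_inc_id (co_ob X : B)).
have J_comp (X Y W : center_ob S) : J X W ∘ dc_comp Z X Y W =
    @ecomp _ center_ecat X Y W ∘ (J Y W ⊠ J X Y).
  apply: hom_inc_mono; rewrite [LHS]compA JE dc_compP [RHS]compA.
  by rewrite hom_inc_comp -[RHS]compA -(ten_comp HB) !JE.
have J_ten (X X' Y Y' : center_ob S) : J (dc_ten Z X Y) (dc_ten Z X' Y') ∘ dc_tenm Z X X' Y Y' =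
    @em_tenm _ D X X' Y Y' ∘ (J X X' ⊠ J Y Y').
  apply: (@hom_inc_mono R B (co_ob X ⊗ co_ob Y : B) (co_ob X' ⊗ co_ob Y' : B)).
  rewrite [LHS]compA JE dc_tenmP [RHS]compA.
  by rewrite hom_inc_ten -[RHS]compA -(ten_comp HB) !JE.
(* Structure isomorphisms on both sides are determined by their images in the self-enrichment, where
   they agree. *)
have J_str (X Y : center_ob S) (f : isopair (co_ob X : B) (co_ob Y))
    (g : Mor 𝟙 (dc_hom Z X Y)) (g' : Mor 𝟙 (dc_hom Z Y X)) :
    dc_inc Z X Y ∘ g = fwd (self_isopair f) /\ dc_inc Z Y X ∘ g' = bwd (self_isopair f) ->
    J X Y ∘ g = fwd (center_isopair f) /\ J Y X ∘ g' = bwd (center_isopair f).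
  have [e1 e2] := hom_inc_isopair f.
  case=> h1 h2; split; apply: hom_inc_mono; rewrite compA JE ?h1 ?h2.
    exact: esym e1.
  exact: esym e2.
have J_asc (X Y W : center_ob S) := J_str _ _ _ _ _ (dc_ascP Z X Y W).
have J_lun (X : center_ob S) := J_str _ _ _ _ _ (dc_lunP Z X).
have J_run (X : center_ob S) := J_str _ _ _ _ _ (dc_runP Z X).
have J_brd (X Y : center_ob S) : J _ _ ∘ fwd (@dc_brd B S Z X Y) = fwd (@eb_brd _ Db X Y).
  apply: hom_inc_mono; rewrite compA JE dc_brdP center_hb.
  exact: esym (proj1 (hom_inc_isopair (brd (co_ob X : B) (co_ob Y)))).
have HD := vect_center_ebraided (dc_unitP Z) (dc_tenP Z).
split.
- exact (sub_ebraided HB (C := D) J_mono J_id J_comp J_ten J_asc J_lun J_run J_brd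
    (@dc_brdK B S Z) HD).
- exact: vect_ebraided.
have [F1 [F2 [F3 _]]] := sub_ebraided_equivalence HB (C := D) J_id J_comp J_ten
  J_asc J_lun J_run J_brd J_iso HD.
(* The functor forgets half-braidings. Apart from enriched naturality of its tensor constraint, its
   monoidal and braided axioms are read off from the comparison with the pulled-back enrichment. *)
exists (@EMFunData B (center_ebr Z) (vect_enrichment B)
  (@EFunData B (center_ebr Z) (vect_enrichment B) (fun X : center_ob S => co_ob X) J)
  (@eid B V 𝟙) (fun X Y : center_ob S => @eid B V (co_ob X ⊗ co_ob Y : B))).
destruct F1 as [f1 [[_ f4] [[f5 f6] [f7 [f8 [f9 [f10 [f11 f12]]]]]]]].
have iso_push (X Y : center_ob S) (f : @uHom B center_ecat X Y) :
    @is_iso (underlying center_ecat) X Y f -> @is_iso (underlying V) (co_ob X) (co_ob Y) f.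
  by case=> g [p q]; exists g; split; [exact p | exact q].
have G : is_monoidal_functor (underlying_mfun (@EMFunData B (center_ebr Z) (vect_enrichment B)
  (@EFunData B (center_ebr Z) (vect_enrichment B) (fun X : center_ob S => co_ob X) J)
  (@eid B V 𝟙) (fun X Y : center_ob S => @eid B V (co_ob X ⊗ co_ob Y : B)))).
  split; first split.
  - exact (fun X => f5 X).
  - exact (fun X Y W g f => f6 X Y W g f).
  split; first (exact (iso_push (dc_unit Z) (dc_unit Z) _ f7)).
  split; first (exact (fun X Y => iso_push (dc_ten Z X Y) (dc_ten Z X Y) _ (f8 X Y))).
  split; first (exact (fun X X' Y Y' f g => f9 X X' Y Y' f g)).
  split; first (exact (fun X Y W => f10 X Y W)).
  split; first (exact (fun X => f11 X)).
  exact (fun X => f12 X).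
split.
  split; first (exact f1).
  split; last exact: G.
  split; last exact (fun p => iso_push (dc_ten Z p.1 p.2) (dc_ten Z p.1 p.2) _ (f4 p)).
  apply: (enat_of_hom HB) => p q.
  have Vc := proj1 (vect_emonoidal B).
  change (@postcomp _ V _ _ _ (@eid B V (co_ob q.1 ⊗ co_ob q.2 : B)) ∘
    (@em_tenm _ D p.1 q.1 p.2 q.2 ∘ (J p.1 q.1 ⊠ J p.2 q.2)) =
    @precomp _ V _ _ _ (@eid B V (co_ob p.1 ⊗ co_ob p.2 : B)) ∘
    (J (dc_ten Z p.1 p.2) (dc_ten Z q.1 q.2) ∘ dc_tenm Z p.1 q.1 p.2 q.2)).
  rewrite (postcomp_id HB _ _ Vc) (precomp_id HB _ _ Vc).
  by rewrite J_ten.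
split.
  split; first exact: G.
  exact (fun X Y => proj2 F2 X Y).
split; first exact J_iso.
(* Every object carries the half-braiding given by its braiding, so the functor is surjective on
   objects. *)
move=> d; exists (center_of d); exists (@eid B V d).
have HV : is_category (underlying V) := proj1 (proj1 (vect_underlying_braided B)).
exact (iso_mid HV d).
Qed.

End Equivalence.

End Center.

Theorem corollary4p9 (R : realType) (B : braided_fusion R)
    (hB : nondegenerate_braided B) :
  is_emonoidal (self_enrichment B) /\
  inhabited (drinfeld_center (self_enrichment B)) /\
  forall Z : drinfeld_center (self_enrichment B),
    ebraided_equivalent (center_ebr Z) (vect_enrichment B).
Proof.
split; first exact: self_emonoidal.
split; first exact: center_exists.
exact: center_equivalent.
Qed.
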